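(* Let $\sigma>0$ and let $X=\{x_i:i\in\mathbb{Z}\}$, $\cdots<x_{i-1}<x_i<x_{i+1}<\cdots$, be a separated set of real numbers such that $\sup_{i\in\mathbb{Z}}(x_{i+1}-x_i)<\frac{2\pi}{\sigma}$. Then there exists a Bessel sequence $\{g_{1,i},\,g_{2,i}:i\in\mathbb{Z}\}$ in $\mathcal{B}_\sigma$ such that $$f'(x)=\sum_{i\in\mathbb{Z}} f(x_i)\,g_{1,i}(x)+\sum_{i\in\mathbb{Z}} f'(x_i)\,g_{2,i}(x)$$ for every $f\in\mathcal{B}_\sigma$. The function $f$ can be computed using the relation $$f(x)=\int_{x_i}^x f'(t)\,\mathrm{d}t+f(x_i).$$
   Context: The Fourier transform is $\widehat f(w)=\int_{\mathbb{R}} f(x)e^{-2\pi i w x}\,\mathrm{d}x$, extended to $L^2(\mathbb{R})$. For $\sigma>0$, $\mathcal{B}_\sigma=\{f\in L^2(\mathbb{R}):\operatorname{supp}\widehat f\subseteq[-\frac{\sigma}{2\pi},\frac{\sigma}{2\pi}]\}$, a closed subspace of $L^2(\mathbb{R})$; its elements are identified with (restrictions to $\mathbb{R}$ of) entire functions of exponential type $\le\sigma$ that are square integrable on the real axis, so point values of $f$ and its derivatives make sense. A set $\{x_i:i\in\mathbb{Z}\}$ of real numbers is separated if there is $\gamma>0$ with $\inf_{i\neq j}|x_i-x_j|\ge\gamma$. A family $\{h_n\}$ in a Hilbert space $\mathcal{H}$ is a Bessel sequence if there is $B>0$ with $\sum_n|\langle f,h_n\rangle|^2\le B\|f\|^2$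 for all $f\in\mathcal{H}$. Here $\{g_{1,i},g_{2,i}:i\in\mathbb{Z}\}$ is regarded as one countable family in $\mathcal{B}_\sigma$. *)

(* Defs.v *)
From HB Require Import structures.
From mathcomp Require Import all_boot all_order all_algebra finmap.
From mathcomp Require Import all_classical all_reals all_analysis.
From mathcomp Require Import complex.
From mathcomp.analysis Require Import showcase.summability.

Set Implicit Arguments.
Unset Strict Implicit.
Unset Printing Implicit Defensive.
Import Order.TTheory GRing.Theory Num.Theory.
Import numFieldNormedType.Exports.

Local Open Scope classical_set_scope.
Local Open Scope ring_scope.

Local Notation normc := ComplexField.Normc.normc.

Section ComplexValued.
Context {R : realType}.
Local Notation C := (R[i]).
Local Notation mu := (@lebesgue_measure R).
Implicit Types (f g h : R -> C) (D : set R).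

Definition cintegral D f : C :=
  (\int[mu]_(t in D) complex.Re (f t) +i* \int[mu]_(t in D) complex.Im (f t))%C.

                                                        
Definition ointegral (a b : R) f : C :=
  if a <= b then cintegral `[a, b] f else - cintegral `[b, a] f.

Definition cderive f (t : R) : C :=
  (derive1 (fun s => complex.Re (f s)) t +i*
   derive1 (fun s => complex.Im (f s)) t)%C.

Definition cLfun (p : \bar R) f : Prop :=
  ((fun t => complex.Re (f t)) \in Lfun mu p) /\
  ((fun t => complex.Im (f t)) \in Lfun mu p).

Definition L2norm f : \bar R := Lnorm mu 2%:E (fun t => (normc (f t))%:E).

Definition L2dot f h : C := cintegral setT (fun t => f t * conjc (h t)).

End ComplexValued.

Section PaleyWiener.
Context {R : realType}.
Local Notation C := (R[i]).
Local Notation mu := (@lebesgue_measure R).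
Implicit Types (f g h : R -> C).

Definition fourier1 f (w : R) : C :=
  cintegral setT (fun t =>
    f t * (cos (2 * pi * w * t) -i* sin (2 * pi * w * t))%C).

                                                                        
                                                                             
                                                                           
Definition is_fourier2 f g : Prop :=
  cLfun 2%:E g /\
  exists u : nat -> R -> C,
    [/\ forall n, cLfun 1%:E (u n) /\ cLfun 2%:E (u n),
        L2norm (fun t => u n t - f t) @[n --> \oo] --> 0%E
      & L2norm (fun w => fourier1 (u n) w - g w) @[n --> \oo] --> 0%E].

                                                                            
                                                
Definition ess_support g : set R :=
  [set w | forall U : set R, open U -> U w ->
     ~ {ae mu, forall t, U t -> g t = 0}].

Definition entire (F : C^o -> C^o) : Prop := forall z, derivable F z 1.

Definition exponential_type_le (sigma : R) (F : C -> C) : Prop :=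
  forall eps : R, 0 < eps -> exists A : R,
    forall z, normc (F z) <= A * expR ((sigma + eps) * normc z).

                                                                          
                                                                           
                                     
Definition bandlimited (sigma : R) f : Prop :=
  [/\ cLfun 2%:E f,
      exists2 g, is_fourier2 f g &
        ess_support g `<=` `[- (sigma / (2 * pi)), sigma / (2 * pi)]
    & exists F : C -> C,
        [/\ entire F, exponential_type_le sigma F & forall t, f t = F t%:C%C]].

Definition bessel_sequence (sigma : R) (I : choiceType) (h : I -> R -> C) :
    Prop :=
  (forall n, bandlimited sigma (h n)) /\
  exists2 B : R, 0 < B & forall f, bandlimited sigma f ->
    (\esum_(n in [set: I]) ((normc (L2dot f (h n)) ^+ 2)%:E)
     <= B%:E * L2norm f ^+ 2)%E.

                                                                              
                     
Definition has_function_sum (I : choiceType) (h : I -> R -> C) (S : R -> C) :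
    Prop :=
  L2norm (fun t => partial_sum (h ^~ t) J - S t) @[J --> totally] --> 0%E /\
  forall t, partial_sum (fun n => h n t : C^o) J @[J --> totally] -->
    (S t : C^o).

Definition separated_points (x : int -> R) : Prop :=
  exists2 gamma : R, 0 < gamma &
    (gamma%:E <= ereal_inf [set `|x p.1 - x p.2|%:E | p in
                              [set p : int * int | p.1 <> p.2]])%E.

Definition max_gap (x : int -> R) : \bar R :=
  ereal_sup [set (x (i + 1) - x i)%:E | i in [set: int]].

End PaleyWiener.

(* Main.v *)
Require Import Defs.
From HB Require Import structures.
From mathcomp Require Import all_boot all_order all_algebra finmap.
From mathcomp Require Import all_classical all_reals all_analysis.
From mathcomp Require Import measurable_realfun complex ring lra.
From mathcomp.analysis Require Import showcase.summability.

Set Implicit Arguments.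
Unset Strict Implicit.
Unset Printing Implicit Defensive.
Import Order.TTheory GRing.Theory Num.Theory.
Import numFieldNormedType.Exports.

Local Open Scope classical_set_scope.
Local Open Scope ring_scope.

(** The Hartley transform [H u (w) = \int u(t) (cos (2 pi w t) + sin (2 pi w t)) dt]
    is a real L2-isometry and an involution, and [f] is bandlimited to [sigma]
    exactly when its real and imaginary parts are Hartley transforms of square
    integrable functions vanishing off [[- b, b]], where [b = sigma / (2 pi)].
    On this Hilbert space the functionals [u |-> (H u)(x_i)] and
    [u |-> (H u)'(x_i)] form a frame.  The upper bound is a local sampling
    estimate.  For the lower bound, the gaps are at most [del < 2 pi / sigma], so
    for some [k > sigma] the periodic Wirtinger inequality, applied to [f'] minus
    an affine function on every [[x_i, x_(i+1)]], gives
    [k^2 \int f'^2 <= (1 + eta) \int f''^2 + C (sum of squared samples)];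
    since [norm f'' <= sigma norm f'], the samples control [f'], and then [f].
    The dual frame [d_k] reconstructs [f] from its samples, and because
    differentiation is bounded on bandlimited functions, [g_k = (H d_k)'] are the
    required functions. *)

(** * Derivatives and continuity *)

(** The Hartley transform replaces the Fourier transform because it keeps real functions real and is
    its own inverse: the Hilbert space theory is done over [R], on actual functions, and the real
    and imaginary parts of [f] share one real family [d k]. The critical gap [2 pi / sigma] is twice
    the Nyquist spacing [pi / sigma]. It is reached because [f] and [f'] at both ends of a gap of
    length [L] determine the mean and the increment of [f'] there, so that the affine correction
    leaves a periodic function of mean zero, whose Wirtinger constant [L / (2 pi)] is half the
    Dirichlet constant [L / pi]. The correction costs only samples, and [1 + eta] is the price of
    separating it, paid from the strictness of [del < 2 pi / sigma]. The two series of the theorem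
    must converge separately, which the expansion in the joint frame does not give by itself; this
    is why a synthesis bound for the dual frame is carried along with the reconstruction property.
    Convergence is obtained for spectra and transported by two bounded maps, differentiation and
    point evaluation. *)

Section Calculus.
Context {R : realType}.
Implicit Types (f g : R -> R) (x a b c : R).

Lemma dcst c x : is_derive x (1 : R) (fun _ : R => c) (0 : R).
Proof. exact: is_derive_cst. Qed.

Lemma did x : is_derive x (1 : R) (fun y : R => y) (1 : R).
Proof. exact: is_derive_id. Qed.

Lemma dD f g x a b : is_derive x (1 : R) f a -> is_derive x (1 : R) g b ->
  is_derive x (1 : R) (fun y => f y + g y) (a + b).
Proof. by move=> df dg; exact: is_deriveD. Qed.

Lemma dN f x a : is_derive x (1 : R) f a -> is_derive x (1 : R) (fun y => - f y) (- a).
Proof. by move=> df; exact: is_deriveN. Qed.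

Lemma dB f g x a b : is_derive x (1 : R) f a -> is_derive x (1 : R) g b ->
  is_derive x (1 : R) (fun y => f y - g y) (a - b).
Proof. by move=> df dg; apply: dD => //; exact: dN. Qed.

Lemma dM f g x a b : is_derive x (1 : R) f a -> is_derive x (1 : R) g b ->
  is_derive x (1 : R) (fun y => f y * g y) (a * g x + f x * b).
Proof.
move=> df dg; apply: is_derive_eq.
by rewrite addrC /GRing.scale/= [g x * a]mulrC.
Qed.

Lemma dZ c f x a : is_derive x (1 : R) f a -> is_derive x (1 : R) (fun y => c * f y) (c * a).
Proof. by move=> df; apply: is_derive_eq (dM (dcst c x) df) _; rewrite mul0r add0r. Qed.

Lemma dcomp f g x a b : is_derive (f x) (1 : R) g b -> is_derive x (1 : R) f a ->
  is_derive x (1 : R) (fun y => g (f y)) (b * a).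
Proof. by move=> dg df; apply: is_derive_eq; rewrite mulrC. Qed.

Lemma dsqr f x a : is_derive x (1 : R) f a -> is_derive x (1 : R) (fun y => f y ^+ 2) (2 * f x * a).
Proof.
move=> df; have := dM df df; under eq_fun do rewrite -expr2.
by move=> h; apply: is_derive_eq h _; ring.
Qed.

Lemma is_derive_continuous f x a : is_derive x (1 : R) f a -> {for x, continuous f}.
Proof.
by case=> h _; apply: differentiable_continuous; exact/derivable1_diffP.
Qed.

Lemma continuous_add f g : continuous f -> continuous g -> continuous (fun x => f x + g x).
Proof. by move=> cf cg x; apply: cvgD; [exact: cf|exact: cg]. Qed.

Lemma continuous_mul f g : continuous f -> continuous g -> continuous (fun x => f x * g x).
Proof. by move=> cf cg x; apply: cvgM; [exact: cf|exact: cg]. Qed.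

Lemma continuous_sub f g : continuous f -> continuous g -> continuous (fun x => f x - g x).
Proof. by move=> cf cg x; apply: cvgB; [exact: cf|exact: cg]. Qed.

Lemma continuous_scale c f : continuous f -> continuous (fun x => c * f x).
Proof. by move=> cf x; apply: cvgMr; exact: cf. Qed.

Lemma continuous_compose f g : continuous f -> continuous g -> continuous (fun x => g (f x)).
Proof. by move=> cf cg x; apply: (@continuous_comp _ _ _ f g); [exact: cf|exact: cg]. Qed.

Lemma continuous_sqr f : continuous f -> continuous (fun x => f x ^+ 2).
Proof. by move=> cf; exact: (continuous_mul cf cf). Qed.

Lemma continuous_inv f : (forall x, f x != 0) -> continuous f -> continuous (fun x => (f x)^-1).
Proof. by move=> f0 cf x; apply: cvgV; [exact: f0|exact: cf]. Qed.

Lemma continuous_const c : continuous (fun _ : R => c).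
Proof. by move=> x; exact: cvg_cst. Qed.

Lemma continuous_ident : continuous (fun x : R => x).
Proof. by move=> x; exact: cvg_id. Qed.

End Calculus.

(** * Semi-inner products and frames *)

Section SemiInner.
Context {R : realType} {U : lmodType R}.
Implicit Types (P : U -> Prop) (B : U -> U -> R).

(** Elements are functions, not classes modulo null sets, so [B u u = 0] need not force [u = 0], and
    limits and representers are unique only up to null elements. [P] cuts out the functions on which
    [B] is a genuine bilinear form. *)
Record semi_inner P B : Prop := SemiInner {
  si_0 : P 0;
  si_lin : forall a u v, P u -> P v -> P (a *: u + v);
  si_sym : forall u v, P u -> P v -> B u v = B v u;
  si_linl : forall a u v w, P u -> P v -> P w ->
    B (a *: u + v) w = a * B u w + B v w;
  si_ge0 : forall u, P u -> 0 <= B u u }.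

Definition complete_for P B :=
  forall u : nat -> U, (forall n, P (u n)) ->
  (forall e : R, 0 < e -> exists N, forall m n, (N <= m)%N -> (N <= n)%N ->
     B (u m - u n) (u m - u n) <= e) ->
  exists2 l, P l &
    forall e : R, 0 < e -> exists N, forall n, (N <= n)%N ->
      B (u n - l) (u n - l) <= e.

Section Theory.
Variables (P : U -> Prop) (B : U -> U -> R).
Hypothesis SI : semi_inner P B.

Lemma siP_add u v : P u -> P v -> P (u + v).
Proof. by move=> Pu Pv; rewrite -[u]scale1r; apply: (si_lin SI). Qed.

Lemma siP_scale a u : P u -> P (a *: u).
Proof. by move=> Pu; rewrite -[_ *: _]addr0; apply: (si_lin SI) => //; exact: si_0 SI. Qed.

Lemma siP_opp u : P u -> P (- u).
Proof. by move=> Pu; rewrite -scaleN1r; exact: siP_scale. Qed.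

Lemma siP_sub u v : P u -> P v -> P (u - v).
Proof. by move=> Pu Pv; apply: siP_add => //; exact: siP_opp. Qed.

Lemma siP_sum (I : Type) (s : seq I) (Q : pred I) (F : I -> U) :
  (forall i, P (F i)) -> P (\sum_(i <- s | Q i) F i).
Proof.
move=> PF; elim/big_ind: _ => //; first exact: si_0 SI.
exact: siP_add.
Qed.

Lemma siDl u v w : P u -> P v -> P w -> B (u + v) w = B u w + B v w.
Proof. by move=> *; rewrite -[u]scale1r (si_linl SI)// scale1r mul1r. Qed.

Lemma si0l w : P w -> B 0 w = 0.
Proof.
move=> Pw; have P0 := si_0 SI; have := siDl P0 P0 Pw.
by rewrite addr0 => /eqP; rewrite -subr_eq0 opprD addNKr oppr_eq0 => /eqP.
Qed.

Lemma siZl a u w : P u -> P w -> B (a *: u) w = a * B u w.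
Proof.
move=> Pu Pw; rewrite -[_ *: _]addr0 (si_linl SI)//; last exact: si_0 SI.
by rewrite si0l// addr0.
Qed.

Lemma siNl u w : P u -> P w -> B (- u) w = - B u w.
Proof. by move=> *; rewrite -scaleN1r siZl// mulN1r. Qed.

Lemma siDr u v w : P u -> P v -> P w -> B w (u + v) = B w u + B w v.
Proof.
move=> Pu Pv Pw; rewrite (si_sym SI)//; last exact: siP_add.
by rewrite siDl// !(si_sym SI Pw).
Qed.

Lemma siZr a u w : P u -> P w -> B w (a *: u) = a * B w u.
Proof.
move=> Pu Pw; rewrite (si_sym SI)//; last exact: siP_scale.
by rewrite siZl// (si_sym SI Pw).
Qed.

Lemma siNr u w : P u -> P w -> B w (- u) = - B w u.
Proof. by move=> *; rewrite -scaleN1r siZr// mulN1r. Qed.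

Lemma si_sqrD u v : P u -> P v ->
  B (u + v) (u + v) = B u u + 2 * B u v + B v v.
Proof.
move=> Pu Pv; have Puv := siP_add Pu Pv.
by rewrite siDl// !siDr// (si_sym SI Pv Pu); ring.
Qed.

Lemma si_sqrB u v : P u -> P v ->
  B (u - v) (u - v) = B u u - 2 * B u v + B v v.
Proof.
move=> Pu Pv; have Pv' := siP_opp Pv.
by rewrite si_sqrD// !siNr// siNl//; ring.
Qed.

Lemma si_sqrZ a u : P u -> B (a *: u) (a *: u) = a ^+ 2 * B u u.
Proof. by move=> Pu; have Pau := siP_scale a Pu; rewrite siZl// siZr//; ring. Qed.

Lemma si_suml (I : Type) (s : seq I) (F : I -> U) w :
  (forall i, P (F i)) -> P w -> B (\sum_(i <- s) F i) w = \sum_(i <- s) B (F i) w.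
Proof.
move=> PF Pw; elim: s => [|i s IH]; first by rewrite !big_nil si0l.
by rewrite !big_cons siDl// ?IH//; exact: siP_sum.
Qed.

Lemma si_young (e : R) u v : 0 < e -> P u -> P v ->
  2 * B u v <= e * B u u + e^-1 * B v v.
Proof.
move=> e0 Pu Pv.
have := si_ge0 SI (siP_sub (siP_scale e Pu) Pv).
rewrite si_sqrB//; last exact: siP_scale.
rewrite si_sqrZ// siZl// => h.
rewrite -(ler_pM2l e0) mulrDr [e * (e^-1 * _)]mulrA divff ?gt_eqF// mul1r.
by move: h; rewrite expr2; lra.
Qed.

Lemma si_sqrD_le (e : R) u v : 0 < e -> P u -> P v ->
  B (u + v) (u + v) <= (1 + e) * B u u + (1 + e^-1) * B v v.
Proof. by move=> e0 Pu Pv; rewrite si_sqrD//; have := si_young e0 Pu Pv; lra. Qed.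

Lemma si_sqrD_le2 u v : P u -> P v -> B (u + v) (u + v) <= 2 * B u u + 2 * B v v.
Proof. by move=> Pu Pv; have := si_sqrD_le ltr01 Pu Pv; rewrite invr1; lra. Qed.

Lemma si_sqrB_le2 u v : P u -> P v -> B (u - v) (u - v) <= 2 * B u u + 2 * B v v.
Proof.
by move=> Pu Pv; have := si_sqrD_le2 Pu (siP_opp Pv); rewrite siNl ?siNr ?opprK//; exact: siP_opp.
Qed.

Lemma si_cauchy_schwarz u v : P u -> P v -> (B u v) ^+ 2 <= B u u * B v v.
Proof.
move=> Pu Pv; have A0 := si_ge0 SI Pu; have D0 := si_ge0 SI Pv.
have q t : 0 <= t ^+ 2 * B u u + 2 * t * B u v + B v v.
  have := si_ge0 SI (siP_add (siP_scale t Pu) Pv).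
  by rewrite si_sqrD//; [rewrite si_sqrZ// siZl// mulrA|exact: siP_scale].
(* If [B u u = 0] the form is affine in [t]; unless [B u v = 0], the chosen [t] gives it the value
   [-1]. Otherwise [t] is taken at the minimum. *)
move: A0; rewrite le_eqVlt => /predU1P[A0|A0].
  rewrite -A0 mul0r; case: (eqVneq (B u v) 0) => [->|C0]; first by rewrite expr0n.
  have := q (- (B v v + 1) / (2 * B u v)); rewrite -A0 mulr0 add0r.
  by rewrite [X in X + _ _ _](_ : _ = - (B v v + 1)); [lra|field].
have := q (- B u v / B u u).
rewrite [X in 0 <= X](_ : _ = (B u u * B v v - (B u v) ^+ 2) / B u u); last first.
  by field; rewrite gt_eqF.
by rewrite pmulr_lge0 ?invr_gt0// subr_ge0.
Qed.

(** Minimise [B u u - 2 F u]: the parallelogram law makes a minimising sequence Cauchy, and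
    stationarity of its limit in every direction is the representation. Null elements do no harm in
    this argument. *)
Lemma riesz_representation (F : U -> R) (C : R) :
  complete_for P B ->
  (forall a u v, P u -> P v -> F (a *: u + v) = a * F u + F v) ->
  (forall u, P u -> (F u) ^+ 2 <= C * B u u) ->
  exists2 d, P d & forall v, P v -> F v = B v d.
Proof.
move=> cplt Flin Fbd.
have F0 : F 0 = 0.
  by have := Flin 1 0 0 (si_0 SI) (si_0 SI); rewrite scale1r mul1r addr0; lra.
have FZ a u : P u -> F (a *: u) = a * F u.
  by move=> Pu; rewrite -[_ *: _]addr0 Flin ?F0 ?addr0//; exact: si_0 SI.
have FD u v : P u -> P v -> F (u + v) = F u + F v.
  by move=> Pu Pv; rewrite -[u in LHS]scale1r Flin// mul1r.
pose J u := B u u - 2 * F u.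
(* [(2 F u)^2 <= 4 |C| B u u <= (B u u + |C|)^2]; the absolute value is there because the sign of
   [C] is not known. *)
have Jge u : P u -> - `|C| <= J u.
  move=> Pu; rewrite /J; have b0 := si_ge0 SI Pu; have := Fbd _ Pu => Fb.
  have Fb' : F u ^+ 2 <= `|C| * B u u.
    by rewrite (le_trans Fb)// ler_wpM2r// ler_norm.
  suff : 2 * F u <= B u u + `|C| by lra.
  rewrite leNgt; apply/negP => h.
  have c0 : 0 <= `|C| by [].
  have : (B u u + `|C|) ^+ 2 < (2 * F u) ^+ 2.
    by rewrite ltr_pXn2r// ?nnegrE; lra.
  by rewrite exprMn; have := sqr_ge0 (B u u - `|C|); rewrite !expr2; nra.
pose A := [set J u | u in P].
have A0 : A !=set0 by exists (J 0); exists 0 => //; exact: si_0 SI.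
have Alb : has_inf A.
  by split => //; exists (- `|C|) => _ [u Pu <-]; exact: Jge.
set m := inf A.
have mJ u : P u -> m <= J u by move=> Pu; apply: ge_inf; [case: Alb|exists u].
have ex n : exists u, P u /\ J u <= m + n.+1%:R^-1.
  have : 0 < n.+1%:R^-1 :> R by rewrite invr_gt0 ltr0n.
  by move=> e0; have [_ [u Pu <-] /ltW h] := inf_adherent e0 Alb; exists u.
pose u n := sval (cid (ex n)).
have Pu n : P (u n) by rewrite /u; case: cid => ? [].
have Ju n : J (u n) <= m + n.+1%:R^-1 by rewrite /u; case: cid => ? [].
(* Parallelogram identity, with [J] at the midpoint bounded below by [m]. *)
have par v w : P v -> P w -> B (v - w) (v - w) <= 2 * (J v + J w - 2 * m).
  move=> Pv Pw; have Pvw := siP_add Pv Pw.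
  have := mJ _ (siP_scale 2^-1 Pvw); rewrite /J si_sqrZ// FZ// FD// si_sqrD// si_sqrB//.
  by lra.
have arch (e : R) : 0 < e -> exists N, forall n, (N <= n)%N -> n.+1%:R^-1 <= e.
  move=> e0; exists (Num.truncn e^-1) => n Nn.
  rewrite invf_ple ?posrE ?ltr0n//.
  apply/ltW/(lt_le_trans (truncnS_gt _)).
  by rewrite ler_nat ltnS.
have [l Pl ul] : exists2 l, P l &
    forall e : R, 0 < e -> exists N, forall n, (N <= n)%N ->
      B (u n - l) (u n - l) <= e.
  apply: cplt => // e e0; have [|N hN] := arch (e / 4); first by lra.
  exists N => p q Np Nq; have := par _ _ (Pu p) (Pu q).
  have := Ju p; have := Ju q; have := hN _ Np; have := hN _ Nq.
  by move: (q.+1%:R^-1) (p.+1%:R^-1) => a b; lra.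
exists l => // v Pv.
(* Compare [J (u n + t v)] with the infimum. Replacing [u n] by [l] in the cross term costs, by
   Young, a second copy of [t^2 B v v], hence the factor [2] in front of [t ^+ 2]. *)
have key t : 0 <= 2 * t * (B v l - F v) + 2 * t ^+ 2 * B v v.
  rewrite leNgt; apply/negP => k0.
  set k := (X in X < 0) in k0.
  have kk : 0 < - k / 4 by lra.
  have [N1 h1] := arch _ kk; have [N2 h2] := ul _ kk.
  pose n := maxn N1 N2.
  have n1 := h1 n (leq_maxl _ _); have n2 := h2 n (leq_maxr _ _).
  have Ptv := siP_scale t Pv.
  have := mJ _ (siP_add (Pu n) Ptv).
  rewrite /J si_sqrD// si_sqrZ// FD// FZ// siZr//.
  have := Ju n; rewrite /J.
  have := si_young ltr01 (siP_sub (Pu n) Pl) Ptv.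
  rewrite invr1 si_sqrZ// siZr//; last exact: siP_sub.
  rewrite siDl//; last exact: siP_opp.
  rewrite siNl// (si_sym SI Pl Pv).
  move: n1 n2 k0; rewrite /k; move: (n.+1%:R^-1) => a; lra.
set x := B v l - F v.
suff : x = 0 by rewrite /x; lra.
have D0 := si_ge0 SI Pv; set D := B v v in D0 *.
case: (eqVneq x 0) => // x0; exfalso.
(* At this [t] the expression is [- x^2 (D + 2) / (2 (D + 1)^2)]; [D + 1] in place of [D] admits a
   null [v]. *)
have := key (- x / (2 * (D + 1))); rewrite -/x -/D.
have D1 : 0 < D + 1 by lra.
rewrite [X in 0 <= X](_ : _ = - (x ^+ 2 * (D + 2) / (2 * (D + 1) ^+ 2))); last first.
  by field; rewrite gt_eqF.
rewrite oppr_ge0 leNgt => /negP; apply.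
have D2 : 0 < D + 2 by lra.
by apply: divr_gt0; apply: mulr_gt0 => //; [rewrite exprn_even_gt0|rewrite exprn_gt0].
Qed.
End Theory.
End SemiInner.

#[local] Existing Instance totally_filter.

(* [cvgrPdist_le] with the radius typed as an element of [R], as [lra] needs. *)
Lemma cvg_dist_le {R : realType} {T : Type} (F : set_system T) {FF : Filter F}
    (f : T -> R) (l : R) :
  (forall e : R, 0 < e -> \forall t \near F, `|l - f t| <= e) -> f @ F --> l.
Proof. by move=> h; apply/cvgrPdist_le => e; exact: h. Qed.

Lemma invSn_le {R : realType} (e : R) : 0 < e ->
  exists N, forall n, (N <= n)%N -> n.+1%:R^-1 <= e.
Proof.
move=> e0; exists (Num.truncn e^-1) => n Nn.
rewrite invf_ple ?posrE ?ltr0n//.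
by apply/ltW/(lt_le_trans (truncnS_gt _)); rewrite ler_nat ltnS.
Qed.

(** * Sums over finite sets of indices *)

Section FiniteSums.
Context {R : realType} {K : choiceType}.
Implicit Types (J : {fset K}).
Local Open Scope fset_scope.
Local Open Scope ring_scope.

Lemma totallyP (Q : set {fset K}) :
  (\forall J \near totally, Q J) <-> exists J0, forall J, J0 `<=` J -> Q J.
Proof.
split; first by case=> J0 _ h; exists J0 => J; exact: h.
by case=> J0 h; exists J0.
Qed.

Lemma sum_fset_split (V : nmodType) (a : K -> V) J0 J : J0 `<=` J ->
  \sum_(k <- J) a k = \sum_(k <- J0) a k + \sum_(k <- J `\` J0) a k.
Proof.
move=> J0J; rewrite -big_cat; apply: perm_big; apply: uniq_perm.
- exact: fset_uniq.
- rewrite cat_uniq !fset_uniq/= andbT; apply/hasPn => k.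
  by rewrite inE => /andP[].
- move=> k; rewrite mem_cat inE.
  by case: (boolP (k \in J0)) => //= kJ0; rewrite (fsubsetP J0J).
Qed.

Lemma ler_sum_fset (a : K -> R) J0 J : (forall k, 0 <= a k) -> J0 `<=` J ->
  \sum_(k <- J0) a k <= \sum_(k <- J) a k.
Proof. by move=> a0 h; rewrite (sum_fset_split _ h) lerDl sumr_ge0. Qed.

Lemma bounded_sum_cvg (a : K -> R) (M : R) : (forall k, 0 <= a k) ->
  (forall J, \sum_(k <- J) a k <= M) ->
  exists S : R, [/\ (fun J => \sum_(k <- J) a k) @ totally --> S,
    (forall J, \sum_(k <- J) a k <= S) &
    forall e : R, 0 < e -> exists J, S - e < \sum_(k <- J) a k].
Proof.
move=> a0 aM.
pose A : set R := [set x | exists J, x = \sum_(k <- J) a k].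
have hs : has_sup A.
  by split; [exists (\sum_(k <- fset0) a k), fset0|exists M => _ [J ->]].
have ub J : \sum_(k <- J) a k <= sup A.
  by apply: ub_le_sup; [case: hs|exists J].
have adh (e : R) : 0 < e -> exists J, sup A - e < \sum_(k <- J) a k.
  by move=> e0; have [_ [J ->] h] := sup_adherent e0 hs; exists J.
exists (sup A); split => //.
apply: cvg_dist_le => e e0; apply/totallyP; have [J0 hJ0] := adh _ e0.
exists J0 => J J0J; have := ler_sum_fset a0 J0J; have := ub J.
move: hJ0; move: (sup A) => x; move: (\sum_(k <- J0) a k) (\sum_(k <- J) a k) => y z h1 h2 h3. rewrite ger0_norm; [|lra]. lra.
Qed.

End FiniteSums.

(** * Synthesis operators and dual frames *)

Section Frames.
Context {R : realType} {U : lmodType R} {K : choiceType}.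
Variables (P : U -> Prop) (ip : U -> U -> R).
Hypothesis SI : semi_inner P ip.
Hypothesis cplt : complete_for P ip.
Local Open Scope fset_scope.
Local Open Scope ring_scope.

(** Tails of a square summable family are small, so the synthesis bound makes the partial sums
    Cauchy. Completeness speaks of sequences while the sum runs over finite sets, hence the detour
    through the sets [Jn n]. *)
Lemma bessel_synthesis (d : K -> U) (A : R) (a : K -> R) (M : R) :
  (forall k, P (d k)) ->
  (forall (J : {fset K}) (a : K -> R),
     ip (\sum_(k <- J) a k *: d k) (\sum_(k <- J) a k *: d k)
       <= A * \sum_(k <- J) a k ^+ 2) ->
  (forall J : {fset K}, \sum_(k <- J) a k ^+ 2 <= M) ->
  exists2 s, P s & forall e : R, 0 < e -> exists J0, forall J, J0 `<=` J ->
    ip (\sum_(k <- J) a k *: d k - s) (\sum_(k <- J) a k *: d k - s) <= e.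
Proof.
move=> Pd dA aM; set u := fun J : {fset K} => \sum_(k <- J) a k *: d k.
have Pu J : P (u J) by apply: (siP_sum SI) => k; exact: (siP_scale SI).
have [|S [_ Sub Sadh]] := bounded_sum_cvg _ aM; first by move=> k; exact: sqr_ge0.
have ex n : exists J : {fset K}, S - n.+1%:R^-1 < \sum_(k <- J) a k ^+ 2.
  by apply: Sadh; rewrite invr_gt0.
(* [Jn n] misses less than [1 / (n + 1)] of the total [S], so a finite set disjoint from it carries
   less than that. *)
pose Jn n := sval (cid (ex n)).
have hJn n : S - n.+1%:R^-1 < \sum_(k <- Jn n) a k ^+ 2 by rewrite /Jn; case: cid.
have A'0 : 0 <= `|A| by [].
have near n J : Jn n `<=` J -> ip (u J - u (Jn n)) (u J - u (Jn n)) <= `|A| * n.+1%:R^-1.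
  move=> nJ; rewrite /u (sum_fset_split _ nJ) addrC addrA addNr add0r.
  apply: (le_trans (dA _ _)).
  apply: (@le_trans _ _ (`|A| * \sum_(k <- J `\` Jn n) a k ^+ 2)).
    by rewrite ler_wpM2r ?sumr_ge0// => *; [exact: sqr_ge0|exact: ler_norm].
  rewrite ler_wpM2l//; have := Sub J; rewrite (sum_fset_split _ nJ).
  have := hJn n; move: (n.+1%:R^-1) => b; lra.
have near2 m n : ip (u (Jn m) - u (Jn n)) (u (Jn m) - u (Jn n))
    <= 2 * `|A| * m.+1%:R^-1 + 2 * `|A| * n.+1%:R^-1.
  set J := Jn m `|` Jn n.
  have -> : u (Jn m) - u (Jn n) = (u J - u (Jn n)) - (u J - u (Jn m)).
    by rewrite opprB [RHS]addrC addrA subrK.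
  have := si_sqrB_le2 SI (siP_sub SI (Pu J) (Pu (Jn n))) (siP_sub SI (Pu J) (Pu (Jn m))).
  have := near n J (fsubsetUr _ _); have := near m J (fsubsetUl _ _).
  by move: (n.+1%:R^-1) (m.+1%:R^-1) => b c; lra.
have small (e : R) : 0 < e -> exists N, forall n, (N <= n)%N -> `|A| * n.+1%:R^-1 <= e.
  move=> e0; have [|N hN] := @invSn_le _ (e / (`|A| + 1)).
    by rewrite divr_gt0// ltr_wpDl.
  exists N => n /hN h; apply: (@le_trans _ _ (`|A| * (e / (`|A| + 1)))).
    by rewrite ler_wpM2l.
  by rewrite mulrA ler_pdivrMr ?ltr_wpDl//; nra.
have [s Ps us] : exists2 s, P s & forall e : R, 0 < e -> exists N, forall n, (N <= n)%N ->
    ip (u (Jn n) - s) (u (Jn n) - s) <= e.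
  apply: (cplt (u := fun n => u (Jn n))) => // e e0.
  have [|N hN] := small (e / 4); first by lra.
  exists N => m n /hN hm /hN hn; have := near2 m n.
  by move: hm hn; move: (n.+1%:R^-1) (m.+1%:R^-1) => b c; lra.
exists s => // e e0.
have e40 : 0 < e / 4 by lra.
have [N1 h1] := small _ e40; have [N2 h2] := us _ e40.
pose n := maxn N1 N2; exists (Jn n) => J nJ.
have -> : u J - s = (u J - u (Jn n)) + (u (Jn n) - s) by rewrite addrA subrK.
have := si_sqrD_le2 SI (siP_sub SI (Pu J) (Pu (Jn n))) (siP_sub SI (Pu (Jn n)) Ps).
have := near n J nJ; have := h1 n (leq_maxl _ _); have := h2 n (leq_maxr _ _).
by move: (n.+1%:R^-1) (ip _ _) (ip _ _) (ip _ _) => b p q r; lra.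
Qed.

Variables (c : K -> U -> R) (alpha beta : R).
Hypothesis c_lin : forall k a u v, P u -> P v -> c k (a *: u + v) = a * c k u + c k v.
Hypothesis alpha0 : 0 < alpha.
Hypothesis frame_upper : forall u, P u -> forall J : {fset K},
  \sum_(k <- J) c k u ^+ 2 <= beta * ip u u.
Hypothesis frame_lower : forall u M, P u ->
  (forall J : {fset K}, \sum_(k <- J) c k u ^+ 2 <= M) -> alpha * ip u u <= M.

Let B u v : R := lim ((fun J : {fset K} => \sum_(k <- J) c k u * c k v) @ totally).

Let c_sub k u v : P u -> P v -> c k (u - v) = c k u - c k v.
Proof.
by move=> Pu Pv; rewrite addrC -scaleN1r c_lin// mulN1r addrC.
Qed.

(** Polarisation: the products have no sign, but they are combinations of three squares whose sums
    converge by monotonicity. *)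
Let Bcvg u v : P u -> P v ->
  (fun J : {fset K} => \sum_(k <- J) c k u * c k v) @ totally --> B u v.
Proof.
move=> Pu Pv; apply/cvg_ex => /=.
have [|S1 [c1 _ _]] := bounded_sum_cvg _ (frame_upper Pu); first by move=> k; exact: sqr_ge0.
have [|S2 [c2 _ _]] := bounded_sum_cvg _ (frame_upper Pv); first by move=> k; exact: sqr_ge0.
have [|S3 [c3 _ _]] := bounded_sum_cvg _ (frame_upper (siP_sub SI Pu Pv)).
  by move=> k; exact: sqr_ge0.
exists (2^-1 * (S1 + S2 - S3)).
rewrite (_ : (fun J : {fset K} => _) = (fun J : {fset K} =>
   2^-1 * ((\sum_(k <- J) c k u ^+ 2) + (\sum_(k <- J) c k v ^+ 2)
      - (\sum_(k <- J) c k (u - v) ^+ 2)))).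
  by apply: cvgMr; apply: cvgB => //; exact: cvgD.
apply/funext => J; rewrite -big_split/= -sumrB big_distrr/=.
by apply: eq_bigr => k _; rewrite c_sub//; field.
Qed.

Let B_lower u : P u -> alpha * ip u u <= B u u.
Proof.
move=> Pu; apply: frame_lower => // J.
have [|S [cS leS _]] := bounded_sum_cvg _ (frame_upper Pu); first by move=> k; exact: sqr_ge0.
suff -> : B u u = S by [].
exact/cvg_lim.
Qed.

Let B_upper u : P u -> B u u <= beta * ip u u.
Proof.
move=> Pu; apply: limr_le; first by apply/cvg_ex; exists (B u u); exact: Bcvg.
by apply: nearW => J; apply: le_trans (frame_upper Pu J); apply: ler_sum => k _; rewrite expr2.
Qed.

Let B_sum u (J : {fset K}) : P u -> \sum_(k <- J) c k u ^+ 2 <= B u u.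
Proof.
move=> Pu; apply: limr_ge; first by apply/cvg_ex; exists (B u u); exact: Bcvg.
apply/totallyP; exists J => J' JJ'.
have := @ler_sum_fset R K (fun k => c k u ^+ 2) _ _ (fun k => sqr_ge0 _) JJ'.
by move=> h; apply: (le_trans h); apply: ler_sum => k _; rewrite expr2.
Qed.

Let B_SI : semi_inner P B.
Proof.
split.
- exact: (si_0 SI).
- exact: (si_lin SI).
- move=> u v Pu Pv; apply/cvg_lim => //.
  rewrite [X in X @ _](_ : _ = fun J : {fset K} => \sum_(k <- J) c k v * c k u); first exact: Bcvg.
  by apply/funext => J; apply: eq_bigr => k _; rewrite mulrC.
- move=> a u v w Pu Pv Pw; apply/cvg_lim => //.
  rewrite [X in X @ _](_ : _ = fun J : {fset K} =>
    a * (\sum_(k <- J) c k u * c k w) + \sum_(k <- J) c k v * c k w).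
    by apply: cvgD; [apply: cvgMr|]; exact: Bcvg.
  apply/funext => J; rewrite big_distrr/= -big_split/=.
  by apply: eq_bigr => k _; rewrite c_lin//; ring.
- move=> u Pu; apply: le_trans (B_lower Pu).
  by apply: mulr_ge0; [exact: ltW|exact: (si_ge0 SI)].
Qed.

Let B_complete : complete_for P B.
Proof.
move=> u Pu uC.
have [e e0|l Pl ul] := cplt Pu.
  have [|N hN] := uC (alpha * e); first by rewrite mulr_gt0.
  exists N => m n Nm Nn; rewrite -(ler_pM2l alpha0).
  by apply: le_trans (hN m n Nm Nn); apply: B_lower; exact: (siP_sub SI).
exists l => // e e0.
have b0 : 0 < `|beta| + 1 by rewrite ltr_wpDl.
have [|N hN] := ul (e / (`|beta| + 1)); first by rewrite divr_gt0.
exists N => n Nn; have Pd := siP_sub SI (Pu n) Pl.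
apply: (le_trans (B_upper Pd)); have := hN n Nn.
rewrite ler_pdivlMr//; have := si_ge0 SI Pd; have := ler_norm beta.
by move: (ip _ _) (`|beta|) => x y; nra.
Qed.

(* The dual frame consists of the Riesz representers of the analysis
   functionals for the equivalent inner product [sum_k c k u * c k v]. *)
Theorem dual_frame : exists d : K -> U,
  [/\ forall k, P (d k),
      forall (J : {fset K}) (a : K -> R),
        ip (\sum_(k <- J) a k *: d k) (\sum_(k <- J) a k *: d k)
          <= alpha^-1 * \sum_(k <- J) a k ^+ 2 &
      forall u, P u -> forall e : R, 0 < e -> exists J0, forall J, J0 `<=` J ->
        ip (\sum_(k <- J) c k u *: d k - u) (\sum_(k <- J) c k u *: d k - u) <= e].
Proof.
have ex k : exists2 d, P d & forall v, P v -> c k v = B v d.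
  apply: (@riesz_representation _ _ _ _ B_SI _ 1 B_complete); first exact: c_lin.
  by move=> u Pu; rewrite mul1r; have := B_sum [fset k] Pu; rewrite big_seq_fset1.
pose d k := s2val (cid2 (ex k)).
have Pd k : P (d k) by rewrite /d; case: cid2.
have cd k v : P v -> c k v = B v (d k) by rewrite /d; case: cid2 => /= ? ? ; exact.
have Psum (J : {fset K}) a : P (\sum_(k <- J) a k *: d k).
  by apply: (siP_sum SI) => k; exact: (siP_scale SI).
have Bsum (J : {fset K}) a v : P v ->
    B (\sum_(k <- J) a k *: d k) v = \sum_(k <- J) a k * c k v.
  move=> Pv; rewrite (si_suml B_SI)//; last by move=> k; exact: (siP_scale SI).
  apply: eq_bigr => k _; rewrite (siZl B_SI)// cd// (si_sym B_SI)//.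
(* For [w] the synthesis of [a], [B w w] is the sum of the [a k * c k w]. Young's inequality and
   [B_sum] let one copy of [B w w] be absorbed. *)
have Bb (J : {fset K}) a : B (\sum_(k <- J) a k *: d k) (\sum_(k <- J) a k *: d k)
    <= \sum_(k <- J) a k ^+ 2.
  have Pw := Psum J a; have := B_sum J Pw; have := Bsum J a _ Pw.
  move: (\sum_(k <- J) a k *: d k) (Pw) => w _ h1 h2.
  suff : 2 * B w w <= \sum_(k <- J) a k ^+ 2 + \sum_(k <- J) c k w ^+ 2 by lra.
  rewrite h1 big_distrr/= -big_split/=; apply: ler_sum => k _.
  by have := sqr_ge0 (a k - c k w); rewrite sqrrB; lra.
exists d; split => //.
  move=> J a; rewrite -(ler_pM2l alpha0) mulrA divff ?gt_eqF// mul1r.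
  by apply: le_trans (Bb J a); exact: B_lower.
move=> u Pu e e0.
have [|S [cS leS adhS]] := bounded_sum_cvg _ (frame_upper Pu); first by move=> k; exact: sqr_ge0.
have BS : B u u = S by exact/cvg_lim.
have [|J0 hJ0] := adhS (alpha * e); first by rewrite mulr_gt0.
exists J0 => J J0J.
have := ler_sum_fset (fun k => sqr_ge0 (c k u)) J0J => le0.
have Pw := Psum J (fun k => c k u).
rewrite -(ler_pM2l alpha0); apply: (le_trans (B_lower (siP_sub SI Pw Pu))).
(* With coefficients [c k u] the cross term is the partial sum of squares, which also bounds the
   square of the partial synthesis: the error is at most the tail of [S]. *)
rewrite (si_sqrB B_SI)// (Bsum _ _ u)// BS; have := Bb J (fun k => c k u).
rewrite (eq_bigr (fun k => c k u ^+ 2)); last by move=> k _; rewrite expr2.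
move: hJ0 le0; move: (B _ _) => z; move: (\sum_(k <- J) _) (\sum_(k <- J0) _) => x y.
move: (alpha * e) => w; lra.
Qed.

End Frames.

(** * Square integrable functions *)

Section L2.
Context {R : realType}.
Local Notation mu := (@lebesgue_measure R).
Implicit Types (f g h u v : R -> R).

Lemma ae_imp (A B : R -> Prop) : (forall x, A x -> B x) ->
  {ae mu, forall x, A x} -> {ae mu, forall x, B x}.
Proof.
by move=> AB; apply: (@filterS _ _ (ae_filter_ringOfSetsType mu) A B AB).
Qed.


Definition int1 f := mu.-integrable setT (EFin \o f).

Definition sqint f := measurable_fun setT f /\ int1 (fun x => f x ^+ 2).

Lemma int1_measurable f : int1 f -> measurable_fun setT f.
Proof. by move=> /measurable_int /measurable_EFinP. Qed.

Lemma int1_le f g : measurable_fun setT f -> (forall x, `|f x| <= g x) ->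
  int1 g -> int1 f.
Proof.
move=> mf fg; apply: le_integrable => //; first exact/measurable_EFinP.
by move=> x _ /=; rewrite lee_fin (le_trans (fg x)) ?ler_norm.
Qed.

Lemma int1D f g : int1 f -> int1 g -> int1 (fun x => f x + g x).
Proof. by move=> fi gi; apply: (integrableD measurableT fi gi). Qed.

Lemma int1Z a f : int1 f -> int1 (fun x => a * f x).
Proof. by move=> fi; apply: (integrableZl measurableT a fi). Qed.

Lemma int1N f : int1 f -> int1 (fun x => - f x).
Proof. by move=> /(int1Z (-1)); under eq_fun do rewrite mulN1r. Qed.

Lemma int1B f g : int1 f -> int1 g -> int1 (fun x => f x - g x).
Proof. by move=> fi gi; apply: int1D => //; exact: int1N. Qed.

Lemma int1_norm f : int1 f -> int1 (fun x => `|f x|).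
Proof. by move=> /integrable_norm. Qed.

Lemma int1_0 : int1 (fun=> 0).
Proof. exact: (@integrable0 _ _ _ mu setT). Qed.

Lemma intD f g : int1 f -> int1 g ->
  \int[mu]_x (f x + g x) = \int[mu]_x f x + \int[mu]_x g x.
Proof. by move=> *; exact: RintegralD. Qed.

Lemma intB f g : int1 f -> int1 g ->
  \int[mu]_x (f x - g x) = \int[mu]_x f x - \int[mu]_x g x.
Proof. by move=> *; exact: RintegralB. Qed.

Lemma intZ a f : int1 f -> \int[mu]_x (a * f x) = a * \int[mu]_x f x.
Proof. by move=> *; exact: RintegralZl. Qed.

Lemma intN f : int1 f -> \int[mu]_x (- f x) = - \int[mu]_x f x.
Proof.
move=> fi; rewrite -mulN1r -intZ//; apply: eq_Rintegral => x _.
by rewrite mulN1r.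
Qed.

Lemma int_le f g : int1 f -> int1 g -> (forall x, f x <= g x) ->
  \int[mu]_x f x <= \int[mu]_x g x.
Proof. by move=> fi gi fg; apply: le_Rintegral. Qed.

Lemma int_ge0 f : (forall x, 0 <= f x) -> 0 <= \int[mu]_x f x.
Proof. by move=> f0; apply: Rintegral_ge0. Qed.

Lemma int_abs f : int1 f -> `|\int[mu]_x f x| <= \int[mu]_x `|f x|.
Proof. by move=> fi; apply: le_normr_Rintegral. Qed.

Lemma EFin_int f : int1 f -> (\int[mu]_x f x)%:E = (\int[mu]_x (f x)%:E)%E.
Proof. by move=> fi; rewrite /Rintegral fineK//; exact: integrable_fin_num. Qed.

Lemma eq_int f g : f =1 g -> \int[mu]_x f x = \int[mu]_x g x.
Proof. by move=> fg; apply: eq_Rintegral => x _; exact: fg. Qed.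

Lemma int_dominated (f_ : nat -> R -> R) f g :
  (forall n, measurable_fun setT (f_ n)) ->
  (forall x, f_ ^~ x @ \oo --> f x) ->
  int1 g -> (forall n x, `|f_ n x| <= g x) ->
  int1 f /\ \int[mu]_x (f_ n x) @[n --> \oo] --> \int[mu]_x f x.
Proof.
move=> mf cf gi fg.
have mff : measurable_fun setT f by apply: (measurable_fun_cvg mf) => x _; exact: cf.
have [|||||fi _ cvi] := @dominated_convergence _ _ _ mu setT measurableT
  (fun n x => (f_ n x)%:E) (EFin \o f) (EFin \o g).
- by move=> n; apply/measurable_EFinP; exact: mf.
- by apply/measurable_EFinP; exact: mff.
- by apply: aeW => x _; apply: cvg_EFin; [exact: nearW|exact: cf].
- exact: gi.
- by apply: aeW => x n _; rewrite lee_fin.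
by split => //; apply: fine_cvg; rewrite EFin_int.
Qed.

Lemma int1_sqrD f g : sqint f -> sqint g -> int1 (fun x => f x * g x).
Proof.
move=> [mf fi] [mg gi]; apply: int1_le (int1D fi gi).
  exact: measurable_funM.
move=> x; rewrite normrM -(real_normK (num_real (f x))) -(real_normK (num_real (g x))).
by have := sqr_ge0 (`|f x| - `|g x|); have := sqr_ge0 `|f x|; have := sqr_ge0 `|g x|; rewrite sqrrB; lra.
Qed.

Lemma sqintD f g : sqint f -> sqint g -> sqint (fun x => f x + g x).
Proof.
move=> sf sg; split; first by apply: measurable_funD; [case: sf|case: sg].
under eq_fun do rewrite sqrrD.
apply: int1D; last by case: sg.
apply: int1D; first by case: sf.
have := int1Z 2 (int1_sqrD sf sg).
by apply: eq_integrable => // x _ /=; rewrite mulr2n; congr (_%:E); ring.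
Qed.

Lemma sqintZ a f : sqint f -> sqint (fun x => a * f x).
Proof.
move=> [mf fi]; split; first exact: measurable_funM.
by under eq_fun do rewrite exprMn; exact: int1Z.
Qed.

Lemma sqint0 : sqint (fun=> 0).
Proof.
split; first exact: measurable_cst.
by under eq_fun do rewrite expr0n; exact: int1_0.
Qed.

Lemma sqintN f : sqint f -> sqint (fun x => - f x).
Proof. by move=> /(sqintZ (-1)); under eq_fun do rewrite mulN1r. Qed.

Lemma sqintB f g : sqint f -> sqint g -> sqint (fun x => f x - g x).
Proof. by move=> sf sg; apply: sqintD => //; exact: sqintN. Qed.

Lemma sqint_le f g : measurable_fun setT f -> (forall x, `|f x| <= g x) ->
  sqint g -> sqint f.
Proof.
move=> mf fg [mg gi]; split => //; apply: int1_le gi; first exact: measurable_funX.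
by move=> x; rewrite normrX lerXn2r ?nnegrE// (le_trans _ (fg x)).
Qed.

Lemma sqint_bounded (M : R) f : measurable_fun setT f -> (forall x, `|f x| <= M) ->
  int1 f -> sqint f.
Proof.
move=> mf fM fi; split => //.
apply: int1_le (int1Z M (int1_norm fi)); first exact: measurable_funX.
by move=> x; rewrite normrX expr2 ler_wpM2r.
Qed.

Definition dot f g := \int[mu]_x (f x * g x).

Lemma semi_inner_L2 : @semi_inner R (R -> R^o) sqint dot.
Proof.
split.
- exact: sqint0.
- by move=> a u v su sv; apply: sqintD => //; exact: sqintZ.
- by move=> u v su sv; rewrite /dot; apply: eq_int => x; rewrite mulrC.
- move=> a u v w su sv sw; rewrite /dot -intZ; last exact: int1_sqrD.
  rewrite -intD; [|by apply: int1Z; exact: int1_sqrD|exact: int1_sqrD].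
  by apply: eq_int => x; rewrite -[(a *: u + v) x]/(a * u x + v x); ring.
- by move=> u su; apply: int_ge0 => x; rewrite -expr2 sqr_ge0.
Qed.

Definition norm2 f := \int[mu]_x (f x ^+ 2).

Lemma norm2E f : norm2 f = dot f f.
Proof. by apply: eq_int => x; rewrite expr2. Qed.

Lemma norm2_ge0 f : 0 <= norm2 f.
Proof. by apply: int_ge0 => x; exact: sqr_ge0. Qed.

Lemma norm2D_le2 f g : sqint f -> sqint g ->
  norm2 (fun x => f x + g x) <= 2 * norm2 f + 2 * norm2 g.
Proof. by move=> sf sg; rewrite !norm2E; exact: (si_sqrD_le2 semi_inner_L2). Qed.

Lemma norm2D_le (e : R) f g : 0 < e -> sqint f -> sqint g ->
  norm2 (fun x => f x + g x) <= (1 + e) * norm2 f + (1 + e^-1) * norm2 g.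
Proof. by move=> e0 sf sg; rewrite !norm2E; exact: (si_sqrD_le semi_inner_L2). Qed.


Lemma norm2_eq0 f : sqint f -> norm2 f = 0 -> {ae mu, forall x, f x = 0}.
Proof.
move=> [mf fi] f0.
have : ae_eq mu setT (fun x => (f x ^+ 2)%:E) (cst 0%E).
  apply/ae_eq_integral_abs => //.
    by apply/measurable_EFinP; exact: measurable_funX.
  under eq_integral do rewrite gee0_abs ?lee_fin ?sqr_ge0//.
  by rewrite -EFin_int// [X in X%:E]f0.
apply: filterS => x /(_ I)[] /eqP.
by rewrite sqrf_eq0 => /eqP.
Qed.

(** Cauchy-Schwarz with weights [4^j], whose reciprocals from [k] on sum to [4/3] times [4^-k]; the
    slack up to [2] lets the induction split off the first term crudely. *)
Lemma sum_pow_sqr_le (a : nat -> R) k m :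
  (\sum_(k <= j < k + m) a j) ^+ 2 <=
  2 * (4^-1) ^+ k * \sum_(k <= j < k + m) 4 ^+ j * a j ^+ 2.
Proof.
elim: m k => [|m IH] k; first by rewrite addn0 !big_geq// expr0n mulr0.
rewrite addnS -addSn !(big_ltn (m := k)) ?addSn ?ltnS ?leq_addr//.
have := IH k.+1; rewrite addSn.
set s := \sum_(_ <= _ < _) _; set S := \sum_(_ <= _ < _) _ => h.
rewrite mulrDr -!mulrA [4^-1 ^+ k * (_ * _)]mulrA -exprMn mulVf ?expr1n ?mul1r; last by [].
have S0 : 0 <= S.
  by apply: sumr_ge0 => j _; rewrite mulr_ge0 ?sqr_ge0 ?exprn_ge0.
have := sqr_ge0 (a k - s); rewrite sqrrB sqrrD => h2.
have h3 : s ^+ 2 *+ 2 <= 2 * (4^-1 ^+ k * S).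
  have p0 : 0 <= 4^-1 ^+ k * S by rewrite mulr_ge0 ?exprn_ge0 ?invr_ge0.
  by rewrite mulr2n; move: h p0; rewrite [4^-1 ^+ k.+1]exprS; move: (4^-1 ^+ k) => p; lra.
by move: h2 h3; rewrite !mulr2n; lra.
Qed.

End L2.

Lemma expV4_le {R : realType} k : (4^-1 : R) ^+ k <= k.+1%:R^-1.
Proof.
rewrite exprVn lef_pV2 ?posrE ?exprn_gt0 ?ltr0n//.
by rewrite -natrX ler_nat; exact: ltn_expl.
Qed.

Lemma expV4_small {R : realType} (C e : R) : 0 <= C -> 0 < e ->
  exists N, forall n, (N <= n)%N -> C * (4^-1) ^+ n <= e.
Proof.
move=> C0 e0; have C1 : 0 < C + 1 by rewrite ltr_wpDl.
have [|N hN] := @invSn_le _ (e / (C + 1)); first by rewrite divr_gt0.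
exists N => n /hN h; apply: (@le_trans _ _ (C * (e / (C + 1)))).
  by rewrite ler_wpM2l// (le_trans (expV4_le _)).
by rewrite mulrA ler_pdivrMr//; nra.
Qed.

Lemma norm_lt_sqr {R : realType} (x e : R) : 0 < e -> x ^+ 2 < e ^+ 2 -> `|x| < e.
Proof.
move=> e0; rewrite -(real_normK (num_real x)) ltr_pXn2r ?nnegrE//.
exact: ltW.
Qed.

(** * Completeness of the square integrable functions *)

Section Complete.
Context {R : realType}.
Local Notation mu := (@lebesgue_measure R).
Implicit Types (f g h u v : R -> R).

Lemma norm2_ae f g : measurable_fun setT f -> measurable_fun setT g ->
  {ae mu, forall x, f x = g x} -> norm2 f = norm2 g.
Proof.
move=> mf mg fg; congr fine; apply: ae_eq_integral => //.
- by apply/measurable_EFinP; exact: measurable_funX.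
- by apply/measurable_EFinP; exact: measurable_funX.
- by move: fg; apply: ae_imp => x /= ->.
Qed.

Lemma int1_ae f g : measurable_fun setT g ->
  {ae mu, forall x, f x = g x} -> int1 f -> int1 g.
Proof.
move=> mg fg /integrableP[mf fi]; apply/integrableP; split.
  exact/measurable_EFinP.
rewrite (_ : (\int[mu]_x _)%E = (\int[mu]_x `|(EFin \o f) x|)%E)//.
apply: ae_eq_integral => //.
- by apply: measurableT_comp => //; exact/measurable_EFinP.
- by apply: measurableT_comp.
- by move: fg; apply: ae_imp => x /= ->.
Qed.

Lemma sqint_ae f g : measurable_fun setT g ->
  {ae mu, forall x, f x = g x} -> sqint f -> sqint g.
Proof.
move=> mg fg [mf fi]; split => //; apply: int1_ae fi; first exact: measurable_funX.
by move: fg; apply: ae_imp => x ->.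
Qed.

(** Riesz-Fischer: along a fast subsequence the weighted sum of squared increments has finite
    integral, hence is finite almost everywhere, and its value [G] controls all tails at once. *)
Lemma L2_complete : @complete_for R (R -> R^o) sqint (@dot R).
Proof.
move=> u su uC.
have ex k : exists N, forall m n, (N <= m)%N -> (N <= n)%N ->
    norm2 (fun x => u m x - u n x) <= (16^-1) ^+ k.
  have [|N hN] := uC ((16^-1) ^+ k); first by rewrite exprn_gt0// invr_gt0.
  by exists N => m n mN nN; rewrite norm2E; exact: hN.
pose N k := sval (cid (ex k)).
have hN k m n : (N k <= m)%N -> (N k <= n)%N ->
    norm2 (fun x => u m x - u n x) <= (16^-1) ^+ k by rewrite /N; case: cid => ? /= h; exact: h.
(* Beyond every threshold up to index [k]; the summand [k] makes [M k] tend to infinity. *)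
pose M k := (\sum_(j < k.+1) N j + k)%N.
have MN k m : (k <= m)%N -> (N k <= M m)%N.
  move=> km; have km1 : (k < m.+1)%N by rewrite ltnS.
  by rewrite /M (bigD1 (Ordinal km1))//= -addnA leq_addr.
pose v k := u (M k).
have sv k : sqint (v k) by exact: su.
pose phi k x := v k.+1 x - v k x.
have sphi k : sqint (phi k) by exact: sqintB.
have Nphi k : norm2 (phi k) <= (16^-1) ^+ k.
  by apply: hN; apply: MN.
pose t j x := 4 ^+ j * phi j x ^+ 2.
have t0 j x : 0 <= t j x by rewrite mulr_ge0 ?sqr_ge0 ?exprn_ge0.
have it j : int1 (t j) by apply: int1Z; case: (sphi j).
have mt j : measurable_fun setT (EFin \o t j) by apply/measurable_EFinP; exact: int1_measurable.
pose F x := (\sum_(0 <= j <oo) (t j x)%:E)%E.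
have F0 x : (0 <= F x)%E by apply: nneseries_ge0 => j _ _; rewrite lee_fin.
have mF : measurable_fun setT F.
  apply: ge0_emeasurable_sum => [j x _ _|j _]; [by rewrite lee_fin|exact: mt].
(* Squared norms [16^-j] against weights [4^j] leave a geometric series of ratio [1/4]. *)
have intF : (\int[mu]_x F x <= 2%:E)%E.
  rewrite integral_nneseries//; last by move=> j x _; rewrite lee_fin.
  apply: lime_le.
    by apply: is_cvg_nneseries => j _ _; apply: integral_ge0 => x _; rewrite lee_fin.
  apply: nearW => n.
  apply: (@le_trans _ _ (\sum_(0 <= j < n) ((4^-1) ^+ j)%:E)%E).
    apply: lee_sum => j _; rewrite -EFin_int// lee_fin intZ; last by case: (sphi j).
    have := Nphi j; rewrite -[16^-1](_ : 4^-1 * 4^-1 = _); last by field.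
    rewrite exprMn => h; rewrite (_ : 4^-1 ^+ j = 4 ^+ j * (4^-1 ^+ j * 4^-1 ^+ j)).
      by rewrite ler_wpM2l// exprn_ge0.
    by rewrite mulrA -exprMn divff ?expr1n ?mul1r.
  rewrite sumEFin lee_fin.
  have := @geometric_le_lim R n 1 4^-1 ler01.
  rewrite /series/=; under eq_bigr do rewrite mul1r.
  move=> h; apply: le_trans (h _ _) _; rewrite ?invr_gt0// ?ger0_norm ?invr_ge0//.
    by rewrite invf_lt1// ltr1n.
  by rewrite mul1r invf_ple ?posrE; lra.
have iF : mu.-integrable setT F.
  apply/integrableP; split => //.
  under eq_integral do rewrite gee0_abs//.
  by apply: le_lt_trans intF _; rewrite ltry.
pose G x := fine (F x).
have G0 x : 0 <= G x by rewrite fine_ge0.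
have mG : measurable_fun setT G.
  by apply: measurableT_comp => //; exact: fine_measurable.
have iG : int1 G.
  apply: le_integrable iF => //; first exact/measurable_EFinP.
  move=> x _ /=; rewrite ger0_norm// gee0_abs// /G.
  by have := F0 x; case: (F x) => //= r; rewrite ?leey.
pose good := [set x | F x \is a fin_num].
have mgood : measurable good.
  by rewrite -[good]setTI; exact: emeasurable_fin_num.
have aegood : {ae mu, forall x, good x}.
  by have := integrable_ae measurableT iF; apply: ae_imp => x; exact.
have sumG n x : good x -> \sum_(0 <= j < n) t j x <= G x.
  move=> gx; rewrite -lee_fin -sumEFin fineK//.
  by apply: nneseries_lim_ge => j _ _; rewrite lee_fin.
(* Zeroing on the null set where [F] is infinite makes the subsequence converge at every point, so
   the limit is measurable. *)
pose w k x := v k x * \1_good x.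
have mw k : measurable_fun setT (w k).
  by apply: measurable_funM; [case: (sv k)|exact: measurable_indic].
have wv k : {ae mu, forall x, v k x = w k x}.
  by move: aegood; apply: ae_imp => x gx; rewrite /w indicE mem_set// mulr1.
have wle k m x : (k <= m)%N -> (w m x - w k x) ^+ 2 <= 2 * (4^-1) ^+ k * G x.
  move=> km; rewrite /w indicE; case: (pselect (good x)) => gx; last first.
    by rewrite memNset// !mulr0 subrr expr0n mulr_ge0 ?mulr_ge0 ?exprn_ge0 ?invr_ge0.
  rewrite mem_set// !mulr1.
  have -> : v m x - v k x = \sum_(k <= j < k + (m - k)) phi j x.
    by rewrite subnKC// telescope_sumr.
  apply: (le_trans (sum_pow_sqr_le _ _ _)).
  rewrite ler_wpM2l ?mulr_ge0 ?exprn_ge0 ?invr_ge0//.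
  apply: le_trans (sumG (k + (m - k))%N x gx).
  rewrite (@big_cat_nat _ _ _ k 0%N)//= ?leq_addr// lerDr.
  by apply: sumr_ge0.
have wcvg x : cvgn (w ^~ x).
  apply: cauchy_cvg; apply: cauchy_exP => e e0.
  have e20 : 0 < e ^+ 2 / 2 :> R by rewrite divr_gt0 ?exprn_gt0.
  have [|K hK] := @expV4_small R (2 * G x) _ _ e20; first by rewrite mulr_ge0.
  exists (w K x); exists K => // m /= Km.
  apply: norm_lt_sqr => //; rewrite -sqrrN opprB.
  apply: (le_lt_trans (wle _ _ _ Km)); rewrite mulrAC.
  apply: (le_lt_trans (hK _ (leqnn _))).
  by rewrite ltr_pdivrMr// ltr_pMr ?exprn_gt0// ltr1n.
pose l x := limn (w ^~ x).
have ml : measurable_fun setT l.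
  by apply: (measurable_fun_cvg mw) => x _; exact: wcvg.
have wl k x : (w k x - l x) ^+ 2 <= 2 * (4^-1) ^+ k * G x.
  rewrite -sqrrN opprB.
  have cv : (w m x - w k x) ^+ 2 @[m --> \oo] --> (l x - w k x) ^+ 2.
    by rewrite expr2; apply: cvgM; apply: cvgB => //; exact: cvg_cst || exact: wcvg.
  rewrite -(cvg_lim _ cv)//; apply: limr_le; first by apply/cvg_ex; eexists; exact: cv.
  by exists k => // m /= km; exact: wle.
have iwl k : int1 (fun x => (w k x - l x) ^+ 2).
  apply: int1_le (int1Z (2 * 4^-1 ^+ k) iG); first by apply: measurable_funX; exact: measurable_funB.
  by move=> x; rewrite ger0_norm ?sqr_ge0.
have swl k : sqint (fun x => w k x - l x) by split => //; exact: measurable_funB.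
have sw k : sqint (w k) by apply: sqint_ae (sv k) => //; exact: wv.
have sl : sqint l.
  have := sqintB (sw 0%N) (swl 0%N).
  by under eq_fun do rewrite opprB addrC subrK.
exists l => // e e0.
have e40 : 0 < e / 4 by lra.
have [|K1 h1] := expV4_small (C := 2 * \int[mu]_x G x) _ e40.
  by rewrite mulr_ge0// int_ge0.
have [N2 h2] := uC (e / 4) e40.
pose k := (K1 + N2)%N.
have hw : norm2 (fun x => v k x - l x) <= e / 4.
  rewrite (@norm2_ae _ (fun x => w k x - l x)).
  - apply: le_trans (h1 k (leq_addr _ _)); rewrite mulrAC -intZ//.
    by apply: int_le => //; exact: int1Z.
  - by apply: measurable_funB => //; case: (sv k).
  - exact: measurable_funB.
  - by have := wv k; apply: ae_imp => x ->.
exists (maxn N2 (M k)) => n; rewrite geq_max => /andP[n2 nM].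
have MkN2 : (N2 <= M k)%N by rewrite /M /k (leq_trans _ (leq_addl _ _))// leq_addl.
have h3 := h2 n (M k) n2 MkN2.
have := norm2D_le2 (sqintB (su n) (sv k)) (sqintB (sv k) sl).
rewrite [X in X <= _](_ : _ = norm2 (fun x => u n x - l x)); last first.
  by congr norm2; apply/funext => x; rewrite addrA subrK.
move: h3; rewrite -!norm2E => h3.
rewrite -[norm2 (fun x => u n x - v k x)]/(norm2 (u n - u (M k))).
rewrite -[norm2 (fun x => u n x - l x)]/(norm2 (u n - l)).
by lra.
Qed.

End Complete.

(** * Reflection, truncation and density of continuous functions *)

Section Truncation.
Context {R : realType}.
Local Notation mu := (@lebesgue_measure R).
Implicit Types (f g h u v : R -> R).

Let oppN_measurable : measurable_fun [set: measurableTypeR R]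
  (-%R : measurableTypeR R -> measurableTypeR R).
Proof. exact: oppr_measurable. Qed.

Lemma ge0_integral_reflect (f : R -> \bar R) : measurable_fun setT f ->
  (forall x, 0 <= f x)%E -> (\int[mu]_x f (- x)%R = \int[mu]_x f x)%E.
Proof.
move=> mf f0.
have := @ge0_integral_pushforward _ _ (measurableTypeR R) (measurableTypeR R) R
  -%R oppN_measurable mu setT f measurableT mf (fun x _ => f0 x).
rewrite preimage_setT => <-.
by apply: eq_measure_integral => A mA _; exact: lebesgue_measureN.
Qed.

Lemma measurable_reflect f : measurable_fun setT f ->
  measurable_fun setT (fun x : R => f (- x)).
Proof. by move=> mf; exact: (measurableT_comp mf oppN_measurable). Qed.

Lemma int1_reflect f : int1 f -> int1 (fun x : R => f (- x)).
Proof.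
move=> fi; have mf := int1_measurable fi.
apply/integrableP; split; first by apply/measurable_EFinP; exact: measurable_reflect.
rewrite (@ge0_integral_reflect (fun x => `|(f x)%:E|%E))//.
  by case/integrableP: fi.
by apply: measurableT_comp => //; exact/measurable_EFinP.
Qed.

Lemma int_reflect f : int1 f -> \int[mu]_x f (- x) = \int[mu]_x f x.
Proof.
move=> fi; have mf := int1_measurable fi.
have fi' : mu.-integrable (-%R @^-1` setT) ((EFin \o f) \o -%R).
  by rewrite preimage_setT; exact: int1_reflect.
have mEf : measurable_fun setT (EFin \o f) by exact/measurable_EFinP.
have := @integral_pushforward _ _ (measurableTypeR R) (measurableTypeR R) R
  -%R oppN_measurable mu setT (EFin \o f) mEf fi' measurableT.
rewrite preimage_setT /Rintegral => h; congr fine.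
rewrite -[LHS]/(\int[mu]_x ((EFin \o f) \o -%R) x)%E -h.
by apply: eq_measure_integral => A mA _; exact: lebesgue_measureN.
Qed.

Lemma sqint_reflect f : sqint f -> sqint (fun x : R => f (- x)).
Proof. by move=> [mf fi]; split; [exact: measurable_reflect|exact: (int1_reflect fi)]. Qed.

Lemma norm2_reflect f : sqint f -> norm2 (fun x : R => f (- x)) = norm2 f.
Proof. by move=> [mf fi]; exact: (int_reflect fi). Qed.

Lemma int1_indic (a b : R) (ba bb : bool) :
  int1 (\1_[set` Interval (BSide ba a) (BSide bb b)]).
Proof. exact: integrable_indic_itv. Qed.

Lemma int1_truncate f (a b : R) ba bb : sqint f ->
  int1 (fun x => f x * \1_[set` Interval (BSide ba a) (BSide bb b)] x).
Proof.
move=> [mf fi].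
apply: int1_le (int1D fi (int1_indic a b ba bb)).
  by apply: measurable_funM => //; exact: measurable_indic.
move=> x /=; rewrite indicE; case: (_ \in _) => /=; last by rewrite mulr0 normr0 addr0 sqr_ge0.
by rewrite mulr1 -real_normK ?num_real//; have := sqr_ge0 (`|f x| - 1); have := sqr_ge0 `|f x|; rewrite sqrrB; lra.
Qed.

Lemma sqint_truncate f (A : set R) : measurable A -> sqint f ->
  sqint (fun x => f x * \1_A x).
Proof.
move=> mA [mf fi]; split.
  by apply: measurable_funM => //; exact: measurable_indic.
apply: int1_le fi.
  by apply: measurable_funX; apply: measurable_funM => //; exact: measurable_indic.
move=> x /=; rewrite indicE; case: (_ \in _) => /=; rewrite ?mulr0 ?mulr1 ?expr0n/=.
  by rewrite ger0_norm ?sqr_ge0.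
by rewrite normr0 sqr_ge0.
Qed.

Lemma truncate_cvg f : sqint f ->
  norm2 (fun x => f x * \1_(`[- n%:R, n%:R]) x - f x) @[n --> \oo] --> 0.
Proof.
move=> sf; have [mf fi] := sf.
have [|x|n x|_] := @int_dominated R
  (fun n x => (f x * \1_(`[- n%:R, n%:R]) x - f x) ^+ 2) (cst 0) (fun x => f x ^+ 2) _ _ fi _.
- move=> n; apply: measurable_funX; apply: measurable_funB => //.
  by apply: measurable_funM => //; exact: measurable_indic.
- apply: cvg_near_cst; exists (Num.truncn `|x|).+1 => // n /= xn.
  rewrite indicE mem_set/=; first by rewrite mulr1 subrr expr0n.
  rewrite in_itv/= -ler_norml ltW// (lt_le_trans (truncnS_gt _))// ler_nat//.
- rewrite indicE; case: (_ \in _) => /=; rewrite ?mulr0 ?mulr1 ?subrr ?expr0n/=.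
    by rewrite normr0 sqr_ge0.
  by rewrite add0r sqrrN ger0_norm ?sqr_ge0.
by rewrite /norm2 [X in _ --> X -> _](_ : _ = 0)//; rewrite Rintegral_cst// mul0r.
Qed.

(** For [0 <= M], the projection onto [[-M, M]], in a form whose continuity is visible. It does not
    increase the distance to points of that interval, so clipping an approximant of a bounded
    function loses nothing. *)
Definition clip (M y : R) := (`|y + M| - `|y - M|) / 2.

Lemma clip_le M y : 0 <= M -> `|clip M y| <= M.
Proof.
move=> M0; rewrite /clip ler_norml.
by case: (ger0P (y + M)) => h1; case: (ger0P (y - M)) => h2; apply/andP; split; lra.
Qed.

Lemma clip_dist M a y : `|a| <= M -> `|a - clip M y| <= `|a - y|.
Proof.
rewrite /clip ler_norml => /andP[a1 a2].
by case: (ger0P (y + M)) => h1; case: (ger0P (y - M)) => h2;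
  case: (ger0P (a - y)) => h3; rewrite ler_norml; apply/andP; split; lra.
Qed.

Lemma clip_continuous M g : continuous g -> continuous (fun x => clip M (g x)).
Proof.
move=> cg x; rewrite /clip; apply: cvgMl; apply: cvgB; apply: cvg_norm.
  by apply: cvgD; [exact: cg|exact: cvg_cst].
by apply: cvgB; [exact: cg|exact: cvg_cst].
Qed.

(** Cut [f] down to a bounded function on a bounded interval, approximate in [L1], then clip.
    Between functions bounded by [n] the squared difference is at most [2 n] times its modulus, so
    [L1] closeness becomes [L2] closeness. *)
Lemma L2_density f (e : R) : sqint f -> 0 < e ->
  exists g n M, [/\ continuous g, forall x, `|g x| <= M &
    norm2 (fun x => f x - g x * \1_(`]- n%:R, n%:R[) x) <= e].
Proof.
move=> sf e0; have [mf fi] := sf.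
pose I n : set R := `]- n%:R, n%:R[%classic.
pose A n := [set x | `|f x| <= n%:R].
have mA n : measurable (A n).
  rewrite -[A n]setTI; apply: measurable_fun_le => //.
  by apply: measurableT_comp.
pose fn n x := f x * \1_(I n `&` A n) x.
have mfn n : measurable_fun setT (fn n).
  by apply: measurable_funM => //; apply: measurable_indic; apply: measurableI; [exact: measurable_itv|exact: mA].
have sfn n : sqint (fn n).
  apply: sqint_truncate => //; apply: measurableI; [exact: measurable_itv|exact: mA].
have cvn : norm2 (fun x => f x - fn n x) @[n --> \oo] --> 0.
  have [|x|n x|_] := @int_dominated R
    (fun n x => (f x - fn n x) ^+ 2) (cst 0) (fun x => f x ^+ 2) _ _ fi _.
  - by move=> n; apply: measurable_funX; apply: measurable_funB.
  - apply: cvg_near_cst; exists (maxn (Num.truncn `|x|).+1 (Num.truncn `|f x|).+1) => // n /=.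
    rewrite geq_max => /andP[xn fxn].
    rewrite /fn indicE mem_set/=; first by rewrite mulr1 subrr expr0n.
    split; rewrite /I /A /=; last by rewrite ltW// (lt_le_trans (truncnS_gt _))// ler_nat.
    by rewrite in_itv/= -ltr_norml (lt_le_trans (truncnS_gt _))// ler_nat.
  - rewrite /fn indicE; case: (_ \in _) => /=; rewrite ?mulr0 ?mulr1 ?subrr ?expr0n/=.
      by rewrite normr0 sqr_ge0.
    by rewrite subr0 ger0_norm ?sqr_ge0.
  by rewrite /norm2 [X in _ --> X -> _](_ : _ = 0)//; rewrite Rintegral_cst// mul0r.
have e40 : 0 < e / 4 by lra.
have [n _ hn] := (cvgrPdist_le _ _).1 cvn (e / 4) e40.
have {}hn : norm2 (fun x => f x - fn n x) <= e / 4.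
  by have := hn n (leqnn n); rewrite /= sub0r normrN ger0_norm// norm2_ge0.
have fnn x : `|fn n x| <= n%:R.
  rewrite /fn indicE; case: (boolP (x \in _)) => /=; last by rewrite mulr0 normr0.
  by rewrite inE => -[_ h]; rewrite mulr1.
have fnI x : ~ I n x -> fn n x = 0.
  by move=> nI; rewrite /fn indicE memNset ?mulr0// => -[/nI].
have mI : measurable (I n) by exact: measurable_itv.
have ifn : int1 (fn n).
  have := int1_truncate (- n%:R) n%:R false true (sfn n).
  rewrite [X in int1 X -> _](_ : _ = fn n); first by [].
  apply: funext => y; rewrite indicE.
  case: (pselect (I n y)) => h; first by rewrite mem_set// mulr1.
  by rewrite memNset// mulr0 fnI.
have muI : (mu (I n) < +oo)%E.
  by rewrite lebesgue_measure_itv/=; case: ifP => // _; rewrite -EFinB ltry.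
have ifnI : mu.-integrable (I n) (EFin \o fn n) by apply: integrableS ifn.
have [g_ [cg ig gcv]] := approximation_continuous_integrable mI muI ifnI.
have n0 : 0 <= n%:R :> R by [].
(* The [+ 1] covers [n = 0]. *)
have e8 : 0 < (e / 4) / (2 * n%:R + 1) :> R by rewrite divr_gt0// ltr_wpDl// mulr_ge0.
move: gcv => /fine_cvg /cvgrPdist_le /(_ _ e8)[k _ hk].
have {hk} := hk k (leqnn k); rewrite /= sub0r normrN => hk.
pose g (x : R) : R := clip n%:R (g_ k x).
have cgg : continuous g by exact: clip_continuous.
exists g, n, n%:R; split => //; first by move=> x; exact: clip_le.
have mg : measurable_fun setT g by exact: continuous_measurable_fun.
have mgI : measurable_fun setT (fun x => g x * \1_(I n) x).
  by apply: measurable_funM => //; exact: measurable_indic.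
pose d (x : R) : R := `|fn n x - g_ k x|.
have id : mu.-integrable (I n) (EFin \o d).
  have h : mu.-integrable (I n) (EFin \o (fun x => fn n x - g_ k x)).
    by apply: (integrableB _ ifnI (ig k)).
  exact: (integrable_norm h).
have id1 : int1 (fun x => d x * \1_(I n) x).
  have /integrable_mkcond := id => /(_ mI).
  apply: eq_integrable => // x _ /=; rewrite /patch indicE.
  by case: ifP => _; rewrite ?mulr1 ?mulr0.
have dE : \int[mu]_x (d x * \1_(I n) x) = \int[mu]_(x in I n) d x.
  rewrite [RHS]Rintegral_mkcond; apply: eq_int => x.
  by rewrite /patch indicE; case: ifP => _; rewrite ?mulr1 ?mulr0.
have dle : \int[mu]_x (d x * \1_(I n) x) <= (e / 4) / (2 * n%:R + 1).
  by rewrite dE; apply: le_trans hk; rewrite ger0_norm ?Rintegral_ge0.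
have mdiff : measurable_fun setT (fun x => fn n x - g x * \1_(I n) x).
  exact: measurable_funB.
have ptw x : (fn n x - g x * \1_(I n) x) ^+ 2 <= 2 * n%:R * (d x * \1_(I n) x).
  rewrite indicE; case: (pselect (I n x)) => h; last first.
    by rewrite memNset// !mulr0 fnI// subrr expr0n.
  rewrite mem_set// !mulr1 -real_normK ?num_real// expr2.
  apply: ler_pM => //; last exact: clip_dist.
  by rewrite (le_trans (ler_normB _ _))// mulr2n mulrDl mul1r lerD// clip_le.
have sq2 : int1 (fun x => (fn n x - g x * \1_(I n) x) ^+ 2).
  apply: int1_le (int1Z (2 * n%:R) id1); first exact: measurable_funX.
  by move=> x; rewrite ger0_norm ?sqr_ge0.
have h2 : norm2 (fun x => fn n x - g x * \1_(I n) x) <= e / 4.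
  apply: (@le_trans _ _ (2 * n%:R * ((e / 4) / (2 * n%:R + 1)))).
    apply: (@le_trans _ _ (\int[mu]_x (2 * n%:R * (d x * \1_(I n) x)))).
      by apply: int_le => //; exact: int1Z.
    by rewrite intZ// ler_wpM2l// mulr_ge0.
  by rewrite mulrA ler_pdivrMr ?ltr_wpDl ?mulr_ge0//; nra.
have := norm2D_le2 (sqintB sf (sfn n)) (conj mdiff sq2).
rewrite [X in X <= _](_ : _ = norm2 (fun x => f x - g x * \1_(I n) x)); last first.
  by congr norm2; apply/funext => x; rewrite addrA subrK.
by lra.
Qed.

End Truncation.

(** * The Hartley transform *)

Section Hartley.
Context {R : realType}.
Local Notation mu := (@lebesgue_measure R).
Local Notation T := (measurableTypeR R).
Implicit Types (f g h u v : R -> R).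

Lemma int1_bounded_mul (M : R) u (k : R -> R) : int1 u -> measurable_fun setT k ->
  (forall x, `|k x| <= M) -> int1 (fun x => u x * k x).
Proof.
move=> iu mk kM; apply: int1_le (int1Z M (int1_norm iu)).
  by apply: measurable_funM => //; exact: int1_measurable.
by move=> x; rewrite normrM mulrC ler_wpM2r.
Qed.

Section KernelFubini.
Variables (u v : R -> R) (k : R -> R -> R) (M : R).
Hypotheses (iu : int1 u) (iv : int1 v).
Hypothesis mk : measurable_fun [set: T * T] (fun z : T * T => k z.1 z.2).
Hypothesis kM : forall x y, `|k x y| <= M.

Let mu' : measurable_fun [set: T] u := int1_measurable iu.
Let mv' : measurable_fun [set: T] v := int1_measurable iv.

Lemma measurable_kernel_l x : measurable_fun [set: T] (k x).
Proof. exact: (measurableT_comp mk (pair1_measurable x)). Qed.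

Lemma measurable_kernel_r y : measurable_fun [set: T] (k ^~ y).
Proof. exact: (measurableT_comp mk (pair2_measurable y)). Qed.

Lemma int1_kernel_l x : int1 (fun y => u y * k x y).
Proof. by apply: int1_bounded_mul => //; exact: measurable_kernel_l. Qed.

Lemma int1_kernel_r y : int1 (fun x => v x * k x y).
Proof. by apply: (@int1_bounded_mul M) => //; exact: measurable_kernel_r. Qed.

(** [M |u| |v|] is integrable on the product and dominates the integrand. *)
Lemma kernel_fubini :
  \int[mu]_x (v x * \int[mu]_y (u y * k x y)) =
  \int[mu]_y (u y * \int[mu]_x (v x * k x y)).
Proof.
pose F (z : T * T) : \bar R := (v z.1 * (u z.2 * k z.1 z.2))%:E.
have mF : measurable_fun [set: T * T] F.
  apply/measurable_EFinP; apply: measurable_funM.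
    exact: (measurableT_comp mv' measurable_fst).
  by apply: measurable_funM => //; exact: (measurableT_comp mu' measurable_snd).
have M0 : 0 <= M by exact: le_trans (kM 0 0).
have iF : (mu \x mu)%E.-integrable [set: T * T] F.
  apply/integrable12ltyP => //.
  apply: (@le_lt_trans _ _ (\int[mu]_x ((M * \int[mu]_y `|u y|) * `|v x|)%:E)%E).
    apply: ge0_le_integral => //.
    - by move=> x _; exact: integral_ge0.
    - apply: (measurable_fun_fubini_tonelli_F (abse \o F)).
        by apply: measurableT_comp.
      by move=> z; exact: abse_ge0.
    - apply/measurable_EFinP; apply: measurable_funM => //; exact: measurableT_comp.
    move=> x _; rewrite mulrAC -[M * _ * _]/(M * `|v x| * \int[mu]_y `|u y|).
    rewrite -intZ; last exact: int1_norm.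
    rewrite EFin_int; last by apply: int1Z; exact: int1_norm.
    apply: ge0_le_integral => //.
    - apply: measurableT_comp => //.
      exact: (measurableT_comp mF (pair1_measurable x)).
    - by apply/measurable_EFinP; apply: measurable_funM => //; exact: measurableT_comp.
    move=> y _; rewrite /= lee_fin !normrM.
    rewrite [leRHS](_ : _ = `|v x| * (`|u y| * M)); last by ring.
    by rewrite ler_wpM2l// ler_wpM2l.
  have h : int1 (fun x => (M * \int[mu]_y `|u y|) * `|v x|) by apply: int1Z; exact: int1_norm.
  by have := integrable_fin_num measurableT h; rewrite fin_numE => /andP[_]; rewrite ltey.
have := Fubini iF.
rewrite /F /= /Rintegral => h; congr fine; move: h.
have e1 : (\int[mu]_x \int[mu]_y (v x * (u y * k x y))%:E)%E =
    (\int[mu]_x (v x * fine (\int[mu]_y (u y * k x y)%:E))%:E)%E.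
  apply: eq_integral => x _; rewrite -[fine _]/(\int[mu]_y (u y * k x y)).
  rewrite -intZ; last exact: int1_kernel_l.
  by rewrite EFin_int//; apply: int1Z; exact: int1_kernel_l.
have e2 : (\int[mu]_y \int[mu]_x (v x * (u y * k x y))%:E)%E =
    (\int[mu]_y (u y * fine (\int[mu]_x (v x * k x y)%:E))%:E)%E.
  apply: eq_integral => y _; rewrite -[fine _]/(\int[mu]_x (v x * k x y)).
  rewrite -intZ; last exact: int1_kernel_r.
  rewrite EFin_int//; last by apply: int1Z; exact: int1_kernel_r.
  by apply: eq_integral => x _; rewrite mulrCA.
by rewrite e1 e2.
Qed.

End KernelFubini.

Lemma kernel_continuous u (k : R -> R -> R) (M : R) : int1 u ->
  measurable_fun [set: T * T] (fun z : T * T => k z.1 z.2) ->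
  (forall x y, `|k x y| <= M) -> (forall y, continuous (k ^~ y)) ->
  continuous (fun x => \int[mu]_y (u y * k x y)).
Proof.
move=> iu mk kM ck w.
have ww : w - 1 < w < w + 1 by apply/andP; split; lra.
apply: (@continuity_under_integral R _ T mu (fun w t => u t * k w t)
  setT measurableT (w - 1) (w + 1) _ _ (fun t => M * `|u t|) _ _ w).
- by move=> x _; exact: (int1_kernel_l iu mk kM).
- by apply: aeW => y _ x _; apply: cvgMr; exact: ck.
- by apply: int1Z; exact: int1_norm.
- by move=> x _; apply: aeW => y _; rewrite normrM mulrC ler_wpM2r// kM.
- by rewrite inE/= in_itv.
Qed.

Definition cas (x : R) : R := cos x + sin x.

Lemma cas_le x : `|cas x| <= 2.
Proof.
have := ler_normD (cos x) (sin x).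
have := cos_max x; have := sin_max x; rewrite /cas.
by move: (cos x) (sin x) => a b; lra.
Qed.

Lemma continuous_cas : continuous cas.
Proof. by move=> x; apply: cvgD; [exact: continuous_cos|exact: continuous_sin]. Qed.

(** One term depends on the difference and one on the sum. With both arguments proportional to the
    frequency, the second is odd in it and vanishes against an even weight, which leaves a
    convolution kernel. *)
Lemma casM x y : cas x * cas y = cos (x - y) + sin (x + y).
Proof. by rewrite /cas cosB sinD; ring. Qed.

Definition hartley u w : R := \int[mu]_t (u t * cas (2 * pi * w * t)).

Let measurable_cas : measurable_fun setT cas.
Proof. exact: continuous_measurable_fun continuous_cas. Qed.

Lemma measurable_cas_lin (a : R) : measurable_fun setT (fun t : R => cas (a * t)).
Proof. exact: (measurableT_comp measurable_cas (measurable_funM (measurable_cst a) (@measurable_id _ _ setT))). Qed.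

Lemma measurable_cas_kernel :
  measurable_fun [set: T * T] (fun z : T * T => cas (2 * pi * z.1 * z.2)).
Proof.
apply: (measurableT_comp measurable_cas).
by apply: measurable_funM; [apply: measurable_funM|].
Qed.

Lemma int1_cas u (w : R) : int1 u -> int1 (fun t => u t * cas (2 * pi * w * t)).
Proof.
move=> iu; apply: (@int1_bounded_mul 2) => //; last by move=> x; exact: cas_le.
exact: measurable_cas_lin.
Qed.

Lemma hartley_le u w : int1 u -> `|hartley u w| <= 2 * \int[mu]_x `|u x|.
Proof.
move=> iu; apply: (le_trans (int_abs (int1_cas w iu))).
rewrite -intZ; last exact: int1_norm.
apply: int_le.
- by apply: int1_norm; exact: int1_cas.
- by apply: int1Z; exact: int1_norm.
- by move=> x; rewrite normrM mulrC ler_wpM2r// cas_le.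
Qed.

Lemma hartley_continuous u : int1 u -> continuous (hartley u).
Proof.
move=> iu; apply: (kernel_continuous iu measurable_cas_kernel) => [x y|y].
  exact: cas_le.
move=> x; apply: (@continuous_comp _ _ _ (fun x => 2 * pi * x * y) cas).
  by apply: cvgMl; apply: cvgMr; exact: cvg_id.
exact: continuous_cas.
Qed.

Lemma measurable_hartley u : int1 u -> measurable_fun setT (hartley u).
Proof. by move=> iu; apply: continuous_measurable_fun; exact: hartley_continuous. Qed.

(** The kernel is symmetric in time and frequency, so Fubini makes the transform self-adjoint. *)
Lemma hartley_mul u v : int1 u -> int1 v ->
  \int[mu]_x (v x * hartley u x) = \int[mu]_x (u x * hartley v x).
Proof.
move=> iu iv; rewrite /hartley.
rewrite (kernel_fubini iu iv measurable_cas_kernel (fun x y => cas_le (2 * pi * x * y))).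
by apply: eq_int => y; congr (_ * _); apply: eq_int => x; rewrite mulrAC.
Qed.

Lemma int1_mul_hartley u v : int1 u -> int1 v -> int1 (fun x => v x * hartley u x).
Proof.
move=> iu iv; apply: int1_bounded_mul => //; first exact: measurable_hartley.
by move=> x; exact: hartley_le.
Qed.

Lemma hartleyD u v w : int1 u -> int1 v ->
  hartley (fun x => u x + v x) w = hartley u w + hartley v w.
Proof.
move=> iu iv; rewrite /hartley -intD; [|exact: int1_cas|exact: int1_cas].
by apply: eq_int => x; rewrite mulrDl.
Qed.

Lemma hartleyZ a u w : int1 u -> hartley (fun x => a * u x) w = a * hartley u w.
Proof.
move=> iu; rewrite /hartley -intZ; last exact: int1_cas.
by apply: eq_int => x; rewrite mulrA.
Qed.

Lemma hartleyB u v w : int1 u -> int1 v ->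
  hartley (fun x => u x - v x) w = hartley u w - hartley v w.
Proof.
move=> iu iv; rewrite /hartley -intB; [|exact: int1_cas|exact: int1_cas].
by apply: eq_int => x; rewrite mulrBl.
Qed.

End Hartley.

(** * Plancherel theorem *)

Section Poisson.
Context {R : realType}.
Local Notation mu := (@lebesgue_measure R).
Local Notation T := (measurableTypeR R).
Implicit Types (f g h u v : R -> R).

Lemma itv0y_setE : [set x : R | 0 <= x] = `[0, +oo[%classic.
Proof. by apply/seteqP; split => x /=; rewrite in_itv/= andbT. Qed.

(** [f] is even and may have a corner at [0]; [g] is the expression it equals for [x >= 0], which
    has an antiderivative on the whole line, [0] included. *)
Lemma ge0_symfun_FTC (f F g : R -> R) (l : R) : (forall x, 0 <= f x) -> continuous f ->
  f =1 f \o -%R -> (forall x : R, 0 <= x -> f x = g x) -> continuous g ->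
  (forall x : R, is_derive x 1 F (g x)) -> F x @[x --> +oo] --> l ->
  int1 f /\ \int[mu]_x f x = 2 * (l - F 0).
Proof.
move=> f0 cf fe fg cg dF cF.
have e : (\int[mu]_x (f x)%:E = (2 * (l - F 0))%:E)%E.
  rewrite ge0_symfun_integralT// itv0y_setE.
  transitivity (2 * \int[mu]_(x in `[0%R, +oo[) (g x)%:E)%E.
    congr (_ * _)%E; apply: eq_integral => x.
    by rewrite inE/= in_itv/= andbT => x0; rewrite fg.
  have g0 (x : R) : 0 <= x -> 0 <= g x by move=> x0; rewrite -fg.
  have cw : {within `[0, +oo[, continuous g} by exact: continuous_subspaceT.
  have dd (x : R) : 0 < x -> derivable F x 1 by move=> _; case: (dF x).
  have c0 : F x @[x --> 0^'+] --> F 0.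
    by apply: cvg_at_right_filter; exact: is_derive_continuous (dF 0).
  have dE : {in `]0, +oo[, derive1 F =1 g}.
    by move=> x _; rewrite derive1E; case: (dF x).
  by rewrite (ge0_continuous_FTC2y g0 cw cF dd c0 dE) -EFinB.
have if_ : int1 f.
  apply/integrableP; split; first by apply/measurable_EFinP; exact: continuous_measurable_fun.
  under eq_integral do rewrite gee0_abs ?lee_fin//.
  by rewrite e ltry.
by split => //; rewrite /Rintegral e.
Qed.

(** Abel factor: it makes integrals of products of transforms absolutely convergent, and [e -> 0]
    removes it. *)
Definition weight (e w : R) : R := expR (- (e * `|w|)).

Lemma weight_ge0 e w : 0 <= weight e w. Proof. exact: expR_ge0. Qed.

Lemma weight_continuous e : continuous (weight e).
Proof.
move=> x; apply: continuous_comp; last exact: continuous_expR.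
by apply: cvgN; apply: cvgMr; apply: cvg_norm; exact: cvg_id.
Qed.

(** The cosine is raised by [1] because [ge0_symfun_FTC] asks for a nonnegative integrand;
    [int_weight_cos] subtracts the mass of [weight], itself read off at [k = 0]. *)
Lemma weight_cos (e k : R) : 0 < e ->
  int1 (fun w => weight e w * (1 + cos (k * w))) /\
  \int[mu]_w (weight e w * (1 + cos (k * w))) = 2 / e + 2 * e / (e ^+ 2 + k ^+ 2).
Proof.
move=> e0.
pose D := e ^+ 2 + k ^+ 2.
have D0 : 0 < D by rewrite ltr_pwDl ?exprn_gt0 ?sqr_ge0.
pose F x := expR (- (e * x)) * (- e^-1 + D^-1 * (k * sin (k * x) - e * cos (k * x))).
have := @ge0_symfun_FTC (fun w => weight e w * (1 + cos (k * w))) F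
  (fun x => expR (- (e * x)) * (1 + cos (k * x))) 0.
case.
- move=> x; rewrite mulr_ge0 ?weight_ge0//; have := cos_geN1 (k * x); lra.
- apply: continuous_mul; first exact: weight_continuous.
  apply: continuous_add; first exact: continuous_const.
  apply: continuous_compose; last exact: continuous_cos.
  by apply: continuous_scale; exact: continuous_ident.
- by move=> x /=; rewrite /weight normrN mulrN cosN.
- by move=> x x0; rewrite /weight ger0_norm.
- apply: continuous_mul.
    apply: continuous_compose; last exact: continuous_expR.
    by move=> x; apply: cvgN; apply: continuous_scale; exact: continuous_ident.
  apply: continuous_add; first exact: continuous_const.
  apply: continuous_compose; last exact: continuous_cos.
  by apply: continuous_scale; exact: continuous_ident.
- move=> x.
  have d1 : is_derive x (1 : R) (fun x => expR (- (e * x))) (expR (- (e * x)) * (- (e * 1))).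
    by apply: dcomp; apply: dN; apply: dZ; exact: did.
  have dl : is_derive x (1 : R) (fun x => k * x) (k * 1) by apply: dZ; exact: did.
  have dc : is_derive x (1 : R) (fun x => cos (k * x)) (- sin (k * x) * (k * 1)) by exact: dcomp.
  have ds : is_derive x (1 : R) (fun x => sin (k * x)) (cos (k * x) * (k * 1)) by exact: dcomp.
  have := dM d1 (dD (dcst (- e^-1) x) (dZ D^-1 (dB (dZ k ds) (dZ e dc)))).
  move=> h; apply: is_derive_eq h _.
  by rewrite /D; field; rewrite !gt_eqF.
- have cE : expR (- (e * x)) @[x --> +oo] --> 0.
    apply: (@cvg_comp _ _ _ (fun x => e * x) (fun y => expR (- y)) _ (pinfty_nbhs R)).
      by apply: gt0_cvgMry => //; exact: cvg_id.
    exact: cvgr_expR.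
  have Bd x : `|- e^-1 + D^-1 * (k * sin (k * x) - e * cos (k * x))| <=
      e^-1 + D^-1 * (`|k| + e).
    have ei0 : 0 <= e^-1 by rewrite invr_ge0 ltW.
    have Di0 : 0 <= D^-1 by rewrite invr_ge0 ltW.
    apply: (le_trans (ler_normD _ _)); apply: lerD; first by rewrite normrN ger0_norm.
    rewrite normrM (ger0_norm Di0); apply: ler_wpM2l => //.
    apply: (le_trans (ler_normB _ _)); rewrite !normrM (ger0_norm (ltW e0)); apply: lerD.
      by rewrite ler_piMr// sin_max.
    by rewrite ler_piMr ?cos_max// ltW.
  apply: norm_cvg0.
  have cC : expR (- (e * x)) * (e^-1 + D^-1 * (`|k| + e)) @[x --> +oo] --> 0.
    by rewrite -(mul0r (e^-1 + D^-1 * (`|k| + e))); apply: cvgMl.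
  apply: (squeeze_cvgr _ (cvg_cst 0) cC); apply: nearW => x.
  by rewrite normr_ge0/= /F normrM ger0_norm ?expR_ge0// ler_wpM2l ?expR_ge0.
move=> i1 ->; split => //.
rewrite /F mulr0 oppr0 expR0 mulr0 sin0 cos0 -/D; field.
by rewrite !gt_eqF.
Qed.

Lemma weight_int1 (e : R) : 0 < e -> int1 (weight e).
Proof.
move=> e0; have [i0 _] := weight_cos 0 e0.
move: i0; under eq_fun do rewrite mul0r cos0.
move=> /(int1Z 2^-1); rewrite [X in int1 X -> _](_ : _ = weight e)//.
by apply: funext => w; field.
Qed.

Lemma int_weight_cos (e k : R) : 0 < e ->
  \int[mu]_w (weight e w * cos (k * w)) = 2 * e / (e ^+ 2 + k ^+ 2).
Proof.
move=> e0; have [i1 I1] := weight_cos k e0; have [i0 I0] := weight_cos 0 e0.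
have iw := weight_int1 e0.
have w2 : \int[mu]_w weight e w = 2 / e.
  move: I0; under eq_int do rewrite mul0r cos0 mulrC.
  rewrite intZ// expr0n/= addr0 => h.
  have -> : \int[mu]_w weight e w = 2^-1 * ((1 + 1) * \int[mu]_w weight e w) by field.
  by rewrite h; field; rewrite gt_eqF.
have := intB i1 iw; rewrite I1 w2 => h.
have -> : 2 * e / (e ^+ 2 + k ^+ 2) = 2 / e + 2 * e / (e ^+ 2 + k ^+ 2) - 2 / e by ring.
by rewrite -h; apply: eq_int => x; ring.
Qed.

Lemma int1_weight_cas (e a : R) : 0 < e -> int1 (fun w => weight e w * cas (a * w)).
Proof.
move=> e0; apply: (@int1_bounded_mul _ 2); [exact: weight_int1| |by move=> x; exact: cas_le].
exact: measurable_cas_lin.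
Qed.

Lemma int1_weight_sin (e k : R) : 0 < e -> int1 (fun w => weight e w * sin (k * w)).
Proof.
move=> e0; apply: (@int1_bounded_mul _ 1); [exact: weight_int1| |by move=> x; exact: sin_max].
apply: continuous_measurable_fun; apply: continuous_compose; last exact: continuous_sin.
by apply: continuous_scale; exact: continuous_ident.
Qed.

Lemma int1_weight_cosk (e k : R) : 0 < e -> int1 (fun w => weight e w * cos (k * w)).
Proof.
move=> e0; apply: (@int1_bounded_mul _ 1); [exact: weight_int1| |by move=> x; exact: cos_max].
apply: continuous_measurable_fun; apply: continuous_compose; last exact: continuous_cos.
by apply: continuous_scale; exact: continuous_ident.
Qed.

Lemma int_weight_sin (e k : R) : 0 < e ->
  \int[mu]_w (weight e w * sin (k * w)) = 0.
Proof.
move=> e0; have is_ := int1_weight_sin k e0.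
suff : \int[mu]_w (weight e w * sin (k * w)) = - \int[mu]_w (weight e w * sin (k * w)) by lra.
rewrite -{1}int_reflect// -intN//; apply: eq_int => x.
by rewrite /weight normrN mulrN sinN mulrN.
Qed.

(* [poisson e (s - t)] is the integral over [w] of
   [weight e w * cas (2 pi w s) * cas (2 pi w t)]. *)
Definition poisson (e r : R) : R := 2 * e / (e ^+ 2 + (2 * pi * r) ^+ 2).

Lemma int_weight_cas_cas (e s t : R) : 0 < e ->
  \int[mu]_w (weight e w * cas (2 * pi * s * w) * cas (2 * pi * t * w)) = poisson e (s - t).
Proof.
move=> e0.
rewrite (@eq_int _ _ (fun w => weight e w * cos (2 * pi * (s - t) * w)
    + weight e w * sin (2 * pi * (s + t) * w))); last first.
  move=> w; rewrite -mulrA casM mulrDr; congr (_ * cos _ + _ * sin _); ring.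
rewrite intD; [|exact: int1_weight_cosk|exact: int1_weight_sin].
by rewrite int_weight_cos// int_weight_sin// addr0.
Qed.

Lemma poisson_den_gt0 (e r : R) : 0 < e -> 0 < e ^+ 2 + (2 * pi * r) ^+ 2.
Proof. by move=> e0; rewrite ltr_pwDl ?exprn_gt0 ?sqr_ge0. Qed.

Lemma poisson_ge0 (e r : R) : 0 < e -> 0 <= poisson e r.
Proof. by move=> e0; rewrite divr_ge0 ?mulr_ge0 ?ltW// ?poisson_den_gt0. Qed.

Lemma poisson_le (e r : R) : 0 < e -> poisson e r <= 2 / e.
Proof.
move=> e0; rewrite /poisson ler_pdivrMr ?poisson_den_gt0//.
rewrite mulrDr; have -> : 2 / e * e ^+ 2 = 2 * e by field; rewrite ?gt_eqF//.
by rewrite lerDl mulr_ge0 ?sqr_ge0// divr_ge0// ltW.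
Qed.

Lemma poisson_sym (e r : R) : poisson e (- r) = poisson e r.
Proof. by rewrite /poisson mulrN sqrrN. Qed.

Lemma poisson_continuous (e : R) : 0 < e -> continuous (poisson e).
Proof.
move=> e0; apply: continuous_scale; apply: continuous_inv.
  by move=> x; rewrite gt_eqF// poisson_den_gt0.
apply: continuous_add; first exact: continuous_const.
by apply: continuous_sqr; apply: continuous_scale; exact: continuous_ident.
Qed.

Definition cauchy_density (y : R) : R := (pi * (1 + y ^+ 2))^-1.

Lemma cauchy_mass : int1 cauchy_density /\ \int[mu]_y cauchy_density y = 1.
Proof.
have p0 := @pi_gt0 R.
have d0 y : 0 < pi * (1 + y ^+ 2) :> R by rewrite mulr_gt0// ltr_pwDl// sqr_ge0.
have c : continuous cauchy_density.
  apply: continuous_inv => [x|]; first by rewrite gt_eqF.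
  apply: continuous_scale; apply: continuous_add; first exact: continuous_const.
  by apply: continuous_sqr; exact: continuous_ident.
have [|||||||i1 ->] := @ge0_symfun_FTC cauchy_density (fun y => pi^-1 * atan y) cauchy_density 2^-1 => //.
- by move=> y; rewrite invr_ge0 ltW.
- by move=> y /=; rewrite /cauchy_density sqrrN.
- move=> x; have := dZ pi^-1 (is_derive1_atan x).
  move=> h; apply: is_derive_eq h _.
  by rewrite /cauchy_density invfM.
- have -> : 2^-1 = pi^-1 * (pi / 2) :> R by rewrite mulKf// gt_eqF.
  by apply: cvgMr; exact: cvgy_atan.
by split => //; rewrite atan0 mulr0 subr0 divff.
Qed.

(** The substitution [y = 2 pi (t - s) / e] turns the kernel into [cauchy_density]. *)
Lemma poisson_mass (e s : R) : 0 < e ->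
  (\int[mu]_t (poisson e (s - t))%:E = 1)%E.
Proof.
move=> e0; have [i1 I1] := cauchy_mass; have p0 := @pi_gt0 R.
pose a := 2 * pi / e.
have a0 : 0 < a by rewrite divr_gt0// mulr_gt0.
pose F (t : R) : R := a * (t - s).
have dF t : is_derive t (1 : R) F a.
  by have := dZ a (dB (did t) (dcst s t)); rewrite subr0 mulr1.
have F' : derive1 F = cst a by apply/funext => t; rewrite derive1E; case: (dF t).
have cdc : continuous cauchy_density.
  rewrite /cauchy_density; apply: continuous_inv => [y|].
    by rewrite gt_eqF// mulr_gt0// ltr_pwDl// sqr_ge0.
  apply: continuous_scale; apply: continuous_add; first exact: continuous_const.
  by apply: continuous_sqr; exact: continuous_ident.
have := @increasing_ge0_integration_by_substitutionT R F cauchy_density.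
rewrite F'.
have -> : (\int[mu]_x (cauchy_density x)%:E = 1)%E by rewrite -EFin_int// I1.
move=> h; rewrite h.
- apply: eq_integral => t _; congr EFin.
  suff : poisson e (s - t) = cauchy_density (a * (t - s)) * a by [].
  rewrite /poisson /cauchy_density /a.
  have D1 := poisson_den_gt0 (s - t) e0.
  have aE : 1 + (2 * pi / e * (t - s)) ^+ 2 = (e ^+ 2 + (2 * pi * (s - t)) ^+ 2) / e ^+ 2.
    by move: (@pi R) => p; field; rewrite gt_eqF.
  rewrite aE; move: (e ^+ 2 + _) D1 => D D0.
  by move: (@pi R) p0 => p p0; field; rewrite !gt_eqF.
- by move=> x y xy; rewrite ltr_pM2l// ltrD2r.
- by move=> x; exact: cvg_cst.
- by apply/cvg_ex; exists a; exact: cvg_cst.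
- by apply/cvg_ex; exists a; exact: cvg_cst.
- by move=> t; case: (dF t).
- apply: gt0_cvgMrNy => //; apply/cvgrNyPle => A; exists (A + s).
  by split; [exact: num_real|move=> t /ltW; rewrite lerBlDr].
- by apply: gt0_cvgMry => //; exact: cvg_addrr.
- exact: cdc.
- by move=> y; rewrite invr_ge0 ltW// mulr_gt0// ltr_pwDl// sqr_ge0.
Qed.

End Poisson.

Section Plancherel.
Context {R : realType}.
Local Notation mu := (@lebesgue_measure R).
Local Notation T := (measurableTypeR R).
Implicit Types (f g h u v : R -> R).

Lemma measurable_poisson_kernel (e : R) : 0 < e ->
  measurable_fun [set: T * T] (fun z : T * T => poisson e (z.1 - z.2)).
Proof.
move=> e0; apply: (measurableT_comp (continuous_measurable_fun (poisson_continuous e0))).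
by apply: measurable_funB.
Qed.

Lemma poisson_norm_le (e r : R) : 0 < e -> `|poisson e r| <= 2 / e.
Proof. by move=> e0; rewrite ger0_norm ?poisson_ge0// poisson_le. Qed.

Lemma int1_poisson u (e s : R) : 0 < e -> int1 u -> int1 (fun t => u t * poisson e (s - t)).
Proof.
move=> e0 iu; apply: (@int1_kernel_l _ u (fun s t => poisson e (s - t)) (2 / e)) => //.
- exact: measurable_poisson_kernel.
- by move=> x y; exact: poisson_norm_le.
Qed.

Definition poisson_conv (e : R) u (s : R) : R := \int[mu]_t (u t * poisson e (s - t)).

Lemma int1_poisson1 (e s : R) : 0 < e -> int1 (fun t => poisson e (s - t)).
Proof.
move=> e0; apply/integrableP; split.
  apply/measurable_EFinP; apply: continuous_measurable_fun.
  apply: continuous_compose; last exact: poisson_continuous.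
  by apply: continuous_sub; [exact: continuous_const|exact: continuous_ident].
under eq_integral do rewrite gee0_abs ?lee_fin ?poisson_ge0//.
by rewrite poisson_mass// ltry.
Qed.

Lemma int_poisson1 (e s : R) : 0 < e -> \int[mu]_t (poisson e (s - t)) = 1.
Proof. by move=> e0; rewrite /Rintegral poisson_mass. Qed.

Lemma poisson_conv_mass (e : R) v : 0 < e -> int1 v -> (forall x, 0 <= v x) ->
  int1 (poisson_conv e v) /\ \int[mu]_s poisson_conv e v s = \int[mu]_t v t.
Proof.
move=> e0 iv v0.
have mv : measurable_fun [set: T] v := int1_measurable iv.
pose F (z : T * T) : \bar R := (v z.2 * poisson e (z.1 - z.2))%:E.
have mF : measurable_fun [set: T * T] F.
  apply/measurable_EFinP; apply: measurable_funM.
    exact: (measurableT_comp mv measurable_snd).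
  exact: measurable_poisson_kernel.
have F0 z : (0 <= F z)%E by rewrite lee_fin mulr_ge0// poisson_ge0.
have E1 s : (poisson_conv e v s)%:E = (\int[mu]_t F (s, t))%E.
  by rewrite /poisson_conv EFin_int//; exact: int1_poisson.
have E2 t : (\int[mu]_s F (s, t) = (v t)%:E)%E.
  rewrite /F /=; under eq_integral do rewrite EFinM.
  rewrite ge0_integralZl//.
  - under eq_integral => s _ do rewrite -opprB poisson_sym.
    by rewrite poisson_mass// mule1.
  - apply/measurable_EFinP; apply: continuous_measurable_fun.
    apply: continuous_compose; last exact: poisson_continuous.
    by apply: continuous_sub; [exact: continuous_ident|exact: continuous_const].
  - by move=> x _; rewrite lee_fin poisson_ge0.
  - by rewrite lee_fin.
have E3 : (\int[mu]_s (poisson_conv e v s)%:E = \int[mu]_t (v t)%:E)%E.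
  transitivity (\int[mu]_s \int[mu]_t F (s, t))%E; first by apply: eq_integral => s _.
  rewrite (fubini_tonelli F)//.
  by apply: eq_integral => t _; rewrite E2.
have q0 s : 0 <= poisson_conv e v s.
  by apply: int_ge0 => t; rewrite mulr_ge0// poisson_ge0.
split; last by rewrite /Rintegral E3.
apply/integrableP; split.
  suff -> : EFin \o poisson_conv e v = fubini_F mu F.
    exact: measurable_fun_fubini_tonelli_F.
  by apply/funext => s; rewrite /= E1.
under eq_integral do rewrite gee0_abs ?lee_fin//.
by rewrite E3 -EFin_int// ltry.
Qed.

(** Self-adjointness, used twice, moves both transforms onto the weight, where they produce the
    Poisson kernel. *)
Lemma weighted_hartley (e : R) u : 0 < e -> int1 u ->
  \int[mu]_w (weight e w * hartley u w * hartley u w) =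
  \int[mu]_s (u s * poisson_conv e u s).
Proof.
move=> e0 iu; have iv := int1_mul_hartley iu (weight_int1 e0).
rewrite (hartley_mul iu iv); apply: eq_int => s; congr (_ * _).
have iv' := int1_weight_cas (2 * pi * s) e0.
rewrite /hartley (_ : \int[mu]_t _ =
    \int[mu]_w (weight e w * cas (2 * pi * s * w) * hartley u w)); last first.
  by apply: eq_int => w; rewrite mulrAC.
rewrite (hartley_mul iu iv'); apply: eq_int => t; congr (_ * _).
by rewrite /hartley int_weight_cas_cas.
Qed.

Lemma poisson_conv_continuous (e : R) u : 0 < e -> int1 u -> continuous (poisson_conv e u).
Proof.
move=> e0 iu; apply: (kernel_continuous iu (measurable_poisson_kernel e0)) => [x y|y].
  exact: poisson_norm_le.
apply: continuous_compose; last exact: poisson_continuous.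
by apply: continuous_sub; [exact: continuous_ident|exact: continuous_const].
Qed.

Lemma int1_poisson_conv (e : R) u : 0 < e -> int1 u ->
  int1 (fun s => u s * poisson_conv e u s).
Proof.
move=> e0 iu.
apply: (@int1_bounded_mul _ (2 / e * \int[mu]_x `|u x|)) => //.
  by apply: continuous_measurable_fun; exact: poisson_conv_continuous.
move=> s; apply: (le_trans (int_abs (int1_poisson s e0 iu))).
rewrite -intZ; last exact: int1_norm.
apply: int_le.
- by apply: int1_norm; exact: int1_poisson.
- by apply: int1Z; exact: int1_norm.
- by move=> t; rewrite normrM mulrC ler_wpM2r// poisson_norm_le.
Qed.

(** Schur's test: [2 u(s) u(t) <= u(s)^2 + u(t)^2], and the kernel has mass one in each variable. *)
Lemma weighted_hartley_le (e : R) u : 0 < e -> int1 u -> sqint u ->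
  \int[mu]_w (weight e w * hartley u w * hartley u w) <= norm2 u.
Proof.
move=> e0 iu [mu_ iu2]; rewrite weighted_hartley//.
have [iq Iq] := poisson_conv_mass e0 iu2 (fun x => sqr_ge0 _).
suff : 2 * \int[mu]_s (u s * poisson_conv e u s) <= norm2 u + norm2 u by lra.
rewrite -{2}[norm2 u]Iq -intZ; last exact: int1_poisson_conv.
rewrite /norm2 -intD//; apply: int_le.
- by apply: int1Z; exact: int1_poisson_conv.
- exact: int1D.
move=> s; have ip := int1_poisson s e0.
have -> : u s ^+ 2 + poisson_conv e (fun x => u x ^+ 2) s =
    \int[mu]_t (u s ^+ 2 * poisson e (s - t) + u t ^+ 2 * poisson e (s - t)).
  rewrite intD; [|exact/int1Z/int1_poisson1|exact: ip].
  by rewrite intZ ?int_poisson1 ?mulr1//; exact: int1_poisson1.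
rewrite mulrA /poisson_conv -intZ; last exact: ip.
apply: int_le.
- by apply: int1Z; exact: ip.
- by apply: int1D; [exact/int1Z/int1_poisson1|exact: ip].
move=> t; rewrite mulrA -mulrDl ler_wpM2r ?poisson_ge0//.
by have := sqr_ge0 (u s - u t); rewrite sqrrB; lra.
Qed.

Lemma weight_cvg1 (w : R) : weight n.+1%:R^-1 w @[n --> \oo] --> (1 : R).
Proof.
have h : - (n.+1%:R^-1 * `|w|) @[n --> \oo] --> (0 : R).
  rewrite -[X in _ --> X]oppr0; apply: cvgN; rewrite -(mul0r `|w|); apply: cvgMl.
  exact: cvg_harmonic.
by rewrite /weight -[X in _ --> X]expR0; exact: (cvg_comp _ _ h (@continuous_expR R 0)).
Qed.

Lemma weight_nd (w : R) (n m : nat) : (n <= m)%N -> weight n.+1%:R^-1 w <= weight m.+1%:R^-1 w.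
Proof.
move=> nm; rewrite ler_expR lerN2 ler_wpM2r// lef_pV2 ?posrE ?ltr0n//.
by rewrite ler_nat ltnS.
Qed.

(** Along [e = 1 / (n + 1)] the weights increase to [1]: monotone convergence gives integrability
    and the bound, dominated convergence the limit. *)
Lemma hartley_L2 u : int1 u -> sqint u ->
  [/\ sqint (hartley u), norm2 (hartley u) <= norm2 u &
    \int[mu]_w (weight n.+1%:R^-1 w * hartley u w * hartley u w) @[n --> \oo] --> norm2 (hartley u)].
Proof.
move=> iu su; have mh := measurable_hartley iu.
pose G (n : nat) w := weight n.+1%:R^-1 w * hartley u w * hartley u w.
have G0 n w : 0 <= G n w by rewrite /G -mulrA mulr_ge0 ?weight_ge0// -expr2 sqr_ge0.
have n0 (n : nat) : 0 < n.+1%:R^-1 :> R by rewrite invr_gt0.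
have iG n : int1 (G n).
  by apply: int1_mul_hartley => //; apply: int1_mul_hartley => //; exact: weight_int1.
have Gcv w : G n w @[n --> \oo] --> hartley u w ^+ 2.
  have : G n w @[n --> \oo] --> 1 * hartley u w * hartley u w.
    by apply: cvgMl; apply: cvgMl; exact: weight_cvg1.
  by rewrite mul1r -expr2.
have mc := @cvg_monotone_convergence _ T R mu setT measurableT (fun n w => (G n w)%:E).
have lim_le : (\int[mu]_w (hartley u w ^+ 2)%:E <= (norm2 u)%:E)%E.
  have -> : (\int[mu]_w (hartley u w ^+ 2)%:E = \int[mu]_w limn (fun n => (G n w)%:E))%E.
    apply: eq_integral => w _; apply/esym/cvg_lim => //; apply: cvg_EFin; first exact: nearW.
    exact: Gcv.
  have cv : (\int[mu]_x (G n x)%:E @[n --> \oo] --> \int[mu]_x limn (fun n => (G n x)%:E))%E.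
    apply: mc.
    - by move=> n; apply/measurable_EFinP; exact: int1_measurable.
    - by move=> n x _; rewrite lee_fin.
    - move=> x _ n m nm; rewrite lee_fin /G -!mulrA ler_wpM2r -?expr2 ?sqr_ge0//.
      exact: weight_nd.
  rewrite -(cvg_lim _ cv)//; apply: lime_le; first by apply/cvg_ex; eexists; exact: cv.
  by apply: nearW => n; rewrite -EFin_int// lee_fin; exact: weighted_hartley_le.
have ih : int1 (fun w => hartley u w ^+ 2).
  apply/integrableP; split; first by apply/measurable_EFinP; exact: measurable_funX.
  under eq_integral do rewrite gee0_abs ?lee_fin ?sqr_ge0//.
  by apply: (le_lt_trans lim_le); rewrite ltry.
split => //.
  by rewrite -lee_fin /norm2 EFin_int.
have [|w|n w|_] := @int_dominated R G (fun w => hartley u w ^+ 2) (fun w => hartley u w ^+ 2) _ _ ih _.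
- by move=> n; exact: int1_measurable.
- exact: Gcv.
- rewrite ger0_norm// /G -mulrA -expr2 ler_piMl ?sqr_ge0//.
  by rewrite /weight expR_le1 oppr_le0 mulr_ge0// ltW.
exact.
Qed.

End Plancherel.

(** * Hartley isometry and inversion in L2 *)

Section Isometry.
Context {R : realType}.
Local Notation mu := (@lebesgue_measure R).
Implicit Types (f g h u v : R -> R).

(** Away from [0] the kernel is [O(e)] times the kernel at scale [1], which still has mass one; so
    far points contribute [O(e)] to the convolution with a bounded function. *)
Lemma poisson_tail (e d r : R) : 0 < e -> 0 < d -> d <= `|r| ->
  poisson e r <= e * (1 + ((2 * pi * d) ^+ 2)^-1) * poisson 1 r.
Proof.
move=> e0 d0 dr; rewrite /poisson.
have p0 : 0 < 2 * pi :> R by rewrite mulr_gt0// pi_gt0.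
have q0 : 0 < (2 * pi * d) ^+ 2 by rewrite exprn_gt0// mulr_gt0.
have qq : (2 * pi * d) ^+ 2 <= (2 * pi * r) ^+ 2.
  have h : 2 * pi * d <= `|2 * pi * r|.
    by rewrite normrM (gtr0_norm p0) ler_wpM2l// ltW.
  have h0 : 0 <= 2 * pi * d by rewrite ltW// mulr_gt0.
  by rewrite -[leRHS]real_normK ?num_real// ler_pXn2r// nnegrE.
move: ((2 * pi * d) ^+ 2) ((2 * pi * r) ^+ 2) q0 qq => a q a0 aq.
have q0 : 0 < q by exact: lt_le_trans aq.
rewrite expr1n ler_pdivrMr; last by apply: ltr_pwDl; [rewrite exprn_gt0|exact: ltW].
have h1 : 1 <= (1 + a^-1) / (1 + q) * q.
  rewrite mulrAC ler_pdivlMr; last by lra.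
  rewrite mul1r mulrDl mul1r addrC lerD2l.
  by rewrite mulrC ler_pdivlMr// mul1r.
have -> : e * (1 + a^-1) * (2 * 1 / (1 + q)) * (e ^+ 2 + q) =
    2 * e * ((1 + a^-1) / (1 + q) * q) + 2 * e * ((1 + a^-1) / (1 + q) * e ^+ 2) by ring.
have h2 : 0 <= (1 + a^-1) / (1 + q) * e ^+ 2.
  by rewrite mulr_ge0 ?divr_ge0 ?addr_ge0 ?invr_ge0 ?sqr_ge0// ltW.
have h3 : 2 * e <= 2 * e * ((1 + a^-1) / (1 + q) * q).
  by rewrite ler_peMr// mulr_ge0// ltW.
by rewrite (le_trans h3)// lerDl mulr_ge0// mulr_ge0// ltW.
Qed.

(** Continuity is asked at [s] only: the functions to be treated may jump at the ends of an
    interval. *)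
Lemma poisson_conv_cvg u (M s : R) : int1 u -> (forall x, `|u x| <= M) ->
  (forall eta : R, 0 < eta -> exists2 d : R, 0 < d &
    forall t, `|s - t| < d -> `|u s - u t| <= eta) ->
  poisson_conv n.+1%:R^-1 u s @[n --> \oo] --> u s.
Proof.
move=> iu uM us; apply: cvg_dist_le => e e0.
have e20 : 0 < e / 2 by rewrite divr_gt0.
have [d d0 hd] := us _ e20.
have M0 : 0 <= M by exact: le_trans (uM 0).
pose C : R := 1 + ((2 * pi * d) ^+ 2)^-1.
have C0 : 0 <= C by rewrite addr_ge0// invr_ge0 sqr_ge0.
(* The far part contributes at most [2 M C / (n + 1)]; the [+ 1] keeps the quotient safe if [M] or
   [C] vanishes. *)
have [|N hN] := @invSn_le R (e / 2 / (2 * M * C + 1)).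
  by rewrite divr_gt0// ltr_wpDl// !mulr_ge0.
exists N => // n /= /hN.
have en0 : 0 < n.+1%:R^-1 :> R by rewrite invr_gt0.
move: (n.+1%:R^-1 : R) en0 => en en0 hen.
have {}hen : 2 * M * C * en <= e / 2.
  move: hen; rewrite ler_pdivlMr ?ltr_wpDl ?mulr_ge0//.
  by rewrite mulrDr mulr1 mulrC; have := ltW en0; lra.
have i1 := int1_poisson1 s en0; have i2 := int1_poisson1 s (@ltr01 R).
have ip := int1_poisson s en0 iu.
have -> : u s - poisson_conv en u s = \int[mu]_t ((u s - u t) * poisson en (s - t)).
  have uE : u s = \int[mu]_t (u s * poisson en (s - t)).
    by rewrite (intZ _ i1) int_poisson1// mulr1.
  rewrite {1}uE /poisson_conv -intB//; last exact: int1Z.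
  by apply: eq_int => t; rewrite mulrBl.
have id : int1 (fun t => (u s - u t) * poisson en (s - t)).
  have := int1B (int1Z (u s) i1) ip; rewrite [X in int1 X -> _](_ : _ =
    (fun t => (u s - u t) * poisson en (s - t)))//.
  by apply: funext => t; rewrite mulrBl.
apply: (le_trans (int_abs id)).
apply: (@le_trans _ _ (\int[mu]_t (e / 2 * poisson en (s - t)
    + 2 * M * (en * C) * poisson 1 (s - t)))); last first.
  rewrite intD; [|exact: int1Z|exact: int1Z].
  by rewrite (intZ _ i1) (intZ _ i2) !int_poisson1// !mulr1; lra.
apply: int_le; [exact: int1_norm|by apply: int1D; exact: int1Z|].
have K0 : 0 <= 2 * M * (en * C) by rewrite mulr_ge0 ?mulr_ge0 ?(ltW en0).
move=> t; rewrite normrM (ger0_norm (poisson_ge0 _ en0)).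
have pe := poisson_ge0 (s - t) en0; have p1 := poisson_ge0 (s - t) (@ltr01 R).
case: (ltrP `|s - t| d) => st.
  rewrite -[leLHS]addr0 lerD//; first by rewrite ler_wpM2r// hd.
  exact: mulr_ge0.
rewrite -[leLHS]add0r lerD//; first by apply: mulr_ge0 => //; exact: ltW.
rewrite -[leRHS]mulrA; apply: ler_pM => //; last exact: poisson_tail.
by rewrite (le_trans (ler_normB _ _))//; have := uM s; have := uM t; lra.
Qed.

Lemma plancherel_continuous g (n : nat) (M : R) : continuous g -> (forall x, `|g x| <= M) ->
  let u := (fun x => g x * \1_(`]- n%:R, n%:R[) x) in
  [/\ int1 u, sqint u & norm2 (hartley u) = norm2 u].
Proof.
move=> cg gM u.
have mg : measurable_fun setT g by exact: continuous_measurable_fun.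
have iu : int1 u.
  rewrite /u; under eq_fun do rewrite mulrC.
  by apply: (@int1_bounded_mul _ M) => //; exact: int1_indic.
have uM x : `|u x| <= M.
  rewrite /u indicE; case: (_ \in _); rewrite ?mulr1// mulr0 normr0.
  exact: le_trans (gM 0).
have su : sqint u by apply: (sqint_bounded (M := M)) => //; exact: int1_measurable.
split => //.
have [sh _ cvh] := hartley_L2 iu su.
suff cvu : \int[mu]_w (weight k.+1%:R^-1 w * hartley u w * hartley u w) @[k --> \oo] --> norm2 u.
  exact: (cvg_unique _ cvh cvu).
have n0 (k : nat) : 0 < k.+1%:R^-1 :> R by rewrite invr_gt0.
rewrite (_ : (fun k : nat => _) = (fun k : nat =>
    \int[mu]_s (u s * poisson_conv k.+1%:R^-1 u s))); last first.
  by apply/funext => k; exact: weighted_hartley.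
have [|s|k s|_] := @int_dominated R (fun k s => u s * poisson_conv k.+1%:R^-1 u s)
  (fun s => u s ^+ 2) (fun s => M * `|u s|) _ _ (int1Z M (int1_norm iu)) _.
- by move=> k; apply: int1_measurable; exact: int1_poisson_conv.
(* Off the open interval, endpoints included, [u s = 0] and both sides vanish; inside, [u] agrees
   with [g] near [s] and is continuous there. *)
- rewrite expr2; case: (ltrP `|s| n%:R) => sn; last first.
    have -> : u s = 0.
      rewrite /u indicE memNset ?mulr0//= in_itv/= -ltr_norml.
      by apply/negP; rewrite -leNgt.
    by under eq_fun do rewrite mul0r; rewrite mul0r; exact: cvg_cst.
  apply: cvgMr; apply: (poisson_conv_cvg iu uM) => eta eta0.
  have [d /= d0 hd] := (cvgrPdist_le _ _).1 (cg s) eta eta0.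
  exists (Num.min d (n%:R - `|s|)); first by rewrite lt_min d0 subr_gt0.
  move=> t; rewrite lt_min => /andP[td tn].
  have tn' : `|t| < n%:R.
    have -> : t = s - (s - t) by rewrite opprB addrC subrK.
    by rewrite (le_lt_trans (ler_normB _ _))//; lra.
  rewrite /u !indicE !mem_set/= ?in_itv/= -?ltr_norml// !mulr1.
  exact: hd.
- rewrite normrM mulrC ler_wpM2r//.
  have ip := int1_poisson s (n0 k) iu; have i1 := int1_poisson1 s (n0 k).
  apply: (le_trans (int_abs ip)).
  have ME : M = \int[mu]_t (M * poisson k.+1%:R^-1 (s - t)).
    by rewrite (intZ _ i1) int_poisson1// mulr1.
  rewrite [leRHS]ME; apply: int_le; [exact: int1_norm|exact: int1Z|].
  by move=> t; rewrite normrM (ger0_norm (poisson_ge0 _ (n0 k))) ler_wpM2r ?poisson_ge0.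
exact.
Qed.

(** By density from truncated continuous functions: the contraction bound already known controls the
    transform of the approximation error. *)
Theorem hartley_plancherel u : int1 u -> sqint u -> norm2 (hartley u) = norm2 u.
Proof.
move=> iu su; have [sh hle _] := hartley_L2 iu su.
apply/eqP; rewrite eq_le hle/= leNgt; apply/negP => lt.
set A := norm2 (hartley u) in lt hle *; set N := norm2 u in lt hle *.
have A0 : 0 <= A by exact: norm2_ge0.
(* Approximating to accuracy [eta^2] turns [1 + 1 / eta] times the error into at most [eta^2 + eta].
   The chain then yields [N <= A + eta (3 A + 6)], and for this [eta] the right side is at most the
   midpoint of [A] and [N]. *)
pose eta : R := Num.min 1 ((N - A) / (2 * (3 * A + 6))).
have D0 : 0 < 2 * (3 * A + 6) by lra.
have eta0 : 0 < eta by rewrite lt_min ltr01 divr_gt0// subr_gt0.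
have eta1 : eta <= 1 by rewrite ge_min lexx.
have eta2 : eta * (2 * (3 * A + 6)) <= N - A.
  by rewrite -ler_pdivlMr// ge_min lexx orbT.
have [g [n [M [cg gM ge]]]] := L2_density su (exprn_gt0 2 eta0).
have [iw sw nw] := plancherel_continuous n cg gM.
set w := (fun x => g x * _) in ge iw sw nw.
have [shw _ _] := hartley_L2 iw sw.
have idf := int1B iu iw; have sdf := sqintB su sw.
have [shd hd _] := hartley_L2 idf sdf.
have hdE : hartley (fun x => u x - w x) = (fun x => hartley u x - hartley w x).
  by apply/funext => x; exact: hartleyB.
rewrite hdE in shd hd.
have e1 : N <= (1 + eta) * norm2 w + (1 + eta^-1) * norm2 (fun x => u x - w x).
  have := norm2D_le eta0 sw sdf; rewrite [X in X <= _](_ : _ = N)//.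
  by congr norm2; apply/funext => x; rewrite addrC subrK.
have e2 : norm2 w <= (1 + eta) * A + (1 + eta^-1) * norm2 (fun x => hartley u x - hartley w x).
  have := norm2D_le eta0 sh (sqintN shd); rewrite -nw [X in X <= _](_ : _ = norm2 (hartley w)).
    rewrite (_ : norm2 (fun x => - _) = norm2 (fun x => hartley u x - hartley w x))//.
    by apply: eq_int => x; rewrite sqrrN.
  by congr norm2; apply/funext => x; rewrite opprB addrC subrK.
have e3 := le_trans hd ge.
have ei : eta^-1 * eta ^+ 2 = eta by rewrite expr2 mulKf// gt_eqF.
have ei0 : 0 < eta^-1 by rewrite invr_gt0.
move: (norm2 (fun x => u x - w x)) (norm2 (fun x => hartley u x - hartley w x)) (norm2 w) e1 e2 ge e3 hd.
move=> a b c e1 e2 a2 b2 _.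
clearbody eta A N; have et0 := ltW eta0.
have h1 : (1 + eta^-1) * a <= eta ^+ 2 + eta.
  apply: (@le_trans _ _ ((1 + eta^-1) * eta ^+ 2)); first by rewrite ler_wpM2l// ltW// addr_gt0.
  by rewrite mulrDl mul1r ei.
have h2 : (1 + eta^-1) * b <= eta ^+ 2 + eta.
  apply: (@le_trans _ _ ((1 + eta^-1) * eta ^+ 2)); first by rewrite ler_wpM2l// ltW// addr_gt0.
  by rewrite mulrDl mul1r ei.
have es : eta ^+ 2 <= eta by rewrite expr2 ler_piMl// ltW.
have h3 : (1 + eta) * c <= (1 + eta) * ((1 + eta) * A + (eta ^+ 2 + eta)).
  by apply: ler_wpM2l; lra.
have h4 : (1 + eta) * ((1 + eta) * A + (eta ^+ 2 + eta)) <= (1 + 3 * eta) * A + 4 * eta.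
  move: es; rewrite expr2; nra.
by nra.
Qed.

(** Expand both squares: the norms agree by isometry, the cross terms by self-adjointness. This
    stands in for the involution property, whose second transform is not directly defined when
    [hartley p] is not integrable. *)
Lemma norm2_hartley_swap (p k : R -> R) : int1 p -> sqint p -> int1 k -> sqint k ->
  norm2 (fun x => hartley p x - k x) = norm2 (fun x => p x - hartley k x).
Proof.
move=> ip sp ik sk.
have [sp' _ _] := hartley_L2 ip sp; have [sk' _ _] := hartley_L2 ik sk.
rewrite !norm2E (si_sqrB (@semi_inner_L2 R) sp' sk) (si_sqrB (@semi_inner_L2 R) sp sk').
rewrite -!norm2E !hartley_plancherel//; congr (_ - 2 * _ + _).
rewrite /dot -hartley_mul//; by apply: eq_int => x; rewrite mulrC.
Qed.

(** The swap turns the second limit into convergence of [p n] to [hartley k], while the first one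
    says that [p n] tends to [P]. *)
Theorem hartley_inversion_L2 (p : nat -> R -> R) (P k : R -> R) :
  (forall n, int1 (p n)) -> (forall n, sqint (p n)) -> sqint P -> int1 k -> sqint k ->
  norm2 (fun x => p n x - P x) @[n --> \oo] --> 0 ->
  norm2 (fun x => hartley (p n) x - k x) @[n --> \oo] --> 0 ->
  {ae mu, forall x, P x = hartley k x}.
Proof.
move=> ip sp sP ik sk c1 c2.
have [sk' _ _] := hartley_L2 ik sk.
have sd : sqint (fun x => P x - hartley k x) by exact: sqintB.
suff h : norm2 (fun x => P x - hartley k x) = 0.
  by have := norm2_eq0 sd h; apply: ae_imp => x /eqP; rewrite subr_eq0 => /eqP.
apply/eqP; rewrite eq_le norm2_ge0 andbT.
have cv : 2 * norm2 (fun x => p n x - P x) + 2 * norm2 (fun x => hartley (p n) x - k x)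
    @[n --> \oo] --> (2 * 0 + 2 * 0 : R).
  by apply: cvgD; apply: cvgMr.
rewrite !mulr0 addr0 in cv.
rewrite -(cvg_lim _ cv)//; apply: limr_ge; first by apply/cvg_ex; eexists; exact: cv.
apply: nearW => n; rewrite norm2_hartley_swap//.
have := norm2D_le2 (sqintN (sqintB (sp n) sP)) (sqintB (sp n) sk').
rewrite (_ : norm2 (fun x => - _) = norm2 (fun x => p n x - P x)).
  rewrite [X in X <= _](_ : _ = norm2 (fun x => P x - hartley k x))//.
  by congr norm2; apply/funext => x; ring.
by apply: eq_int => x; rewrite sqrrN.
Qed.

(** Supplies the integrable approximants that the definition of the [L2] Fourier transform asks for,
    as [hartley k] itself may fail to be integrable. The swap reduces the last limit to the one
    before it. *)
Lemma hartley_truncate_cvg (k : R -> R) : int1 k -> sqint k ->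
  let p := (fun n : nat => fun x => hartley k x * \1_(`[- n%:R, n%:R]) x) in
  [/\ forall n, int1 (p n), forall n, sqint (p n),
    norm2 (fun x => p n x - hartley k x) @[n --> \oo] --> 0 &
    norm2 (fun x => hartley (p n) x - k x) @[n --> \oo] --> 0].
Proof.
move=> ik sk p; have [sk' _ _] := hartley_L2 ik sk.
have ip n : int1 (p n) by exact: int1_truncate.
have sp n : sqint (p n) by apply: sqint_truncate => //; exact: measurable_itv.
have c := truncate_cvg sk'.
split => //; under eq_fun do rewrite norm2_hartley_swap//.
exact: c.
Qed.

End Isometry.

(** * Wirtinger inequalities *)

Section IntervalIntegrals.
Context {R : realType}.
Local Notation mu := (@lebesgue_measure R).
Implicit Types (f g F : R -> R) (a b c : R).

Definition cont_on a b f := forall x, a <= x <= b -> {for x, continuous f}.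

Definition itg a b f := \int[mu]_(x in `[a, b]) f x.

Lemma cont_on_within a b f : cont_on a b f -> {within `[a, b], continuous f}.
Proof.
move=> cf; apply: continuous_in_subspaceT => x; rewrite inE/= in_itv/=.
exact: cf.
Qed.

Lemma cont_on_integrable a b f : cont_on a b f -> mu.-integrable `[a, b] (EFin \o f).
Proof.
move=> cf; apply: continuous_compact_integrable; first exact: segment_compact.
exact: cont_on_within.
Qed.

Lemma continuous_cont_on a b f : continuous f -> cont_on a b f.
Proof. by move=> cf x _; exact: cf. Qed.

Lemma itgD a b f g : cont_on a b f -> cont_on a b g ->
  itg a b (fun x => f x + g x) = itg a b f + itg a b g.
Proof. by move=> cf cg; apply: RintegralD => //; exact: cont_on_integrable. Qed.

Lemma itgZ a b k f : cont_on a b f -> itg a b (fun x => k * f x) = k * itg a b f.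
Proof. by move=> cf; apply: RintegralZl => //; exact: cont_on_integrable. Qed.

Lemma eq_itg a b f g : (forall x, a <= x <= b -> f x = g x) -> itg a b f = itg a b g.
Proof. by move=> fg; apply: eq_Rintegral => x; rewrite inE/= in_itv/=; exact: fg. Qed.

Lemma itg_le a b f g : cont_on a b f -> cont_on a b g ->
  (forall x, a <= x <= b -> f x <= g x) -> itg a b f <= itg a b g.
Proof.
move=> cf cg fg; apply: le_Rintegral => //; try exact: cont_on_integrable.
Qed.

Lemma itg_ge0 a b f : (forall x, a <= x <= b -> 0 <= f x) -> 0 <= itg a b f.
Proof. by move=> f0; apply: Rintegral_ge0 => x /=; rewrite in_itv/=; exact: f0. Qed.

Lemma itg_cst a b k : a <= b -> itg a b (fun=> k) = k * (b - a).
Proof.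
move=> ab; have h : mu `[a, b] = (b - a)%:E.
  rewrite lebesgue_measure_itv/= lte_fin; case: ltP => // ba.
  by have -> : b = a; [apply/eqP; rewrite eq_le ab ba|rewrite subrr].
by rewrite /itg Rintegral_cst// -[X in fine X]/(mu `[a, b]) h.
Qed.

Lemma itg_split a c b f : a <= c -> c <= b -> cont_on a b f ->
  itg a b f = itg a c f + itg c b f.
Proof.
move=> ac cb cf; have := @Rintegral_itvB R f (BLeft a) (BRight b) c (cont_on_integrable cf).
rewrite !bnd_simp => /(_ ac cb) h.
rewrite /itg; apply/eqP; rewrite addrC -subr_eq h; apply/eqP.
apply: Rintegral_itv_obnd_cbnd.
apply: integrableS (cont_on_integrable cf) => //.
by apply: subset_itvr; rewrite bnd_simp.
Qed.

Lemma itg_FTC a b f F : a <= b -> (forall x, a <= x <= b -> is_derive x (1 : R) F (f x)) ->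
  cont_on a b f -> itg a b f = F b - F a.
Proof.
rewrite le_eqVlt => /predU1P[-> _ _|ab dF cf].
  by rewrite subrr /itg set_itv1 Rintegral_set1.
rewrite /itg /Rintegral (@continuous_FTC2 _ f F)//.
- exact: cont_on_within.
- have cF x : a <= x <= b -> {for x, continuous F}.
    by move=> h; exact: is_derive_continuous (dF x h).
  split.
  + move=> x; rewrite in_itv/= => /andP[/ltW ax /ltW xb].
    by case: (dF x _); rewrite ?ax.
  + by apply: cvg_at_right_filter; apply: cF; rewrite lexx ltW.
  + by apply: cvg_at_left_filter; apply: cF; rewrite lexx ltW.
- move=> x; rewrite in_itv/= => /andP[/ltW ax /ltW xb].
  by rewrite derive1E; case: (dF x _); rewrite ?ax.
Qed.

Lemma cont_onD a b f g : cont_on a b f -> cont_on a b g -> cont_on a b (fun x => f x + g x).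
Proof. by move=> cf cg x h; apply: cvgD; [exact: cf|exact: cg]. Qed.

Lemma cont_onM a b f g : cont_on a b f -> cont_on a b g -> cont_on a b (fun x => f x * g x).
Proof. by move=> cf cg x h; apply: cvgM; [exact: cf|exact: cg]. Qed.

Lemma cont_onZ a b k f : cont_on a b f -> cont_on a b (fun x => k * f x).
Proof. by move=> cf x h; apply: cvgMr; exact: cf. Qed.

Lemma cont_onX a b f : cont_on a b f -> cont_on a b (fun x => f x ^+ 2).
Proof. by move=> cf; exact: (cont_onM cf cf). Qed.


Lemma tan_derive (x : R) : cos x != 0 -> is_derive x (1 : R) tan (1 + tan x ^+ 2).
Proof.
by move=> c0; apply: is_derive_eq (is_derive_tan c0) _; rewrite cos2_tan2.
Qed.

(* Integrate the square [(K' + k tan (k (t - m)) K)^2]. *)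
Lemma wirtinger_tan (K K' : R -> R) (k m p q : R) : p <= q -> 0 < k ->
  (forall x : R, is_derive x (1 : R) K (K' x)) -> continuous K' ->
  (forall t, p <= t <= q -> `|k * (t - m)| < pi / 2) ->
  k ^+ 2 * itg p q (fun t => K t ^+ 2) <= itg p q (fun t => K' t ^+ 2)
    + (k * tan (k * (q - m)) * K q ^+ 2 - k * tan (k * (p - m)) * K p ^+ 2).
Proof.
move=> pq k0 dK cK' km.
have cK : continuous K by move=> x; exact: is_derive_continuous (dK x).
pose th (t : R) : R := tan (k * (t - m)).
have dth t : p <= t <= q -> is_derive t (1 : R) th ((1 + th t ^+ 2) * k).
  move=> /km; rewrite ltr_norml => tm.
  have c0 : cos (k * (t - m)) != 0 by rewrite gt_eqF// cos_gt0_pihalf.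
  have dl : is_derive t (1 : R) (fun t => k * (t - m)) k.
    by apply: is_derive_eq (dZ k (dB (did t) (dcst m t))) _; rewrite subr0 mulr1.
  exact: (dcomp (f := fun t => k * (t - m)) (tan_derive c0) dl).
have cth : cont_on p q th by move=> t /dth /is_derive_continuous.
pose D' t := k * ((1 + th t ^+ 2) * k) * K t ^+ 2 + k * th t * (2 * K t * K' t).
have cD' : cont_on p q D'.
  apply: cont_onD.
    apply: cont_onM; last by apply: continuous_cont_on; exact: continuous_sqr.
    apply: cont_onZ; apply: cont_onM; last by move=> x _; exact: cvg_cst.
    by apply: cont_onD; [move=> x _; exact: cvg_cst|exact: cont_onX].
  apply: cont_onM; first exact: cont_onZ.
  apply: continuous_cont_on; apply: continuous_mul => //.
  exact: continuous_scale.
have FTC : itg p q D' = k * th q * K q ^+ 2 - k * th p * K p ^+ 2.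
  have dF t (h : p <= t <= q) := dM (dZ k (dth t h)) (dsqr (dK t)).
  exact: itg_FTC pq dF cD'.
have c1 : cont_on p q (fun t => K t ^+ 2) by apply: continuous_cont_on; exact: continuous_sqr.
have c2 : cont_on p q (fun t => K' t ^+ 2) by apply: continuous_cont_on; exact: continuous_sqr.
rewrite -[in leRHS]FTC -itgZ// -itgD//.
apply: itg_le; [exact: cont_onZ|exact: cont_onD|].
move=> t _; rewrite /D'; have := sqr_ge0 (K' t + k * th t * K t).
by rewrite sqrrD !exprMn; move: (th t) (K t) (K' t) => x y z; rewrite !expr2; lra.
Qed.

(** With [l] half the length, the intermediate value theorem gives [c] with [H (c + l) = H c].
    Subtracting this value splits the period into two arcs of length [l] with zeros at their ends,
    and [k l < pi] is the Dirichlet condition on each. *)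
Lemma wirtinger_periodic (H H' : R -> R) (k a b : R) : a < b -> 0 < k ->
  k * (b - a) < 2 * pi ->
  (forall x : R, is_derive x (1 : R) H (H' x)) -> continuous H' ->
  H a = H b -> itg a b H = 0 ->
  k ^+ 2 * itg a b (fun t => H t ^+ 2) <= itg a b (fun t => H' t ^+ 2).
Proof.
move=> ab k0 kL dH cH' Hab H0.
have cH : continuous H by move=> x; exact: is_derive_continuous (dH x).
pose l := (b - a) / 2.
have l0 : 0 < l by rewrite divr_gt0// subr_gt0.
have lb : a + l + l = b by rewrite /l; lra.
have [c] : exists2 c, c \in `[a, a + l] & H (c + l) - H c = 0.
  apply: IVT.
  - by rewrite lerDl ltW.
  - apply: continuous_subspaceT; apply: continuous_sub => //.
    apply: continuous_compose => //.
    by apply: continuous_add; [exact: continuous_ident|exact: continuous_const].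
  - rewrite lb -Hab; move: (H (a + l)) (H a) => x y.
    rewrite ge_min le_max !subr_le0 !subr_ge0.
    by have [xy|/ltW xy] := lerP x y; rewrite ?xy ?orbT.
rewrite in_itv/= => /andP[ac cl] /eqP; rewrite subr_eq0 => /eqP Hc.
pose K t := H t - H c.
have dK (x : R) : is_derive x (1 : R) K (H' x).
  by apply: is_derive_eq (dB (dH x) (dcst (H c) x)) _; rewrite subr0.
have Kc : K c = 0 by rewrite /K subrr.
have Kcl : K (c + l) = 0 by rewrite /K Hc subrr.
have Kab : K a = K b by rewrite /K Hab.
have kl : k * l < pi by move: kL; rewrite /l; move: (@pi R) => p; lra.
have small (t m : R) : m - l / 2 <= t <= m + l / 2 -> `|k * (t - m)| < pi / 2.
  move=> /andP[t1 t2]; rewrite normrM gtr0_norm//.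
  have : `|t - m| <= l / 2 by rewrite ler_norml; lra.
  by move: (`|t - m|) kl k0 => d; move: (@pi R) => p; nra.
have cK2 : continuous (fun t => K t ^+ 2).
  by apply: continuous_sqr; apply: continuous_sub => //; exact: continuous_const.
have cH2 : continuous (fun t => H' t ^+ 2) by exact: continuous_sqr.
have split f : continuous f -> itg a b f = itg a c f + itg c (c + l) f + itg (c + l) b f.
  move=> cf; rewrite (@itg_split a c b)//; [|by lra|exact: continuous_cont_on].
  rewrite (@itg_split c (c + l) b)//; [by rewrite addrA|by lra|by lra|exact: continuous_cont_on].
have Kmain : k ^+ 2 * itg a b (fun t => K t ^+ 2) <= itg a b (fun t => H' t ^+ 2).
  (* One arc is [[c, c + l]], the other wraps around through [b] and [a]. The tangents on its two
     parts are centred at points one period [b - a] apart, so the boundary terms at [a] and [b]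
     cancel because [K a = K b]; those at [c] and [c + l] vanish. *)
  rewrite !split//.
  have i1 : k ^+ 2 * itg a c (fun t => K t ^+ 2) <= itg a c (fun t => H' t ^+ 2)
      + (k * tan (k * (c - (c - l / 2))) * K c ^+ 2 - k * tan (k * (a - (c - l / 2))) * K a ^+ 2).
    by apply: wirtinger_tan => // t /andP[t1 t2]; apply: small; lra.
  have i2 : k ^+ 2 * itg c (c + l) (fun t => K t ^+ 2) <= itg c (c + l) (fun t => H' t ^+ 2)
      + (k * tan (k * (c + l - (c + l / 2))) * K (c + l) ^+ 2
        - k * tan (k * (c - (c + l / 2))) * K c ^+ 2).
    by apply: wirtinger_tan => //; [lra|move=> t /andP[t1 t2]; apply: small; lra].
  have i3 : k ^+ 2 * itg (c + l) b (fun t => K t ^+ 2) <= itg (c + l) b (fun t => H' t ^+ 2)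
      + (k * tan (k * (b - (c + l + l / 2))) * K b ^+ 2
        - k * tan (k * (c + l - (c + l + l / 2))) * K (c + l) ^+ 2).
    by apply: wirtinger_tan => //; [lra|move=> t /andP[t1 t2]; apply: small; lra].
  have bE : b - (c + l + l / 2) = a - (c - l / 2) by rewrite -lb; lra.
  move: i1 i2 i3; rewrite Kcl Kc bE -Kab expr0n/= !mulr0; lra.
(* As [H] has mean zero, subtracting [H c] only adds [H c ^ 2 (b - a)] to the integral of the
   square. *)
apply: le_trans Kmain; rewrite ler_wpM2l ?sqr_ge0//.
have c0 : cont_on a b (fun=> H c ^+ 2) by move=> x _; exact: cvg_cst.
have cHH : cont_on a b (fun t => H t ^+ 2) by apply: continuous_cont_on; exact: continuous_sqr.
rewrite (_ : itg a b (fun t => K t ^+ 2) = itg a b (fun t => H t ^+ 2) + H c ^+ 2 * (b - a)).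
  by rewrite lerDl mulr_ge0 ?sqr_ge0// subr_ge0 ltW.
rewrite -itg_cst ?ltW// -itgD//.
have -> : itg a b (fun t => H t ^+ 2 + H c ^+ 2) = itg a b (fun t => H t ^+ 2 + H c ^+ 2)
    + (- (2 * H c)) * itg a b H by rewrite H0 mulr0 addr0.
rewrite -itgZ; last exact: continuous_cont_on.
rewrite -itgD; [|exact: cont_onD|by apply: cont_onZ; exact: continuous_cont_on].
by apply: eq_itg => t _; rewrite /K; ring.
Qed.

End IntervalIntegrals.

(** * Estimates between two consecutive nodes *)

Section LocalInequalities.
Context {R : realType}.
Implicit Types (a b : R).

(* After subtracting from [f'] the affine function with the same mean and the
   same increment over [[a, b]], the periodic Wirtinger inequality applies. *)
Lemma local_frame_inequality (f f1 f2 : R -> R) (k eta g a b : R) :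
  (forall x : R, is_derive x (1 : R) f (f1 x)) ->
  (forall x : R, is_derive x (1 : R) f1 (f2 x)) -> continuous f2 ->
  0 < k -> 0 < eta -> 0 < g -> g <= b - a -> k * (b - a) < 2 * pi ->
  k ^+ 2 * itg a b (fun t => f1 t ^+ 2) <= (1 + eta) * itg a b (fun t => f2 t ^+ 2)
    + k ^+ 2 * (1 + eta^-1) * (4 * g^-1 + 2 * pi * k^-1)
      * (f a ^+ 2 + f b ^+ 2 + f1 a ^+ 2 + f1 b ^+ 2).
Proof.
move=> df df1 cf2 k0 eta0 g0 gL kL.
have cf : continuous f by move=> x; exact: is_derive_continuous (df x).
have cf1 : continuous f1 by move=> x; exact: is_derive_continuous (df1 x).
have ab : a < b by lra.
pose L := b - a; have L0 : 0 < L by rewrite subr_gt0.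
pose c : R := (f b - f a) / L; pose m : R := (f1 b - f1 a) / L.
pose mid : R := (a + b) / 2.
pose l (t : R) : R := c + m * (t - mid).
have dl (t : R) : is_derive t (1 : R) l m.
  by apply: is_derive_eq (dD (dcst c t) (dZ m (dB (did t) (dcst mid t)))) _; ring.
have cl : continuous l by move=> x; exact: is_derive_continuous (dl x).
pose H (t : R) : R := f1 t - l t.
have dH (t : R) : is_derive t (1 : R) H (f2 t - m) by exact: dB.
have cH : continuous H by exact: continuous_sub.
have cH' : continuous (fun t => f2 t - m) by apply: continuous_sub => //; exact: continuous_const.
have mL : m * L = f1 b - f1 a by rewrite /m divfK// gt_eqF.
have cL : c * L = f b - f a by rewrite /c divfK// gt_eqF.
have Hab : H a = H b.
  by rewrite /H /l /mid; move: mL; rewrite /L; lra.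
have H0 : itg a b H = 0.
  pose Fp (t : R) : R := f t - (c * t + m / 2 * (t - mid) ^+ 2).
  have -> : 0 = Fp b - Fp a by rewrite /Fp /mid; move: cL; rewrite /L; lra.
  apply: itg_FTC.
  - exact: ltW.
  - move=> x _.
    have := dB (df x) (dD (dZ c (did x)) (dZ (m / 2) (dsqr (dB (did x) (dcst mid x))))).
    by move=> h; apply: is_derive_eq h _; rewrite /H /l; field.
  - exact: continuous_cont_on.
have W := wirtinger_periodic ab k0 kL dH cH' Hab H0.
have c2 : cont_on a b (fun t => f2 t ^+ 2) by apply: continuous_cont_on; exact: continuous_sqr.
(* [m] is the mean of [f2] on the interval, and removing the mean does not increase the integral of
   the square. *)
have h2 : itg a b (fun t => (f2 t - m) ^+ 2) <= itg a b (fun t => f2 t ^+ 2).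
  have cm : cont_on a b (fun t => m ^+ 2 - 2 * m * f2 t).
    by apply: continuous_cont_on; apply: continuous_sub; [exact: continuous_const|exact: continuous_scale].
  rewrite (_ : itg a b (fun t => (f2 t - m) ^+ 2) =
      itg a b (fun t => f2 t ^+ 2) + itg a b (fun t => m ^+ 2 - 2 * m * f2 t)); last first.
    by rewrite -itgD//; apply: eq_itg => t _; ring.
  rewrite gerDl.
  have -> : itg a b (fun t => m ^+ 2 - 2 * m * f2 t) =
      (m ^+ 2 * b - 2 * m * f1 b) - (m ^+ 2 * a - 2 * m * f1 a).
    apply: (@itg_FTC _ a b _ (fun t => m ^+ 2 * t - 2 * m * f1 t)) => //; first exact: ltW.
    move=> x _; have := dB (dZ (m ^+ 2) (did x)) (dZ (2 * m) (df1 x)).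
    by rewrite mulr1.
  have -> : m ^+ 2 * b - 2 * m * f1 b - (m ^+ 2 * a - 2 * m * f1 a) =
      m * (m * L) - 2 * m * (f1 b - f1 a) by rewrite /L; ring.
  by rewrite -mL; have : 0 <= m ^+ 2 * L; [rewrite mulr_ge0 ?sqr_ge0 ?ltW|rewrite expr2; lra].
pose S := f a ^+ 2 + f b ^+ 2 + f1 a ^+ 2 + f1 b ^+ 2.
have Lpi : L <= 2 * pi * k^-1.
  by rewrite ler_pdivlMr// mulrC ltW.
have gi : L^-1 <= g^-1 by rewrite lef_pV2 ?posrE.
have S0 : 0 <= S by rewrite !addr_ge0 ?sqr_ge0.
(* Here the samples enter: the midpoint value [c] of [l] and its slope [m] are difference quotients
   of [f] and [f1]. After integration the first costs [1 / L <= 1 / g], the second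
   [L <= 2 pi / k]. *)
have hl : itg a b (fun t => l t ^+ 2) <= (4 * g^-1 + 2 * pi * k^-1) * S.
  have lt t : a <= t <= b -> l t ^+ 2 <= 2 * c ^+ 2 + 2 * (m * L / 2) ^+ 2.
    move=> /andP[at_ tb]; have h := sqr_ge0 (c - m * (t - mid)).
    have h3 : (m * (t - mid)) ^+ 2 <= (m * L / 2) ^+ 2.
      rewrite -mulrA ![(m * _) ^+ 2]exprMn; apply: ler_wpM2l; first exact: sqr_ge0.
      by rewrite -subr_ge0 subr_sqr; apply: mulr_ge0; rewrite /L /mid; lra.
    by move: h h3; rewrite /l; lra.
  apply: (@le_trans _ _ (itg a b (fun=> 2 * c ^+ 2 + 2 * (m * L / 2) ^+ 2))).
    apply: itg_le => //; first by apply: continuous_cont_on; exact: continuous_sqr.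
    by move=> x _; exact: cvg_cst.
  rewrite (itg_cst _ (ltW ab)) -/L mL mulrDl.
  have -> : 2 * c ^+ 2 * L = 2 * L^-1 * (f b - f a) ^+ 2.
    by rewrite -cL; field; rewrite gt_eqF.
  have e1 : (f b - f a) ^+ 2 <= 2 * S.
    have := sqr_ge0 (f b + f a); have := sqr_ge0 (f1 a); have := sqr_ge0 (f1 b).
    by rewrite /S; lra.
  have e2 : (f1 b - f1 a) ^+ 2 <= 2 * S.
    have := sqr_ge0 (f1 b + f1 a); have := sqr_ge0 (f a); have := sqr_ge0 (f b).
    by rewrite /S; lra.
  have Li0 : 0 < L^-1 by rewrite invr_gt0.
  have t1 : 2 * L^-1 * (f b - f a) ^+ 2 <= 4 * g^-1 * S.
    apply: (@le_trans _ _ (2 * L^-1 * (2 * S))).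
      by rewrite ler_wpM2l// mulr_ge0// ltW.
    by have := ler_wpM2r S0 gi; lra.
  have t2 : 2 * ((f1 b - f1 a) / 2) ^+ 2 * L <= 2 * pi * k^-1 * S.
    apply: (@le_trans _ _ (L * S)).
      rewrite exprMn mulrC; apply: ler_wpM2l; first exact: ltW.
      by move: e2; rewrite exprVn; lra.
    exact: ler_wpM2r.
  by rewrite [leRHS]mulrDl; exact: lerD.
have cl2 : cont_on a b (fun t => l t ^+ 2) by apply: continuous_cont_on; exact: continuous_sqr.
have cH2 : cont_on a b (fun t => H t ^+ 2) by apply: continuous_cont_on; exact: continuous_sqr.
have h1 : itg a b (fun t => f1 t ^+ 2) <=
    (1 + eta) * itg a b (fun t => H t ^+ 2) + (1 + eta^-1) * itg a b (fun t => l t ^+ 2).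
  rewrite -!itgZ// -itgD; [|exact: cont_onZ|exact: cont_onZ].
  apply: itg_le.
  - by apply: continuous_cont_on; exact: continuous_sqr.
  - by apply: cont_onD; exact: cont_onZ.
  move=> t _; have -> : f1 t = H t + l t by rewrite /H subrK.
  have := sqr_ge0 (eta * H t - l t).
  rewrite sqrrB exprMn => h.
  have : 0 <= eta * H t ^+ 2 - 2 * (H t * l t) + eta^-1 * l t ^+ 2.
    have -> : eta * H t ^+ 2 - 2 * (H t * l t) + eta^-1 * l t ^+ 2 =
      eta^-1 * (eta ^+ 2 * H t ^+ 2 - eta * H t * l t *+ 2 + l t ^+ 2).
      by field; rewrite gt_eqF.
    by rewrite mulr_ge0// invr_ge0 ltW.
  by lra.
have ei0 : 0 <= eta^-1 by rewrite invr_ge0 ltW.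
have k20 : 0 <= k ^+ 2 by exact: sqr_ge0.
have W2 := le_trans W h2.
apply: (le_trans (ler_wpM2l k20 h1)).
rewrite mulrDr; apply: lerD.
  rewrite mulrCA; apply: ler_wpM2l => //; lra.
rewrite -[leRHS]mulrA -[leRHS]mulrA; apply: ler_wpM2l => //; apply: ler_wpM2l; first lra.
exact: hl.
Qed.

(** Integrate the derivative of [(b - t) f(t)^2]: the weight removes the end [b] and leaves the
    sample at [a]. *)
Lemma sampling_bound (f f1 : R -> R) a b : a < b ->
  (forall x : R, is_derive x (1 : R) f (f1 x)) -> continuous f1 ->
  (b - a) * f a ^+ 2 <= 2 * itg a b (fun t => f t ^+ 2)
    + (b - a) ^+ 2 * itg a b (fun t => f1 t ^+ 2).
Proof.
move=> ab df cf1.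
have cf : continuous f by move=> x; exact: is_derive_continuous (df x).
pose D (t : R) : R := - f t ^+ 2 + (b - t) * (2 * f t * f1 t).
have cbt : continuous (fun t : R => b - t).
  by apply: continuous_sub; [exact: continuous_const|exact: continuous_ident].
have cD2 : continuous (fun t => (b - t) * (2 * f t * f1 t)).
  by apply: continuous_mul => //; apply: continuous_mul => //; exact: continuous_scale.
have cf2 : continuous (fun t => f t ^+ 2) by exact: continuous_sqr.
have cf12 : continuous (fun t => f1 t ^+ 2) by exact: continuous_sqr.
have cD : continuous D by apply: continuous_add => //; move=> x; apply: cvgN; exact: cf2.
have FTC : itg a b D = - ((b - a) * f a ^+ 2).
  have -> : - ((b - a) * f a ^+ 2) = (b - b) * f b ^+ 2 - (b - a) * f a ^+ 2 by ring.
  apply: (@itg_FTC _ a b D (fun t => (b - t) * f t ^+ 2)).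
  - exact: ltW.
  - move=> x _; have := dM (dB (dcst b x) (did x)) (dsqr (df x)).
    by move=> h; apply: is_derive_eq h _; rewrite /D; ring.
  - exact: continuous_cont_on.
have : itg a b (fun t => - 1 * D t) <= itg a b (fun t => 2 * f t ^+ 2 + (b - a) ^+ 2 * f1 t ^+ 2).
  apply: itg_le.
  - by apply: continuous_cont_on; exact: continuous_scale.
  - by apply: continuous_cont_on; apply: continuous_add; exact: continuous_scale.
  move=> t /andP[at_ tb]; rewrite /D.
  have h := sqr_ge0 (f t + (b - t) * f1 t).
  have h3 : ((b - t) * f1 t) ^+ 2 <= (b - a) ^+ 2 * f1 t ^+ 2.
    rewrite exprMn; apply: ler_wpM2r; first exact: sqr_ge0.
    by rewrite ler_pXn2r// ?nnegrE; lra.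
  by move: h h3; lra.
have -> : itg a b (fun t => - 1 * D t) = - 1 * itg a b D.
  by apply: itgZ; exact: continuous_cont_on.
have c1 := continuous_cont_on (a := a) (b := b) cf2; have c2 := continuous_cont_on (a := a) (b := b) cf12.
rewrite (itgD (@cont_onZ _ a b 2 _ c1) (@cont_onZ _ a b ((b - a) ^+ 2) _ c2)).
rewrite (itgZ _ c1) (itgZ _ c2) FTC.
by lra.
Qed.

(** The identity behind [sampling_bound], solved for the integral of [f^2] instead of the sample;
    half of that integral absorbs the mixed term. *)
Lemma interval_L2_bound (f f1 : R -> R) a b : a < b ->
  (forall x : R, is_derive x (1 : R) f (f1 x)) -> continuous f1 ->
  itg a b (fun t => f t ^+ 2) <= 2 * (b - a) * f a ^+ 2
    + 4 * (b - a) ^+ 2 * itg a b (fun t => f1 t ^+ 2).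
Proof.
move=> ab df cf1.
have cf : continuous f by move=> x; exact: is_derive_continuous (df x).
pose D (t : R) : R := - f t ^+ 2 + (b - t) * (2 * f t * f1 t).
have cbt : continuous (fun t : R => b - t).
  by apply: continuous_sub; [exact: continuous_const|exact: continuous_ident].
have cD2 : continuous (fun t => (b - t) * (2 * f t * f1 t)).
  by apply: continuous_mul => //; apply: continuous_mul => //; exact: continuous_scale.
have cf2 : continuous (fun t => f t ^+ 2) by exact: continuous_sqr.
have cf12 : continuous (fun t => f1 t ^+ 2) by exact: continuous_sqr.
have cD : continuous D by apply: continuous_add => //; move=> x; apply: cvgN; exact: cf2.
have FTC : itg a b D = - ((b - a) * f a ^+ 2).
  have -> : - ((b - a) * f a ^+ 2) = (b - b) * f b ^+ 2 - (b - a) * f a ^+ 2 by ring.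
  apply: (@itg_FTC _ a b D (fun t => (b - t) * f t ^+ 2)).
  - exact: ltW.
  - move=> x _; have := dM (dB (dcst b x) (did x)) (dsqr (df x)).
    by move=> h; apply: is_derive_eq h _; rewrite /D; ring.
  - exact: continuous_cont_on.
have : itg a b D <= itg a b (fun t => - 2^-1 * f t ^+ 2 + 2 * (b - a) ^+ 2 * f1 t ^+ 2).
  apply: itg_le.
  - by apply: continuous_cont_on.
  - by apply: continuous_cont_on; apply: continuous_add; exact: continuous_scale.
  move=> t /andP[at_ tb]; rewrite /D.
  have h := sqr_ge0 (f t - 2 * ((b - t) * f1 t)).
  have h3 : ((b - t) * f1 t) ^+ 2 <= (b - a) ^+ 2 * f1 t ^+ 2.
    rewrite exprMn; apply: ler_wpM2r; first exact: sqr_ge0.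
    by rewrite ler_pXn2r// ?nnegrE; lra.
  by move: h h3; lra.
have c1 := continuous_cont_on (a := a) (b := b) cf2; have c2 := continuous_cont_on (a := a) (b := b) cf12.
rewrite (itgD (@cont_onZ _ a b (- 2^-1) _ c1) (@cont_onZ _ a b (2 * (b - a) ^+ 2) _ c2)).
rewrite (itgZ _ c1) (itgZ _ c2) FTC.
by lra.
Qed.

End LocalInequalities.

(** * Paley-Wiener space and sampling *)

Section PaleyWiener.
Context {R : realType}.
Local Notation mu := (@lebesgue_measure R).
Local Notation T := (measurableTypeR R).
Implicit Types (f g h u v : R -> R).
Variable b : R.
Hypothesis b0 : 0 < b.

(** Spectra vanish off the band at every point, not almost everywhere: a representative is fixed
    once, so that later estimates can be pointwise. *)
Definition PW h := sqint h /\ forall w, b < `|w| -> h w = 0.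

Let D : set R := `[- b, b]%classic.

Let mD : measurable (D : set T). Proof. exact: measurable_itv. Qed.

Let inD w : D w <-> `|w| <= b.
Proof. by rewrite /D/= in_itv/= ler_norml. Qed.

Lemma PW_indic h w : PW h -> h w * \1_D w = h w.
Proof.
case=> _ h0; rewrite indicE; case: (pselect (D w)) => Dw; first by rewrite mem_set// mulr1.
by rewrite memNset// mulr0 h0// ltNge; apply/negP => /inD.
Qed.

Lemma PW_of_sqint h : sqint h -> PW (fun w => h w * \1_D w).
Proof.
move=> sh; split; first exact: sqint_truncate.
move=> w bw; rewrite indicE memNset ?mulr0// => /inD.
by rewrite leNgt bw.
Qed.

Lemma PW_int1 h : PW h -> int1 h.
Proof.
move=> Ph; have := int1_truncate (- b) b true false Ph.1.
by rewrite [X in int1 X -> _](_ : _ = h)//; apply/funext => w; rewrite (PW_indic w Ph).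
Qed.

Lemma PW_sqint h : PW h -> sqint h. Proof. by case. Qed.

Lemma semi_inner_PW : @semi_inner R (R -> R^o) PW (@dot R).
Proof.
have S := @semi_inner_L2 R; split.
- by split; [exact: sqint0|].
- move=> a u v [su u0] [sv v0]; split; first exact: (si_lin S a su sv).
  by move=> w bw; rewrite -[LHS]/(a * u w + v w) u0// v0// mulr0 addr0.
- by move=> u v [su _] [sv _]; exact: (si_sym S).
- by move=> a u v w [su _] [sv _] [sw _]; exact: (si_linl S).
- by move=> u [su _]; exact: (si_ge0 S).
Qed.

Lemma PW_complete : @complete_for R (R -> R^o) PW (@dot R).
Proof.
move=> u Pu uC; have [l sl ul] := L2_complete (fun n => (Pu n).1) uC.
have Pl := PW_of_sqint sl.
exists (fun w => l w * \1_D w) => // e e0; have [N hN] := ul e e0.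
exists N => n /hN; apply: le_trans; rewrite -!norm2E.
have [_ i1] := sqintB (Pu n).1 Pl.1; have [_ i2] := sqintB (Pu n).1 sl.
apply: int_le => // w.
rewrite -[(u n - _) w]/(u n w - l w * \1_D w) -[(u n - l) w]/(u n w - l w).
rewrite indicE; case: (pselect (D w)) => Dw; first by rewrite mem_set// mulr1.
by rewrite memNset// mulr0 (Pu n).2 ?subr0 ?expr0n ?sqr_ge0// ltNge; apply/negP => /inD.
Qed.

Lemma hartley_PW_isometry h : PW h -> norm2 (hartley h) = norm2 h.
Proof. by move=> Ph; apply: hartley_plancherel; [exact: PW_int1|exact: PW_sqint]. Qed.

Lemma hartley_PW_sqint h : PW h -> sqint (hartley h).
Proof. by move=> Ph; have [] := hartley_L2 (PW_int1 Ph) (PW_sqint Ph). Qed.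

(** Spectrum of the derivative: the derivative of [cas x] is [cas (- x)], so differentiating the
    kernel gives [2 pi w cas (- 2 pi w t)], and the reflection [w -> - w] restores the kernel. *)
Definition hderiv h (w : R) : R := - (2 * pi * w) * h (- w).

Lemma hderiv_PW h : PW h -> PW (hderiv h).
Proof.
move=> Ph; have [sh h0] := Ph; split; last first.
  by move=> w bw; rewrite /hderiv h0 ?mulr0// normrN.
have p0 := @pi_gt0 R.
apply: (sqint_le (g := fun w => 2 * pi * b * `|h (- w)|)).
- apply: measurable_funM.
    by apply: continuous_measurable_fun => x; apply: cvgN; apply: continuous_scale; exact: continuous_ident.
  by apply: measurable_reflect; case: sh.
- move=> w; rewrite /hderiv normrM normrN !normrM (gtr0_norm p0) gtr0_norm//.
  case: (lerP `|w| b) => bw; last by rewrite h0 ?normrN// normr0 !mulr0.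
  by rewrite ler_wpM2r// ler_wpM2l// mulr_ge0// ltW.
- apply: sqintZ; apply: (sqint_le (g := fun w => `|h (- w)|)).
  + by apply: measurableT_comp => //; apply: measurable_reflect; case: sh.
  + by move=> w; rewrite normr_id.
  + split; first by apply: measurableT_comp => //; apply: measurable_reflect; case: sh.
    have [_] := sqint_reflect sh.
    by apply: eq_integrable => // w _ /=; rewrite real_normK ?num_real.
Qed.

Lemma norm2_hderiv h : PW h -> norm2 (hderiv h) <= (2 * pi * b) ^+ 2 * norm2 h.
Proof.
move=> Ph; have [sh h0] := Ph; have [_ i1] := (hderiv_PW Ph).1.
have sr := sqint_reflect sh; have [_ i2] := sr.
rewrite -(norm2_reflect sh) -intZ//; apply: int_le => //; first exact: int1Z.
move=> w; rewrite /hderiv exprMn.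
case: (lerP `|w| b) => bw; last by rewrite h0 ?normrN// expr0n !mulr0.
apply: ler_wpM2r; first exact: sqr_ge0.
rewrite sqrrN ![(2 * pi * _) ^+ 2]exprMn; apply: ler_wpM2l; first exact: sqr_ge0.
by rewrite -[w ^+ 2]real_normK ?num_real// ler_pXn2r ?nnegrE// ltW.
Qed.

Lemma hartley_deriv h (t : R) : PW h ->
  is_derive t (1 : R) (hartley h) (hartley (hderiv h) t).
Proof.
move=> Ph; have ih := PW_int1 Ph; have h0 := Ph.2.
have p0 := @pi_gt0 R.
pose f (t w : R) : R := h w * cas (2 * pi * t * w).
have df (s w : R) : is_derive s (1 : R) (f ^~ w) (h w * ((2 * pi * w) * cas (- (2 * pi * s * w)))).
  have dl : is_derive s (1 : R) (fun s => 2 * pi * s * w) (2 * pi * w).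
    apply: is_derive_eq (dM (dZ (2 * pi) (did s)) (dcst w s)) _.
    by rewrite mulr1 mulr0 addr0.
  have dc := dcomp (f := fun s => 2 * pi * s * w) (is_derive_cos _) dl.
  have ds := dcomp (f := fun s => 2 * pi * s * w) (is_derive_sin _) dl.
  have := dZ (h w) (dD dc ds) => d; apply: is_derive_eq d _.
  by rewrite /cas cosN sinN; ring.
have tI : `]t - 1, t + 1[%classic t by rewrite /= in_itv/=; apply/andP; split; lra.
have d1E s w : partial1of2 f s w = h w * ((2 * pi * w) * cas (- (2 * pi * s * w))).
  by rewrite partial1of2E; have [_ ->] := df s w.
(* Majorant for the differentiated integrand: [|w| <= b] wherever [h] is nonzero, and [cas] is at
   most [2] in modulus. *)
pose G (w : R) : R := 2 * pi * b * 2 * `|h w|.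
have G_ub (x y : R) : `]t - 1, t + 1[%classic x -> setT y -> `|partial1of2 f x y| <= G y.
  move=> _ _; rewrite d1E /G normrM.
  case: (lerP `|y| b) => yb; last by rewrite h0// normr0 mulr0 mul0r.
  rewrite mulrC ler_wpM2r// normrM; apply: ler_pM => //; last exact: cas_le.
  by rewrite !normrM (gtr0_norm p0) gtr0_norm// ler_wpM2l// mulr_ge0// ltW.
have G0 y : 0 <= G y by rewrite /G !mulr_ge0// ltW.
have iG : int1 G by apply: int1Z; exact: int1_norm.
have if_ (x : R) : `]t - 1, t + 1[%classic x -> int1 (f x) by move=> _; exact: int1_cas.
have derf (x y : R) : `]t - 1, t + 1[%classic x -> setT y -> derivable (f^~ y) x 1.
  by move=> _ _; case: (df x y).
have D1 := @derivable_under_integral R _ T mu f setT measurableT t (t - 1) (t + 1) tI if_ derf G G0 iG G_ub.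
have D2 := @differentiation_under_integral R _ T mu f setT measurableT t (t - 1) (t + 1) tI if_ derf G G0 iG G_ub.
split; first exact: D1.
rewrite -derive1E [LHS]D2.
have -> : hartley (hderiv h) t = \int[mu]_w (hderiv h (- w) * cas (2 * pi * t * (- w))).
  by rewrite (@int_reflect _ (fun w => hderiv h w * cas (2 * pi * t * w)))//; apply: int1_cas; apply: PW_int1; exact: hderiv_PW.
apply: eq_int => w; rewrite d1E /hderiv opprK !mulrN opprK.
by rewrite mulrCA mulrA.
Qed.

Lemma hartley_PW_continuous h : PW h -> continuous (hartley h).
Proof. by move=> Ph t; exact: is_derive_continuous (hartley_deriv t Ph). Qed.

(** Cauchy-Schwarz against [cas] cut to the band, whose square is at most [4] on a set of measure
    [2 b]. *)
Lemma hartley_PW_point h (t : R) : PW h -> (hartley h t) ^+ 2 <= 8 * b * norm2 h.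
Proof.
move=> Ph; have [sh h0] := Ph.
pose k (w : R) : R := cas (2 * pi * t * w) * \1_D w.
have mk : measurable_fun setT k.
  by apply: measurable_funM; [exact: measurable_cas_lin|exact: measurable_indic].
have iD : int1 (\1_D : R -> R) by exact: int1_indic.
have k2 w : k w ^+ 2 <= 4 * \1_D w.
  rewrite /k indicE exprMn; case: (_ \in D) => /=; last by rewrite expr0n !mulr0.
  have := cas_le (2 * pi * t * w); rewrite expr1n !mulr1 -real_normK ?num_real// => hc.
  by have : 0 <= `|cas (2 * pi * t * w)| by []; move: hc; move: (`|cas _|) => x; nra.
have ik2 : int1 (fun w => k w ^+ 2).
  apply: int1_le (int1Z 4 iD); first exact: measurable_funX.
  by move=> w; rewrite ger0_norm ?sqr_ge0.
have sk : sqint k by split.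
have Ek : hartley h t = dot h k.
  rewrite /hartley /dot; apply: eq_int => w; rewrite /k mulrCA mulrC.
  by rewrite -{1}(PW_indic w Ph); ring.
have nk : norm2 k <= 8 * b.
  apply: (@le_trans _ _ (\int[mu]_w (4 * \1_D w))).
    by apply: int_le => //; exact: int1Z.
  have muD : mu D = (b + b)%:E.
    have bb : - b < b by rewrite (lt_trans _ b0)// oppr_lt0.
    by rewrite lebesgue_measure_itv/= lte_fin bb opprK.
  rewrite intZ// /Rintegral integral_indic// setIT -[X in fine X]/(mu D) muD /=; lra.
have := si_cauchy_schwarz (@semi_inner_L2 R) sh sk.
rewrite -!norm2E Ek => hcs; apply: (le_trans hcs).
by rewrite mulrC ler_wpM2r// norm2_ge0.
Qed.

Lemma hartley_0_fun : hartley (0 : R -> R^o) = (0 : R -> R^o).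
Proof.
apply/funext => t; rewrite /hartley (_ : \int[mu]_t0 _ = \int[mu]_x (0 * 0)).
  by rewrite intZ ?mul0r//; exact: int1_0.
by apply: eq_int => x; rewrite -[(0 : R -> R^o) x]/(0 : R) !mul0r.
Qed.

Lemma hderiv_lin a (u v : R -> R^o) : hderiv (a *: u + v) = a *: (hderiv u : R -> R^o) + hderiv v.
Proof.
apply/funext => w; rewrite /hderiv.
rewrite -[(a *: u + v) (- w)]/(a * u (- w) + v (- w)).
rewrite -[RHS]/(a * (- (2 * pi * w) * u (- w)) + (- (2 * pi * w) * v (- w))).
by rewrite mulrDr mulrCA.
Qed.

Lemma hartley_lin a (u v : R -> R^o) t : PW u -> PW v ->
  hartley (a *: u + v) t = a * hartley u t + hartley v t.
Proof.
move=> Pu Pv; rewrite -hartleyZ; last exact: PW_int1.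
rewrite -hartleyD//; [by apply: int1Z; exact: PW_int1|exact: PW_int1].
Qed.

End PaleyWiener.

(** * Frame bounds for samples of values and derivatives *)

Section FrameBounds.
Context {R : realType}.
Local Notation mu := (@lebesgue_measure R).
Implicit Types (f g h u v : R -> R).
Variables (x : int -> R) (gam del : R).
Hypotheses (gam0 : 0 < gam) (gapl : forall i : int, gam <= x (i + 1) - x i)
  (gapr : forall i : int, x (i + 1) - x i <= del).

Let xlt i : x i < x (i + 1).
Proof. by have := gapl i; have := gam0; lra. Qed.

Lemma nodes_addn i (n : nat) : x i + gam * n%:R <= x (i + n%:Z).
Proof.
elim: n => [|n IH]; first by rewrite mulr0 !addr0.
have -> : i + n.+1%:Z = i + n%:Z + 1 by rewrite -addrA -PoszD addn1.
have := gapl (i + n%:Z); rewrite -natr1; lra.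
Qed.

Lemma nodes_le i j : i <= j -> x i <= x j.
Proof.
move=> ij; have ji0 : 0 <= j - i by rewrite subr_ge0.
have e : i + `|j - i|%N%:Z = j by rewrite gez0_abs// [LHS]addrC subrK.
have := nodes_addn i `|j - i|; rewrite e.
have : 0 <= gam * `|j - i|%N%:R :> R by rewrite mulr_ge0// ltW.
lra.
Qed.

Lemma itg_le_int a b g : int1 g -> (forall t, 0 <= g t) -> itg a b g <= \int[mu]_t g t.
Proof.
move=> ig g0; rewrite /itg /Rintegral.
apply: fine_le.
- by apply: integrable_fin_num => //; apply: integrableS ig.
- exact: integrable_fin_num.
apply: ge0_subset_integral => //.
- by apply/measurable_EFinP; exact: int1_measurable.
- by move=> t _; rewrite lee_fin.
Qed.

Lemma sum_itg_le (s : seq int) g : uniq s -> int1 g -> (forall t, 0 <= g t) ->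
  \sum_(i <- s) itg (x i) (x (i + 1)) g <= \int[mu]_t g t.
Proof.
move=> us ig g0.
pose F i : set R := `[x i, x (i + 1)[%classic.
have mF i : measurable (F i : set (measurableTypeR R)) by exact: measurable_itv.
have iF i : mu.-integrable (F i) (EFin \o g) by apply: integrableS ig.
have itgE i : (itg (x i) (x (i + 1)) g)%:E = (\int[mu]_(t in F i) (g t)%:E)%E.
  rewrite /itg -Rintegral_itv_bndo_bndc; last exact: iF.
  by rewrite /Rintegral fineK//; exact: integrable_fin_num (iF i).
rewrite -lee_fin -sumEFin EFin_int//.
rewrite (eq_bigr (fun i => \int[mu]_(t in F i) (g t)%:E)%E); last by move=> i _; exact: itgE.
have tF : trivIset [set` s] F.
  apply/trivIsetP => i j _ _ ij; rewrite -subset0 => t []; rewrite /F /= !in_itv/=.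
  move=> /andP[i1 i2] /andP[j1 j2].
  have [lt|lt|eq] := ltgtP i j; last by rewrite eq eqxx in ij.
    by have := @nodes_le (i + 1) j; rewrite lezD1 => /(_ lt); lra.
  by have := @nodes_le (j + 1) i; rewrite lezD1 => /(_ lt); lra.
have mg : measurable_fun [set: measurableTypeR R] (EFin \o g).
  by apply/measurable_EFinP; exact: int1_measurable.
rewrite -(@ge0_integral_bigsetU _ _ _ mu int F (EFin \o g) s mF us tF)//.
- apply: ge0_subset_integral => //.
  + by apply: bigsetU_measurable => i _; exact: mF.
  + by move=> t _; rewrite lee_fin.
- by apply: measurable_funTS.
- by move=> t _; rewrite lee_fin.
Qed.

Variables (b : R).
Hypothesis b0 : 0 < b.
Local Notation sigma := (2 * pi * b).

Let sigma0 : 0 < sigma.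
Proof. by rewrite !mulr_gt0// pi_gt0. Qed.

Lemma del_gt0 : 0 < del.
Proof. by have := gapl 0; have := gapr 0; have := gam0; lra. Qed.

(** [sampling_bound] divided by the gap length and summed over disjoint gaps; Bernstein's inequality
    turns the derivative term into [sigma ^+ 2]. *)
Lemma sample_sum_le (s : seq int) u : uniq s -> PW b u ->
  \sum_(i <- s) hartley u (x i) ^+ 2 <= (2 / gam + del * sigma ^+ 2) * norm2 u.
Proof.
move=> us Pu; have Pu1 := hderiv_PW Pu.
have [_ i0] := hartley_PW_sqint Pu; have [_ i1] := hartley_PW_sqint Pu1.
pose f0 t := hartley u t ^+ 2; pose f1 t := hartley (hderiv u) t ^+ 2.
apply: (@le_trans _ _ (2 / gam * \sum_(i <- s) itg (x i) (x (i + 1)) f0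
    + del * \sum_(i <- s) itg (x i) (x (i + 1)) f1)); last first.
  rewrite [leRHS]mulrDl; apply: lerD.
    apply: ler_wpM2l; first by rewrite divr_ge0// ltW.
    by rewrite -(hartley_PW_isometry Pu); apply: sum_itg_le => // t; exact: sqr_ge0.
  rewrite -[leRHS]mulrA; apply: ler_wpM2l; first exact: ltW del_gt0.
  apply: le_trans (norm2_hderiv b0 Pu).
  by rewrite -(hartley_PW_isometry Pu1); apply: sum_itg_le => // t; exact: sqr_ge0.
rewrite !big_distrr -big_split/=; apply: ler_sum => i _.
have h := @sampling_bound R (hartley u) (hartley (hderiv u)) (x i) (x (i + 1)) (xlt i)
  (fun t => hartley_deriv b0 t Pu) (hartley_PW_continuous b0 Pu1).
have g1 := gapl i; have g2 := gapr i; have l0 := xlt i.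
set L := x (i + 1) - x i in h g1 g2.
have L0 : 0 < L by rewrite subr_gt0.
rewrite -(ler_pM2l L0); apply: (le_trans h); rewrite mulrDr.
have p0 : 0 <= itg (x i) (x (i + 1)) f0 by apply: itg_ge0 => t _; exact: sqr_ge0.
have p1 : 0 <= itg (x i) (x (i + 1)) f1 by apply: itg_ge0 => t _; exact: sqr_ge0.
apply: lerD.
  rewrite mulrA; apply: ler_wpM2r => //.
  by rewrite mulrA ler_pdivlMr// mulrC ler_wpM2r.
rewrite expr2 -!mulrA; apply: ler_wpM2l; first exact: ltW.
exact: ler_wpM2r.
Qed.

Definition sample (k : int + int) u : R :=
  match k with inl i => hartley u (x i) | inr i => hartley (hderiv u) (x i) end.

Let lefts (s : seq (int + int)) := pmap (fun k => if k is inl i then Some i else None) s.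
Let rights (s : seq (int + int)) := pmap (fun k => if k is inr i then Some i else None) s.

Lemma sum_lefts_rights (F : int + int -> R) (s : seq (int + int)) :
  \sum_(k <- s) F k = \sum_(i <- lefts s) F (inl i) + \sum_(i <- rights s) F (inr i).
Proof.
elim: s => [|[i|i] s IH]; first by rewrite !big_nil addr0.
  by rewrite /lefts/= !big_cons IH addrA.
by rewrite /rights/= !big_cons IH addrCA.
Qed.

Lemma sample_upper u : PW b u -> forall J : {fset (int + int)},
  \sum_(k <- J) sample k u ^+ 2 <=
    (2 / gam + del * sigma ^+ 2) * (1 + sigma ^+ 2) * norm2 u.
Proof.
move=> Pu J; have Pu1 := hderiv_PW Pu.
rewrite (@sum_lefts_rights (fun k => sample k u ^+ 2) J) /=.
have u1 : uniq (lefts J).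
  by apply: (pmap_uniq (g := @inl int int)); [move=> [i|i]|exact: fset_uniq].
have u2 : uniq (rights J).
  by apply: (pmap_uniq (g := @inr int int)); [move=> [i|i]|exact: fset_uniq].
have h1 := sample_sum_le u1 Pu; have h2 := sample_sum_le u2 Pu1.
have h3 := norm2_hderiv b0 Pu.
have C0 : 0 <= 2 / gam + del * sigma ^+ 2.
  apply: addr_ge0; first by rewrite divr_ge0// ltW.
  by rewrite mulr_ge0 ?sqr_ge0// ltW// del_gt0.
rewrite -[leRHS]mulrA [X in _ <= _ * X]mulrDl mul1r mulrDr; apply: lerD => //.
by apply: (le_trans h2); exact: ler_wpM2l.
Qed.

Lemma sample_lin k a (u v : R -> R^o) : PW b u -> PW b v ->
  sample k (a *: u + v) = a * sample k u + sample k v.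
Proof.
move=> Pu Pv; case: k => i; rewrite /sample; first by rewrite (hartley_lin _ _ Pu Pv).
by rewrite hderiv_lin (hartley_lin _ _ (hderiv_PW Pu) (hderiv_PW Pv)).
Qed.

(** The nodes from [x (- n)] on, indexed by naturals so that integrals over consecutive gaps add up;
    [y n (n + n)] is [x n]. *)
Let y (n k : nat) : R := x (k%:Z - n%:Z).

Let yS n k : y n k.+1 = x (k%:Z - n%:Z + 1).
Proof. by rewrite /y; congr x; rewrite -addn1 PoszD addrAC. Qed.

Let ylt n k : y n k < y n k.+1.
Proof. by rewrite yS; exact: xlt. Qed.

Let y_le n k : y n 0 <= y n k.
Proof. by elim: k => // k /le_trans; apply; exact: ltW. Qed.

Lemma itg_chain n m g : continuous g ->
  itg (y n 0) (y n m) g = \sum_(0 <= k < m) itg (y n k) (y n k.+1) g.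
Proof.
move=> cg; elim: m => [|m IH].
  by rewrite big_geq// /itg set_itv1 Rintegral_set1.
rewrite big_nat_recr//= -IH; apply: itg_split; [exact: y_le|exact: ltW|].
exact: continuous_cont_on.
Qed.

(** Gaps of at least [gam] push the end nodes to infinity on both sides, so the windows exhaust the
    line. *)
Lemma int_le_of_itg g (K : R) : int1 g -> continuous g -> (forall t, 0 <= g t) ->
  (forall n, itg (y n 0) (y n (n + n)) g <= K) -> \int[mu]_t g t <= K.
Proof.
move=> ig cg g0 gK.
pose A n : set R := `[y n 0, y n (n + n)]%classic.
have mA n : measurable (A n : set (measurableTypeR R)) by exact: measurable_itv.
have [|t|n t|_ cv] := @int_dominated R (fun n t => g t * \1_(A n) t) g g _ _ ig _.
- move=> n; apply: measurable_funM; first exact: int1_measurable.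
  by apply: measurable_indic; exact: mA.
- apply: cvg_near_cst; exists (Num.truncn ((`|t| + `|x 0|) / gam)).+1 => // n /= tn.
  have {}tn : (`|t| + `|x 0|) <= gam * n%:R.
    rewrite mulrC -ler_pdivrMr// ltW// (lt_le_trans (truncnS_gt _))// ler_nat//.
  rewrite indicE mem_set ?mulr1// /A/= in_itv/=.
  have h1 := nodes_addn 0 n; have h2 := nodes_addn (- n%:Z) n.
  move: h1 h2; rewrite add0r addNr /y sub0r PoszD addrK => h1 h2.
  have := ler_norm t; have := ler_norm (x 0); have := ler_norm (- t); have := ler_norm (- x 0); rewrite !normrN.
  by move=> *; apply/andP; split; lra.
- rewrite indicE; case: (_ \in _) => /=; rewrite ?mulr1 ?mulr0 ?normr0//.
  by rewrite ger0_norm.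
rewrite -(cvg_lim _ cv)//; apply: limr_le; first by apply/cvg_ex; eexists; exact: cv.
apply: nearW => n; apply: le_trans (gK n).
rewrite [leRHS]Rintegral_mkcond le_eqVlt; apply/orP; left; apply/eqP.
apply: eq_int => t; rewrite /patch indicE /A.
by case: (_ \in _); rewrite ?mulr1 ?mulr0.
Qed.

(* For [sigma < k < 2 pi / del], the Bernstein inequality
   [norm2 f'' <= sigma ^ 2 * norm2 f'] absorbs the second derivatives produced by
   [local_frame_inequality] on the intervals between consecutive nodes. *)
Lemma sample_lower : sigma * del < 2 * pi ->
  exists2 alpha : R, 0 < alpha & forall u M, PW b u ->
    (forall J : {fset (int + int)}, \sum_(k <- J) sample k u ^+ 2 <= M) ->
    alpha * norm2 u <= M.
Proof.
move=> sd.
have d0 := del_gt0; have s0 := sigma0.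
pose k : R := (sigma + 2 * pi / del) / 2.
have sk : sigma < 2 * pi / del by rewrite ltr_pdivlMr.
have k0 : 0 < k by rewrite /k; move: s0 sk; move: (2 * pi / del) sigma => p q; lra.
have sk' : sigma < k by rewrite /k; move: s0 sk; move: (2 * pi / del) sigma => p q; lra.
have kd : k * del < 2 * pi.
  rewrite -ltr_pdivlMr// /k; move: sk; move: (2 * pi / del) sigma => p q; lra.
(* Chosen so that [(1 + eta) sigma^2 = k sigma], still below [k^2]: the room between [sigma] and [k]
   pays both for [eta] and for the absorption. *)
pose eta : R := k / sigma - 1.
have eta0 : 0 < eta by rewrite subr_gt0 ltr_pdivlMr// mul1r.
have es : (1 + eta) * sigma ^+ 2 = k * sigma.
  by rewrite /eta addrC subrK; move: sigma s0 => p p0; rewrite expr2 mulrA divfK// gt_eqF.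
pose C : R := k ^+ 2 * (1 + eta^-1) * (4 * gam^-1 + 2 * pi * k^-1).
have C0 : 0 < C.
  have ki : 0 < k^-1 by rewrite invr_gt0.
  have gi : 0 < gam^-1 by rewrite invr_gt0.
  have ei : 0 < eta^-1 by rewrite invr_gt0.
  apply: mulr_gt0; first by apply: mulr_gt0; [exact: exprn_gt0|exact: addr_gt0].
  by apply: addr_gt0; rewrite !mulr_gt0// pi_gt0.
have CE : C = k ^+ 2 * (1 + eta^-1) * (4 * gam^-1 + 2 * pi * k^-1) by [].
clearbody C.
(* From [k^2 n <= k sigma n + 2 C M], solved for [n = norm2 f1]. *)
pose C1 : R := 2 * C / (k * (k - sigma)).
have ks0 : 0 < k * (k - sigma) by rewrite mulr_gt0// subr_gt0.
have C10 : 0 < C1 by rewrite divr_gt0// mulr_gt0.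
pose C2 : R := 2 * del + 4 * del ^+ 2 * C1.
have C20 : 0 < C2.
  by apply: addr_gt0; [rewrite mulr_gt0|apply: mulr_gt0 => //; rewrite mulr_gt0 ?exprn_gt0].
exists C2^-1; first by rewrite invr_gt0.
move=> u M Pu uM.
have Pu1 := hderiv_PW Pu; have Pu2 := hderiv_PW Pu1.
pose f := hartley u; pose f1 := hartley (hderiv u); pose f2 := hartley (hderiv (hderiv u)).
have df t : is_derive t (1 : R) f (f1 t) by exact: (hartley_deriv b0).
have df1 t : is_derive t (1 : R) f1 (f2 t) by exact: (hartley_deriv b0).
have cf1 : continuous f1 by exact: (hartley_PW_continuous b0).
have cf2 : continuous f2 by exact: (hartley_PW_continuous b0).
have cf : continuous f by exact: (hartley_PW_continuous b0).
have [_ i0] := hartley_PW_sqint Pu; have [_ i1] := hartley_PW_sqint Pu1.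
have [_ i2] := hartley_PW_sqint Pu2.
pose a n j := f (y n j) ^+ 2 + f1 (y n j) ^+ 2.
have a0 n j : 0 <= a n j by rewrite addr_ge0 ?sqr_ge0.
have aM n m : \sum_(0 <= j < m) a n j <= M.
  pose nodes : seq int := [seq (j%:Z - n%:Z) | j <- index_iota 0 m].
  have un : uniq nodes.
    rewrite map_inj_uniq; first exact: iota_uniq.
    by move=> i j /addIr [].
  pose s := map (@inl int int) nodes ++ map (@inr int int) nodes.
  have us : uniq s.
    have il : injective (@inl int int) by move=> ? ? [].
    have ir : injective (@inr int int) by move=> ? ? [].
    rewrite cat_uniq (map_inj_uniq il) (map_inj_uniq ir) un /= andbT.
    by apply/hasPn => _ /mapP[j _ ->]; apply/mapP => -[].
  have := uM [fset k | k in s]%fset.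
  rewrite (perm_big s)/=; last first.
    apply: uniq_perm => //; first exact: fset_uniq.
    by move=> z; rewrite in_fset.
  rewrite big_cat/= !big_map -big_split/= => h.
  exact: h.
(* Each inner node bounds two gaps, hence the factor [2]. *)
have chain2 n m : \sum_(0 <= j < m) (a n j + a n j.+1) <= 2 * M.
  rewrite big_split/=; have h1 := aM n m; have := aM n m.+1.
  by rewrite big_nat_recl//=; have := a0 n 0%N; move: (\sum_(_ <= _ < _) _) (\sum_(_ <= _ < _) _) h1 => p q; lra.
have n1 : norm2 f1 <= C1 * M.
  (* Bernstein's inequality is a statement about the whole line, so the windowed estimate is passed
     to the limit before absorbing. *)
  have hint : norm2 f1 <= k ^- 2 * ((1 + eta) * norm2 f2 + 2 * C * M).
    apply: int_le_of_itg => //.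
    - exact: continuous_sqr.
    - by move=> t; exact: sqr_ge0.
    move=> n; rewrite -(ler_pM2l (exprn_gt0 2 k0)) mulrA divff ?expf_neq0 ?gt_eqF// mul1r.
    apply: (@le_trans _ _ ((1 + eta) * itg (y n 0) (y n (n + n)) (fun t => f2 t ^+ 2)
        + 2 * C * M)); last first.
      rewrite lerD2r; apply: ler_wpM2l; first by rewrite addr_ge0// ltW.
      by apply: itg_le_int => // t; exact: sqr_ge0.
    rewrite !itg_chain; [|exact: continuous_sqr..].
    apply: (@le_trans _ _ ((1 + eta) *
      (\sum_(0 <= j < n + n) itg (y n j) (y n j.+1) (fun t => f2 t ^+ 2))
       + C * \sum_(0 <= j < n + n) (a n j + a n j.+1))).
      rewrite !big_distrr -big_split/=; apply: ler_sum => j _.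
      have gl : gam <= y n j.+1 - y n j by rewrite yS; exact: gapl.
      have gr : k * (y n j.+1 - y n j) < 2 * pi.
        apply: le_lt_trans kd; apply: ler_wpM2l; first exact: ltW.
        by rewrite yS; exact: gapr.
      have := local_frame_inequality df df1 cf2 k0 eta0 gam0 gl gr.
      move=> h; apply: (le_trans h); rewrite -CE lerD2l; apply: ler_wpM2l; first exact: ltW.
      by rewrite /a; lra.
    rewrite lerD2l -mulrA mulrCA; apply: ler_wpM2l; first exact: ltW.
    exact: chain2.
  have h2 : norm2 f2 <= sigma ^+ 2 * norm2 f1.
    rewrite (hartley_PW_isometry Pu2) (hartley_PW_isometry Pu1).
    exact: norm2_hderiv.
  have e0 : 0 <= 1 + eta by rewrite addr_ge0// ltW.
  have h3 : (1 + eta) * norm2 f2 <= k * sigma * norm2 f1.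
    by rewrite -es -[leRHS]mulrA; exact: ler_wpM2l.
  rewrite /C1 mulrAC ler_pdivlMr//.
  move: hint; rewrite -(ler_pM2l (exprn_gt0 2 k0)) mulrA divff ?expf_neq0 ?gt_eqF// mul1r.
  move: h3; move: ((1 + eta) * norm2 f2) (norm2 f1) sigma => q n p; rewrite expr2; lra.
have n0 : norm2 f <= C2 * M.
  apply: int_le_of_itg => //.
  - exact: continuous_sqr.
  - by move=> t; exact: sqr_ge0.
  move=> n; rewrite itg_chain; last exact: continuous_sqr.
  apply: (@le_trans _ _ (2 * del * (\sum_(0 <= j < n + n) a n j)
     + 4 * del ^+ 2 * \sum_(0 <= j < n + n) itg (y n j) (y n j.+1) (fun t => f1 t ^+ 2))).
    rewrite !big_distrr -big_split/=; apply: ler_sum => j _.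
    have gl : y n j.+1 - y n j <= del by rewrite yS; exact: gapr.
    have l0 : 0 < y n j.+1 - y n j by rewrite subr_gt0.
    have := @interval_L2_bound R f f1 (y n j) (y n j.+1) (ylt n j) df cf1.
    move=> h; apply: (le_trans h); apply: lerD.
      apply: ler_pM.
      - by rewrite mulr_ge0// ltW.
      - exact: sqr_ge0.
      - by rewrite ler_wpM2l.
      - by rewrite /a lerDl sqr_ge0.
    apply: ler_wpM2r; first by apply: itg_ge0 => t _; exact: sqr_ge0.
    by rewrite ler_wpM2l// ler_pXn2r// ?nnegrE ltW.
  rewrite -itg_chain; last exact: continuous_sqr.
  rewrite /C2 [leRHS]mulrDl; apply: lerD.
    by apply: ler_wpM2l; [rewrite mulr_ge0// ltW|exact: aM].
  rewrite -[leRHS]mulrA; apply: ler_wpM2l; first by rewrite mulr_ge0// sqr_ge0.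
  apply: le_trans n1; apply: itg_le_int => // t; exact: sqr_ge0.
rewrite -(hartley_PW_isometry Pu) -/f mulrC ler_pdivrMr// mulrC.
exact: n0.
Qed.

End FrameBounds.

(** * Complex-valued bandlimited functions *)

Section ComplexInterface.
Context {R : realType}.
Local Notation C := (R[i]).
Local Notation mu := (@lebesgue_measure R).
Local Notation Re := complex.Re.
Local Notation Im := complex.Im.
Local Notation normc := ComplexField.Normc.normc.
Implicit Types (f g h : R -> C).

Lemma Lfun2P (f : R -> R) : f \in Lfun mu 2%:E <-> sqint f.
Proof.
split.
  move=> lf; split; last exact: Lfun2_integrable_sqr.
  by move: lf; rewrite inE => /andP[/[!inE]/=].
move=> [mf fi]; rewrite inE; apply/andP; split; rewrite inE//=.
rewrite /finite_norm unlock /Lnorm; apply: poweR_lty.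
suff -> : (\int[mu]_x `|(f x)%:E| `^ 2 = \int[mu]_x (f x ^+ 2)%:E)%E.
  by apply: integrable_lty => //.
apply: eq_integral => x _ /=.
by rewrite powR_mulrn// real_normK ?num_real.
Qed.

Definition csqint f := sqint (fun t => Re (f t)) /\ sqint (fun t => Im (f t)).

Lemma cLfun2P f : cLfun 2%:E f <-> csqint f.
Proof. by rewrite /cLfun /csqint !Lfun2P. Qed.

Lemma cLfun1P f : cLfun 1%:E f <-> int1 (fun t => Re (f t)) /\ int1 (fun t => Im (f t)).
Proof. by rewrite /cLfun !Lfun1_integrable. Qed.

Definition cnorm2 f : R := norm2 (fun t => Re (f t)) + norm2 (fun t => Im (f t)).

Lemma cnorm2_ge0 f : 0 <= cnorm2 f.
Proof. by rewrite addr_ge0 ?norm2_ge0. Qed.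

Lemma sqr_normc (z : C) : normc z ^+ 2 = Re z ^+ 2 + Im z ^+ 2.
Proof. by case: z => a b /=; rewrite sqr_sqrtr// addr_ge0 ?sqr_ge0. Qed.

Lemma normc_ge0 (z : C) : 0 <= normc z.
Proof. by case: z => a b /=; exact: sqrtr_ge0. Qed.

Lemma L2normE f : csqint f -> L2norm f = (Num.sqrt (cnorm2 f))%:E.
Proof.
move=> [[m1 i1] [m2 i2]].
rewrite /L2norm unlock /Lnorm.
have -> : (\int[mu]_x `| (normc (f x))%:E | `^ 2 = (cnorm2 f)%:E)%E.
  rewrite /cnorm2 /norm2 -intD// EFin_int; last exact: int1D.
  apply: eq_integral => x _ /=; congr EFin.
  by rewrite powR_mulrn// ger0_norm ?normc_ge0// sqr_normc.
by rewrite poweR_EFin powR12_sqrt// cnorm2_ge0.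
Qed.

Lemma L2norm_sqr f : csqint f -> (L2norm f ^+ 2)%E = (cnorm2 f)%:E.
Proof. by move=> sf; rewrite L2normE// -EFin_expe sqr_sqrtr// cnorm2_ge0. Qed.

Lemma L2norm_cvg0 {T : Type} (F : set_system T) {FF : Filter F} (f : T -> R -> C) :
  (forall n, csqint (f n)) ->
  (L2norm (f n) @[n --> F] --> 0%E <-> cnorm2 (f n) @[n --> F] --> 0).
Proof.
move=> sf; have -> : (fun n => L2norm (f n)) = (fun n => (Num.sqrt (cnorm2 (f n)))%:E).
  by apply/funext => n; rewrite L2normE.
split.
  move=> /fine_cvg h.
  have : Num.sqrt (cnorm2 (f n)) * Num.sqrt (cnorm2 (f n)) @[n --> F] --> (0 * 0 : R).
    by apply: cvgM; exact: h.
  rewrite mul0r; under eq_fun do rewrite -expr2 sqr_sqrtr ?cnorm2_ge0//.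
  exact.
move=> h; apply: cvg_EFin; first exact: nearW.
rewrite -[X in _ --> X]sqrtr0.
exact: (cvg_comp _ _ h (@sqrt_continuous R 0)).
Qed.

Lemma L2dot_real f (k : R -> R) :
  L2dot f (fun t => (k t)%:C%C) =
  (dot (fun t => Re (f t)) k +i* dot (fun t => Im (f t)) k)%C.
Proof.
rewrite /L2dot /cintegral /dot; congr (_ +i* _)%C; apply: eq_int => t.
  by case: (f t) => a b /=; rewrite oppr0 mulr0 subr0.
by case: (f t) => a b /=; rewrite oppr0 mulr0 add0r mulrC.
Qed.

Lemma int1_cos_lin (p : R -> R) (w : R) : int1 p -> int1 (fun t => p t * cos (2 * pi * w * t)).
Proof.
move=> ip; apply: (@int1_bounded_mul _ 1) => //; last by move=> x; exact: cos_max.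
apply: continuous_measurable_fun; apply: continuous_compose; last exact: continuous_cos.
by apply: continuous_scale; exact: continuous_ident.
Qed.

Lemma int1_sin_lin (p : R -> R) (w : R) : int1 p -> int1 (fun t => p t * sin (2 * pi * w * t)).
Proof.
move=> ip; apply: (@int1_bounded_mul _ 1) => //; last by move=> x; exact: sin_max.
apply: continuous_measurable_fun; apply: continuous_compose; last exact: continuous_sin.
by apply: continuous_scale; exact: continuous_ident.
Qed.

Definition ctrans (p : R -> R) w : R := \int[mu]_t (p t * cos (2 * pi * w * t)).
Definition strans (p : R -> R) w : R := \int[mu]_t (p t * sin (2 * pi * w * t)).

Lemma hartley_ctrans (p : R -> R) w : int1 p -> hartley p w = ctrans p w + strans p w.
Proof.
move=> ip; rewrite /ctrans /strans -intD; [|exact: int1_cos_lin|exact: int1_sin_lin].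
by apply: eq_int => t; rewrite /cas mulrDr.
Qed.

Lemma hartleyN_ctrans (p : R -> R) (w : R) : int1 p -> hartley p (- w) = ctrans p w - strans p w.
Proof.
move=> ip; rewrite /ctrans /strans -intB; [|exact: int1_cos_lin|exact: int1_sin_lin].
by apply: eq_int => t; rewrite /cas mulrN mulNr cosN sinN mulrDr mulrN.
Qed.

Lemma fourier1E f w : int1 (fun t => Re (f t)) -> int1 (fun t => Im (f t)) ->
  fourier1 f w = ((ctrans (fun t => Re (f t)) w + strans (fun t => Im (f t)) w) +i*
    (ctrans (fun t => Im (f t)) w - strans (fun t => Re (f t)) w))%C.
Proof.
move=> i1 i2; rewrite /fourier1 /cintegral /ctrans /strans; congr (_ +i* _)%C.
  rewrite -intD; [|exact: int1_cos_lin|exact: int1_sin_lin].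
  by apply: eq_int => t; case: (f t) => a b /=; ring.
rewrite -intB; [|exact: int1_cos_lin|exact: int1_sin_lin].
by apply: eq_int => t; case: (f t) => a b /=; ring.
Qed.

(* [hpart a b] is the Hartley transform of the real part of a function with
   Fourier transform [a + i b]; [hpart b (- a)] that of its imaginary part. *)
Definition hpart (a b : R -> R) (w : R) : R := (a w + a (- w) - b w + b (- w)) / 2.

Lemma hpart_sqint (a b : R -> R) : sqint a -> sqint b -> sqint (hpart a b).
Proof.
move=> sa sb; have sa' := sqint_reflect sa; have sb' := sqint_reflect sb.
have := sqintZ 2^-1 (sqintD (sqintB (sqintD sa sa') sb) sb').
by rewrite [X in sqint X -> _](_ : _ = hpart a b)//; apply/funext => w; rewrite /hpart mulrC.
Qed.

Lemma norm2_hpart (a b : R -> R) : sqint a -> sqint b ->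
  norm2 (hpart a b) <= 2 * (norm2 a + norm2 b).
Proof.
move=> sa sb; have sa' := sqint_reflect sa; have sb' := sqint_reflect sb.
have := norm2_reflect sa; have := norm2_reflect sb; rewrite /norm2 => eb ea.
have [_ i1] := hpart_sqint sa sb.
have -> : 2 * (\int[mu]_x (a x ^+ 2) + \int[mu]_x (b x ^+ 2)) =
    \int[mu]_x (a x ^+ 2 + a (- x) ^+ 2 + (b x ^+ 2 + b (- x) ^+ 2)).
  have [[[[_ j1] [_ j2]] [_ j3]] [_ j4]] := (sa, sb, sa', sb').
  rewrite intD; [|exact: int1D|exact: int1D].
  by rewrite !intD// ea eb; ring.
have [[[[_ j1] [_ j2]] [_ j3]] [_ j4]] := (sa, sb, sa', sb').
apply: int_le => //; first by apply: int1D; exact: int1D.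
move=> x; rewrite /hpart; move: (a x) (a (- x)) (b x) (b (- x)) => p q r s.
(* Cauchy-Schwarz for four numbers, written as a sum of six squares. *)
have := sqr_ge0 (p - q); have := sqr_ge0 (p + r); have := sqr_ge0 (p - s).
have := sqr_ge0 (q + r); have := sqr_ge0 (q - s); have := sqr_ge0 (r + s).
lra.
Qed.

Lemma hpart_fourier f w : int1 (fun t => Re (f t)) -> int1 (fun t => Im (f t)) ->
  hpart (fun w => Re (fourier1 f w)) (fun w => Im (fourier1 f w)) w =
    hartley (fun t => Re (f t)) w /\
  hpart (fun w => Im (fourier1 f w)) (fun w => - Re (fourier1 f w)) w =
    hartley (fun t => Im (f t)) w.
Proof.
move=> i1 i2; rewrite /hpart !fourier1E//= !hartley_ctrans//.
have cN p : ctrans p (- w) = ctrans p w.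
  by apply: eq_int => t; rewrite mulrN mulNr cosN.
have sN p : int1 p -> strans p (- w) = - strans p w.
  move=> ip; rewrite /strans -intN; last exact: int1_sin_lin.
  by apply: eq_int => t; rewrite mulrN mulNr sinN mulrN.
by rewrite !cN !sN//; split; field.
Qed.

End ComplexInterface.

(** * Bandlimited functions are Hartley transforms *)

Section Bandlimited.
Context {R : realType}.
Local Notation C := (R[i]).
Local Notation mu := (@lebesgue_measure R).
Local Notation Re := complex.Re.
Local Notation Im := complex.Im.
Local Notation normc := ComplexField.Normc.normc.
Implicit Types (f g h : R -> C).

Lemma normCE (z : C) : `|z| = (normc z)%:C%C.
Proof. by []. Qed.

Lemma normc_distC (z w : C) : normc (z - w) = normc (w - z).
Proof. case: z w => a b [c d] /=; congr Num.sqrt; ring. Qed.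

(** The norm on [R[i]], and with it every radius, takes values in [R[i]]; this equivalence brings
    limits back to the real line. *)
Lemma cvgC_normc {T : Type} (F : set_system T) {FF : Filter F} (f : T -> C^o) (l : C^o) :
  f x @[x --> F] --> l <-> normc (f x - l) @[x --> F] --> (0 : R).
Proof.
split=> [/cvgrPdist_lt h|/cvgrPdist_lt h]; apply/cvgrPdist_lt => e e0.
  have e0' : 0 < (e%:C%C : C) by rewrite ltcE/= eqxx.
  apply: filterS (h _ e0') => x.
  by rewrite normCE ltcE/= eqxx/= sub0r normrN ger0_norm ?normc_ge0// normc_distC.
case: e e0 => e e'; rewrite ltcE/= => /andP[/eqP e'0 e0].
apply: filterS (h _ e0) => x.
by rewrite normCE ltcE/= e'0 eqxx/= sub0r normrN ger0_norm ?normc_ge0// normc_distC.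
Qed.

Lemma Re_normc (z : C) : `|Re z| <= normc z.
Proof.
rewrite -(@ler_pXn2r _ 2) ?nnegrE ?normc_ge0// sqr_normc real_normK ?num_real//.
by rewrite lerDl sqr_ge0.
Qed.

Lemma Im_normc (z : C) : `|Im z| <= normc z.
Proof.
rewrite -(@ler_pXn2r _ 2) ?nnegrE ?normc_ge0// sqr_normc real_normK ?num_real//.
by rewrite lerDr sqr_ge0.
Qed.

Lemma normc_Re_Im (z : C) : normc z <= `|Re z| + `|Im z|.
Proof.
rewrite -(@ler_pXn2r _ 2) ?nnegrE ?normc_ge0 ?addr_ge0// sqr_normc sqrrD !real_normK ?num_real//.
by rewrite -addrA lerD2l lerDr mulrn_wge0// mulr_ge0.
Qed.

Lemma cvgC_Re_Im {T : Type} (F : set_system T) {FF : Filter F} (f : T -> C^o) (l : C^o) :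
  f x @[x --> F] --> l <->
    Re (f x) @[x --> F] --> Re l /\ Im (f x) @[x --> F] --> Im l.
Proof.
have ReB (z w : C) : Re (z - w) = Re z - Re w by case: z w => ? ? [].
have ImB (z w : C) : Im (z - w) = Im z - Im w by case: z w => ? ? [].
rewrite cvgC_normc; split.
  move=> /cvgrPdist_lt h; split; apply/cvgrPdist_lt => e /h; apply: filterS => x;
  rewrite sub0r normrN ger0_norm ?normc_ge0// normc_distC; apply: le_lt_trans.
    by rewrite -ReB Re_normc.
  by rewrite -ImB Im_normc.
move=> [/cvgrPdist_lt h1 /cvgrPdist_lt h2]; apply/cvgrPdist_lt => e e0.
have e2 : 0 < e / 2 by rewrite divr_gt0.
apply: filterS2 (h1 _ e2) (h2 _ e2) => x x1 x2.
rewrite sub0r normrN ger0_norm ?normc_ge0// normc_distC.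
by apply: le_lt_trans (normc_Re_Im _) _; rewrite ReB ImB (splitr e) ltrD.
Qed.

Lemma entire_real_continuous (F : C -> C) : entire F ->
  continuous (fun t : R => Re (F t%:C%C)) /\ continuous (fun t : R => Im (F t%:C%C)).
Proof.
move=> eF.
have cF (z : C^o) : (F : C^o -> C^o) x @[x --> z] --> (F z : C^o).
  by apply: differentiable_continuous; apply/derivable1_diffP; exact: eF.
have c0 (t : R) : (s%:C%C : C^o) @[s --> t] --> (t%:C%C : C^o).
  by apply/cvgC_Re_Im; split => /=; [exact: cvg_id|exact: cvg_cst].
have cR (t : R) : (F s%:C%C : C^o) @[s --> t] --> (F t%:C%C : C^o).
  exact: (cvg_comp _ _ (c0 t) (cF _)).
by split=> t; have /cvgC_Re_Im[] := cR t.
Qed.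

(** Distinct values at a point persist on an interval, which has positive measure. This upgrades
    [L2] inversion to an identity at every point. *)
Lemma continuous_ae_eq (p q : R -> R) : continuous p -> continuous q ->
  {ae mu, forall x, p x = q x} -> forall x, p x = q x.
Proof.
move=> cp cq pq x; apply/eqP/negPn/negP => pqx.
have ch : continuous (fun t => p t - q t) by exact: continuous_sub.
have h0 : 0 < `|p x - q x| by rewrite normr_gt0 subr_eq0.
have /cvgrPdist_lt/(_ _ h0) := ch x.
move=> /nbhs_ballP[e/= e0 he].
have sub : `]x - e, x + e[%classic `<=` ~` [set t | p t = q t].
  move=> t /=; rewrite in_itv/= => /andP[t1 t2] pqt.
  suff bt : ball x e t by have := he t bt; rewrite /= pqt subrr subr0 ltxx.
  by rewrite /ball/= ltr_norml; lra.
have pq' : mu.-negligible (~` [set t | p t = q t]) := pq.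
have neg := @negligibleS _ _ _ mu _ _ sub pq'.
have m0 : mu (`]x - e, x + e[%classic : set (measurableTypeR R)) = 0%E.
  by apply: measure_negligible => //; exact: measurable_itv.
move: m0; rewrite lebesgue_measure_itv/= lte_fin ifT; last by lra.
by move/eqP; rewrite eqe; apply/negP; rewrite gt_eqF//; lra.
Qed.

(* Countably many rational intervals cover the complement of the support. *)
Lemma ess_support_ae g b : ess_support g `<=` `[- b, b] ->
  {ae mu, forall w : R, b < `|w| -> g w = 0}.
Proof.
move=> gb.
pose B (n : nat) : set R := [set w | exists2 pq : rat * rat, choice.unpickle n = Some pq &
  [/\ {ae mu, forall t : R, `]ratr pq.1, ratr pq.2[%classic t -> g t = 0},
    `]ratr pq.1, ratr pq.2[%classic w & g w <> 0]].
have nB n : mu.-negligible (B n).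
  case E : (choice.unpickle n) => [pq|]; last first.
    by rewrite (_ : B n = set0); [exact: negligible_set0|apply/seteqP; split => // w [pq]; rewrite E].
  have [H|H] := pselect {ae mu, forall t : R, `]ratr pq.1, ratr pq.2[%classic t -> g t = 0}.
    have H' : mu.-negligible (~` [set t : R | `]ratr pq.1, ratr pq.2[%classic t -> g t = 0]) := H.
    apply: (@negligibleS _ _ _ mu _ _ _ H') => w [pq']; rewrite E => -[<-] [_ w1 w2] /= w3.
    by apply: w2; exact: w3.
  rewrite (_ : B n = set0); [exact: negligible_set0|apply/seteqP; split => // w [pq']].
  by rewrite E => -[<-] [].
apply: (@negligibleS _ _ _ mu _ _ _ (negligible_bigcup nB)) => w /= /not_implyP[bw gw].
have : ~ ess_support g w.
  by move=> /gb /=; rewrite in_itv/= -ler_norml leNgt bw.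
move=> /existsNP[U /not_implyP[oU /not_implyP[Uw /contrapT gU]]].
have /nbhs_ballP[e/= e0 he] : nbhs w U by exact: open_nbhs_nbhs.
have [p] := @rat_in_itvoo R (w - e) w ltac:(lra).
have [q] := @rat_in_itvoo R w (w + e) ltac:(lra).
rewrite !in_itv/= => /andP[q1 q2] /andP[p1 p2].
exists (choice.pickle (p, q)) => //; exists (p, q); first by rewrite choice.pickleK.
split => //=; last by rewrite in_itv/= p2.
move: gU; apply: ae_imp => t gU; rewrite in_itv/= => /andP[t1 t2]; apply: gU; apply: he.
rewrite /ball/= ltr_norml; apply/andP; split; lra.
Qed.

Lemma hpartB (a b a' b' : R -> R) w :
  hpart (fun w => a w - a' w) (fun w => b w - b' w) w = hpart a b w - hpart a' b' w.
Proof. by rewrite /hpart; field. Qed.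

(** The cosine and sine transforms are the even and odd parts of the Hartley transform. *)
Lemma csqint_fourier1 f : cLfun 1%:E f -> csqint f -> csqint (fourier1 f).
Proof.
move=> /cLfun1P[i1 i2] [s1 s2].
have h (p : R -> R) : int1 p -> sqint p -> sqint (ctrans p) /\ sqint (strans p).
  move=> ip sp; have [sh _ _] := hartley_L2 ip sp; have sh' := sqint_reflect sh; split.
    have := sqintZ 2^-1 (sqintD sh sh').
    rewrite [X in sqint X -> _](_ : _ = ctrans p)//; apply/funext => w.
    by rewrite hartleyN_ctrans// hartley_ctrans//; field.
  have := sqintZ 2^-1 (sqintB sh sh').
  rewrite [X in sqint X -> _](_ : _ = strans p)//; apply/funext => w.
  by rewrite hartleyN_ctrans// hartley_ctrans//; field.
have [[c1 t1] [c2 t2]] := (h _ i1 s1, h _ i2 s2).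
split.
  rewrite [X in sqint X](_ : _ = fun w => ctrans (fun t => Re (f t)) w + strans (fun t => Im (f t)) w).
    exact: sqintD.
  by apply/funext => w; rewrite fourier1E.
rewrite [X in sqint X](_ : _ = fun w => ctrans (fun t => Im (f t)) w - strans (fun t => Re (f t)) w).
  exact: sqintB.
by apply/funext => w; rewrite fourier1E.
Qed.

Lemma csqintB f g : csqint f -> csqint g -> csqint (fun t => f t - g t).
Proof.
move=> [s1 s2] [t1 t2]; split.
  have := sqintB s1 t1; rewrite [X in sqint X -> _](_ : _ = fun t => Re (f t - g t))//.
  by apply/funext => t; case: (f t) (g t) => ? ? [].
have := sqintB s2 t2; rewrite [X in sqint X -> _](_ : _ = fun t => Im (f t - g t))//.
by apply/funext => t; case: (f t) (g t) => ? ? [].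
Qed.

(** [hpart] converts the Fourier approximants of the definition into Hartley approximants, [L2]
    inversion identifies [f] almost everywhere, and continuity, read off the entire extension,
    everywhere. *)
Lemma bandlimited_PW sigma f : 0 < sigma -> bandlimited sigma f ->
  exists k1 k2, [/\ PW (sigma / (2 * pi)) k1, PW (sigma / (2 * pi)) k2 &
    forall t, f t = (hartley k1 t +i* hartley k2 t)%C].
Proof.
move=> s0 [/cLfun2P sf [g [/cLfun2P sg [u [uL /L2norm_cvg0 uf /L2norm_cvg0 ug]]] gb]
  [F [eF _ fF]]].
set b := sigma / (2 * pi) in gb *.
have b0 : 0 < b by rewrite divr_gt0// mulr_gt0// pi_gt0.
have su n : csqint (u n) by apply/cLfun2P; exact: (uL n).2.
have iu n : cLfun 1%:E (u n) := (uL n).1.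
have {}uf := uf (fun n => csqintB (su n) sf).
have {}ug := ug (fun n => csqintB (csqint_fourier1 (iu n) (su n)) sg).
have [c1 c2] := entire_real_continuous eF.
pose D : set R := `[- b, b]%classic.
(* A representative of the transform that vanishes at every point off the band, as [PW] demands. *)
pose g' w := ((Re (g w) * \1_D w) +i* (Im (g w) * \1_D w))%C.
have gg' : {ae mu, forall w : R, g w = g' w}.
  move: (ess_support_ae gb); apply: ae_imp => w h; rewrite /g' indicE.
  have [Dw|] := pselect (D w); first (rewrite mem_set// /= !mulr1; case: (g w) => a c; reflexivity).
  move=> Dw; rewrite memNset//= !mulr0; apply: h; rewrite ltNge; apply/negP => bw; apply: Dw.
  by rewrite /D/= in_itv/= -ler_norml.
have sg' : csqint g' by split; (apply: sqint_truncate; [exact: measurable_itv|by case: sg]).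
have g'0 w : b < `|w| -> Re (g' w) = 0 /\ Im (g' w) = 0.
  move=> bw; rewrite /g' indicE memNset ?mulr0// /D/= in_itv/= -ler_norml => /le_lt_trans/(_ bw).
  by rewrite ltxx.
have {}ug : cnorm2 (fun w => fourier1 (u n) w - g' w) @[n --> \oo] --> 0.
  move: ug; rewrite (_ : (fun _ => _) = fun n => cnorm2 (fun w => fourier1 (u n) w - g' w))//.
  apply/funext => n; have sn := csqint_fourier1 (iu n) (su n).
  have [[[m1 _] [m2 _]] [[m3 _] [m4 _]]] := (csqintB sn sg, csqintB sn sg').
  by rewrite /cnorm2; congr (_ + _); apply: norm2_ae => //; move: gg'; apply: ae_imp => w ->.
move: sg' g'0 ug; clearbody g'; move=> {sg gb gg'} {g}sg g0 ug; rename g' into g.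
have ReB (z w : C) : Re (z - w) = Re z - Re w by case: z w => ? ? [].
have ImB (z w : C) : Im (z - w) = Im z - Im w by case: z w => ? ? [].
(* Common to both parts of [f]: the pair [(a, c)] is [(Re g, Im g)] for the real part and
   [(Im g, - Re g)] for the imaginary part. *)
have main (p : nat -> R -> R) (P : R -> R) (a c : R -> R) (a' c' : nat -> R -> R) :
    (forall n, int1 (p n)) -> (forall n, sqint (p n)) -> sqint P -> continuous P ->
    norm2 (fun t => p n t - P t) @[n --> \oo] --> 0 ->
    sqint a -> sqint c -> (forall n, sqint (a' n)) -> (forall n, sqint (c' n)) ->
    (forall n w, hpart (a' n) (c' n) w = hartley (p n) w) ->
    (forall w, b < `|w| -> a w = 0 /\ c w = 0) ->
    norm2 (fun w => a' n w - a w) + norm2 (fun w => c' n w - c w) @[n --> \oo] --> 0 ->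
    exists2 k, PW b k & forall t, P t = hartley k t.
  move=> ip sp sP cP pP sa sc sa' sc' e ac0 acv.
  have sk := hpart_sqint sa sc.
  have Pk : PW b (hpart a c).
    split=> // w bw; have [ha hc] := ac0 w bw.
    by have [|ha' hc'] := ac0 (- w); rewrite ?normrN// /hpart ha hc ha' hc'; field.
  exists (hpart a c) => //.
  apply: continuous_ae_eq => //.
    exact: hartley_PW_continuous b0 _ Pk.
  apply: (hartley_inversion_L2 (p := p)) => //; first exact: PW_int1 Pk.
  apply: (@squeeze_cvgr _ _ _ _ (fun=> 0) (fun n => 2 * (norm2 (fun w => a' n w - a w) + norm2 (fun w => c' n w - c w)))).
  - apply: nearW => n; rewrite norm2_ge0/=.
    have [sh _ _] := hartley_L2 (ip n) (sp n).
    rewrite [leLHS](_ : _ = norm2 (hpart (fun w => a' n w - a w) (fun w => c' n w - c w))).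
      by apply: norm2_hpart; exact: sqintB.
    by apply: eq_int => w; rewrite hpartB e.
  - exact: cvg_cst.
  - by rewrite -[X in _ --> X](mulr0 2); apply: cvgM => //; exact: cvg_cst.
have [s1 s2] := sf; have [t1 t2] := sg.
have [k1 Pk1 e1] : exists2 k, PW b k & forall t, Re (f t) = hartley k t.
  apply: (main (fun n t => Re (u n t)) _ (fun w => Re (g w)) (fun w => Im (g w))
    (fun n w => Re (fourier1 (u n) w)) (fun n w => Im (fourier1 (u n) w))) => //.
  - by move=> n; have /cLfun1P[] := iu n.
  - by move=> n; have [] := su n.
  - by rewrite (_ : (fun _ => _) = fun t : R => Re (F t%:C%C))//; apply/funext => t; rewrite fF.
  - apply: (@squeeze_cvgr _ _ _ _ (fun=> 0) (fun n => cnorm2 (fun t => u n t - f t))) => //; last exact: cvg_cst.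
    apply: nearW => n; rewrite norm2_ge0/= /cnorm2.
    under [X in _ <= norm2 X + _]eq_fun do rewrite ReB.
    by rewrite lerDl norm2_ge0.
  - by move=> n; have [] := csqint_fourier1 (iu n) (su n).
  - by move=> n; have [] := csqint_fourier1 (iu n) (su n).
  - by move=> n w; have /cLfun1P[i1 i2] := iu n; have [] := hpart_fourier w i1 i2.
  - move: ug; rewrite /cnorm2.
    by under eq_fun do (under [X in norm2 X + _]eq_fun do rewrite ReB; under [X in _ + norm2 X]eq_fun do rewrite ImB).
have [k2 Pk2 e2] : exists2 k, PW b k & forall t, Im (f t) = hartley k t.
  apply: (main (fun n t => Im (u n t)) _ (fun w => Im (g w)) (fun w => - Re (g w))
    (fun n w => Im (fourier1 (u n) w)) (fun n w => - Re (fourier1 (u n) w))) => //.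
  - by move=> n; have /cLfun1P[] := iu n.
  - by move=> n; have [] := su n.
  - by rewrite (_ : (fun _ => _) = fun t : R => Im (F t%:C%C))//; apply/funext => t; rewrite fF.
  - apply: (@squeeze_cvgr _ _ _ _ (fun=> 0) (fun n => cnorm2 (fun t => u n t - f t))) => //; last exact: cvg_cst.
    apply: nearW => n; rewrite norm2_ge0/= /cnorm2.
    under [X in _ <= _ + norm2 X]eq_fun do rewrite ImB.
    by rewrite lerDr norm2_ge0.
  - exact: sqintN.
  - by move=> n; have [] := csqint_fourier1 (iu n) (su n).
  - by move=> n; have [] := csqint_fourier1 (iu n) (su n) => h _; exact: sqintN.
  - by move=> n w; have /cLfun1P[i1 i2] := iu n; have [] := hpart_fourier w i1 i2.
  - by move=> w bw; have [-> ->] := g0 w bw; rewrite oppr0.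
  - move: ug; rewrite /cnorm2.
    under eq_fun do (under [X in norm2 X + _]eq_fun do rewrite ReB; under [X in _ + norm2 X]eq_fun do rewrite ImB).
    rewrite (_ : (fun _ => _) = (fun n => norm2 (fun w => Im (fourier1 (u n) w) - Im (g w)) +
      norm2 (fun w => - Re (fourier1 (u n) w) - - Re (g w))))//.
    apply/funext => n; rewrite addrC; congr (_ + _); rewrite /norm2; apply: eq_int => w.
    by rewrite -opprD sqrrN.
by exists k1, k2; split => // t; rewrite -e1 -e2; case: (f t).
Qed.

End Bandlimited.

(** * Entire extension by a Fourier-Laplace integral *)

Section EntireExtension.
Context {R : realType}.
Local Notation C := (R[i]).
Local Notation mu := (@lebesgue_measure R).
Local Notation Re := complex.Re.
Local Notation Im := complex.Im.
Local Notation normc := ComplexField.Normc.normc.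

(** Complex differentiability with an explicit remainder: such a bound passes through the integral
    over frequencies and through sums. [K] is complex because the norm is, and [0 <= K] makes it
    real. *)
Definition differs_quadratically (F : C -> C) (z : C) := exists D, exists2 K : C, 0 <= K &
  forall h, `|h| <= 1 -> `|F (z + h) - F z - h * D| <= K * `|h| ^+ 2.

Lemma derivable_quadratic (F : C -> C) (z : C) : differs_quadratically F z ->
  derivable (F : C^o -> C^o) z 1.
Proof.
move=> [D [K K0 hF]]; apply/cvg_ex; exists D; apply/cvgrPdist_lt => e e0.
have K1 : 0 < K + 1 by rewrite ltr_wpDl.
near=> h.
have h0 : h != 0 by near: h; exact: nbhs_dnbhs_neq.
have h1 : `|h| <= 1 by apply: ltW; near: h; exact: dnbhs0_lt.
have h2 : `|h| < e / (K + 1) by near: h; apply: dnbhs0_lt; rewrite divr_gt0.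
have hp : 0 < `|h| by rewrite normr_gt0.
have -> : (F \o shift z) h%:A = F (z + h).
  by rewrite /= addrC; congr (F (_ + _)); exact: mulr1.
rewrite -[h^-1 *: _]/(h^-1 * (F (z + h) - F z)).
have -> : D - h^-1 * (F (z + h) - F z) = - (h^-1 * (F (z + h) - F z - h * D)).
  by field.
rewrite normrN normrM normfV -(ltr_pM2l hp) mulrA mulfV ?gt_eqF// mul1r.
apply: le_lt_trans (hF h h1) _.
rewrite expr2 mulrCA ltr_pM2l//; move: h2; rewrite ltr_pdivlMr//; apply: le_lt_trans.
by rewrite mulrDr mulr1 mulrC lerDl ltW.
Unshelve. all: by end_near.
Qed.

Lemma mean_value0 (f df : R -> R) (a : R) : (forall x, is_derive x (1 : R) f (df x)) ->
  exists2 c, `|c| <= `|a| & f a - f 0 = df c * a.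
Proof.
move=> hf; have cf (x y : R) : {within `[x, y], continuous f}.
  by apply: continuous_subspaceT => t; exact: is_derive_continuous (hf t).
have [a0|a0] := lerP 0 a.
  have [c] := MVT_segment a0 (fun x _ => hf x) (cf 0 a).
  rewrite in_itv/= => /andP[c0 ca]; rewrite subr0 => e; exists c => //.
  by rewrite !ger0_norm.
have [c] := MVT_segment (ltW a0) (fun x _ => hf x) (cf a 0).
rewrite in_itv/= => /andP[c0 ca] e; exists c.
  by rewrite !ler0_norm ?(ltW a0)// lerN2.
by rewrite -opprB e sub0r mulrN opprK.
Qed.

Lemma normr_sin_le (x : R) : `|sin x| <= `|x|.
Proof.
have [c _] := mean_value0 x (fun t => is_derive_sin t).
by rewrite sin0 subr0 => ->; rewrite normrM ler_piMl// cos_max.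
Qed.

(** Half-angle formula: the middle term is [2 sin^2 (x / 2)]. *)
Lemma cosB1_le (x : R) : 0 <= 1 - cos x <= x ^+ 2 / 2.
Proof.
rewrite subr_ge0 cos_le1/=.
have -> : cos x = cos (x / 2) ^+ 2 - sin (x / 2) ^+ 2.
  by rewrite [in LHS](splitr x) cosD -!expr2.
have := cos2Dsin2 (x / 2) => /(congr1 (fun z => z - sin (x / 2) ^+ 2)); rewrite addrK => ->.
have : sin (x / 2) ^+ 2 <= (x / 2) ^+ 2.
  by rewrite -[leLHS]real_normK ?num_real// -[leRHS]real_normK ?num_real// ler_pXn2r ?nnegrE// normr_sin_le.
move: (sin _) => s; lra.
Qed.

(** A quadratic bound is all that [cexp_taylor] uses. By the mean value theorem it suffices that
    [1 - cos c], being at most [2] and at most [c^2 / 2], is at most [|c|]. *)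
Lemma sinB_le (x : R) : `|sin x - x| <= x ^+ 2.
Proof.
have d (t : R) : is_derive t (1 : R) (fun t => sin t - t) (cos t - 1).
  exact: dB (is_derive_sin t) (did t).
have [c cx] := mean_value0 x d; rewrite sin0 !subr0 => ->.
rewrite normrM -[leRHS]real_normK ?num_real// expr2 ler_wpM2r//; apply: le_trans cx.
have /andP[c1 c2] := cosB1_le c; rewrite distrC ger0_norm//.
have c3 := cos_geN1 c.
have [h|h] := lerP 2 `|c|; first by apply: le_trans h; lra.
apply: (le_trans c2); rewrite -real_normK ?num_real//.
have := normr_ge0 c; move: h; move: (`|c|) => r; nra.
Qed.

Lemma expRB1_le (x : R) : `|expR x - 1| <= `|x| * expR `|x|.
Proof.
have h1 := expR_ge1Dx x; have h2 := expR_ge1Dx (- x); rewrite expRN in h2.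
have e0 := expR_gt0 x.
have h3 : expR x - 1 <= x * expR x.
  have := ler_wpM2l (ltW e0) h2; rewrite mulfV ?gt_eqF//; lra.
have [x0|x0] := lerP 0 x.
  by rewrite ger0_norm ?(ger0_norm x0)//; lra.
have ex1 : expR x <= 1 by rewrite expR_le1 ltW.
rewrite ler0_norm; last by lra.
rewrite (ltr0_norm x0).
have : 1 <= expR (- x) by rewrite -expR0 ler_expR oppr_ge0 ltW.
move: (expR (- x)) => E; nra.
Qed.

Lemma expRB1B_le (x : R) : `|expR x - 1 - x| <= x ^+ 2 * expR `|x|.
Proof.
have h1 := expR_ge1Dx x; have h2 := expR_ge1Dx (- x); rewrite expRN in h2.
have e0 := expR_gt0 x.
have h3 : expR x - 1 <= x * expR x.
  have := ler_wpM2l (ltW e0) h2; rewrite mulfV ?gt_eqF//; lra.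
rewrite ger0_norm; last by lra.
apply: (@le_trans _ _ (x * (expR x - 1))); first by lra.
apply: (le_trans (ler_norm _)); rewrite normrM -real_normK ?num_real// expr2 -mulrA.
by apply: ler_wpM2l => //; exact: expRB1_le.
Qed.

Definition cexp (u : C) : C := ((expR (Re u) * cos (Im u)) +i* (expR (Re u) * sin (Im u)))%C.

Lemma cexpD u v : cexp (u + v) = cexp u * cexp v.
Proof.
case: u v => a b [c d]; rewrite /cexp /= expRD cosD sinD.
by rewrite -[RHS]/(_ +i* _)%C; congr (_ +i* _)%C; ring.
Qed.

Lemma normc_cexp u : normc (cexp u) = expR (Re u).
Proof.
rewrite /= !exprMn -mulrDr cos2Dsin2 mulr1 sqrtr_sqr ger0_norm//; exact: expR_ge0.
Qed.

(** Four real errors, two in each coordinate, each at most [r^2 exp r]. *)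
Lemma cexp_taylor u : normc (cexp u - 1 - u) <= 4 * normc u ^+ 2 * expR (normc u).
Proof.
set r := normc u; have ra : `|Re u| <= r := Re_normc u; have rb : `|Im u| <= r := Im_normc u.
have r0 : 0 <= r := normc_ge0 u.
apply: (le_trans (normc_Re_Im _)).
have -> : Re (cexp u - 1 - u) = (expR (Re u) - 1 - Re u) - expR (Re u) * (1 - cos (Im u)).
  by case: (u) => a b /=; ring.
have -> : Im (cexp u - 1 - u) = (expR (Re u) - 1) * sin (Im u) + (sin (Im u) - Im u).
  by case: (u) => a b /=; ring.
move: (Re u) (Im u) ra rb => a b ra rb.
have Ea : expR `|a| <= expR r by rewrite ler_expR.
have E1 : 1 <= expR r by rewrite -expR0 ler_expR.
have Ea' : expR a <= expR r by rewrite ler_expR (le_trans _ ra)// ler_norm.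
have a2 : a ^+ 2 <= r ^+ 2 by rewrite -real_normK ?num_real// ler_pXn2r ?nnegrE.
have b2 : b ^+ 2 <= r ^+ 2 by rewrite -real_normK ?num_real// ler_pXn2r ?nnegrE.
have r2 : 0 <= r ^+ 2 by exact: sqr_ge0.
have t1 : `|expR a - 1 - a| <= r ^+ 2 * expR r.
  by apply: (le_trans (expRB1B_le a)); apply: ler_pM; rewrite ?sqr_ge0 ?expR_ge0.
have /andP[cb1 cb2] := cosB1_le b.
have t2 : `|expR a * (1 - cos b)| <= expR r * r ^+ 2.
  rewrite normrM (ger0_norm cb1) ger0_norm ?expR_ge0//.
  by apply: ler_pM; rewrite ?expR_ge0 ?(le_trans cb2) ?ler_pdivrMr//; lra.
have t3 : `|(expR a - 1) * sin b| <= r ^+ 2 * expR r.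
  rewrite normrM expr2 -mulrA [r * expR r]mulrC mulrA; apply: ler_pM => //.
    apply: (le_trans (expRB1_le a)); apply: ler_pM => //; exact: expR_ge0.
  exact: le_trans (normr_sin_le b) rb.
have t4 : `|sin b - b| <= r ^+ 2 * expR r.
  by apply: (le_trans (sinB_le b)); apply: (le_trans b2); rewrite ler_peMr.
apply: (@le_trans _ _ ((`|expR a - 1 - a| + `|expR a * (1 - cos b)|) + (`|(expR a - 1) * sin b| + `|sin b - b|))).
  by apply: lerD; [exact: ler_normB|exact: ler_normD].
move: t1 t2 t3 t4; move: (`|_|) (`|_ * (1 - _)|) (`|_ * sin _|) (`|sin _ - _|) (r ^+ 2) (expR r) => p q s t X Y.
lra.
Qed.

(** The exponential of [2 pi i w z], with the exponent in coordinates. *)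
Definition cker (z : C) (w : R) : C := cexp ((- (2 * pi * w * Im z)) +i* (2 * pi * w * Re z))%C.

Lemma ckerD z h w : cker (z + h) w = cker z w * cker h w.
Proof.
rewrite /cker -cexpD; congr cexp; case: z h => a b [c d] /=.
by rewrite -[RHS]/(_ +i* _)%C; congr (_ +i* _)%C; ring.
Qed.

Lemma normc_cker (b : R) z w : 0 <= b -> `|w| <= b -> normc (cker z w) <= expR (2 * pi * b * normc z).
Proof.
move=> b0 wb; rewrite /cker normc_cexp ler_expR; have p0 := @pi_ge0 R.
apply: (le_trans (ler_norm _)); rewrite /= normrN !normrM (ger0_norm p0) ger0_norm//.
apply: ler_pM => //; [by rewrite !mulr_ge0| |exact: Im_normc].
by apply: ler_wpM2l => //; rewrite mulr_ge0.
Qed.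

Lemma cker_taylor (b : R) h w : `|w| <= b -> normc h <= 1 ->
  normc (cker h w - 1 - (0 +i* (2 * pi * w))%C * h) <=
  4 * (2 * pi * b) ^+ 2 * expR (2 * pi * b) * normc h ^+ 2.
Proof.
move=> wb h1; have p0 := @pi_ge0 R.
set u : C := ((- (2 * pi * w * Im h)) +i* (2 * pi * w * Re h))%C.
have eu : (0 +i* (2 * pi * w))%C * h = u.
  by rewrite /u; case: (h) => a c /=; rewrite -[LHS]/(_ +i* _)%C; congr (_ +i* _)%C; ring.
have nu : normc u = 2 * pi * `|w| * normc h.
  rewrite -eu ComplexField.Normc.normcM /= expr0n add0r sqrtr_sqr !normrM (ger0_norm p0).
  by rewrite ger0_norm.
rewrite eu.
have nub : normc u <= 2 * pi * b * normc h.
  by rewrite nu ler_wpM2r ?normc_ge0// ler_wpM2l// mulr_ge0.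
have b0 : 0 <= 2 * pi * b by rewrite !mulr_ge0// (le_trans _ wb).
rewrite -/(cker h w) /cker -/u; apply: (le_trans (cexp_taylor u)).
have -> : 4 * (2 * pi * b) ^+ 2 * expR (2 * pi * b) * normc h ^+ 2 =
  4 * (2 * pi * b * normc h) ^+ 2 * expR (2 * pi * b) by ring.
apply: ler_pM.
- by apply: mulr_ge0 => //; exact: sqr_ge0.
- exact: expR_ge0.
- apply: ler_wpM2l => //; apply: lerXn2r => //; rewrite nnegrE ?normc_ge0//.
  exact: mulr_ge0 b0 (normc_ge0 h).
- by rewrite ler_expR (le_trans nub)// ler_piMr.
Qed.

Variable b : R.
Hypothesis b0 : 0 < b.

Lemma int1_PW_continuous (k p : R -> R) : PW b k -> continuous p -> int1 (fun w => k w * p w).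
Proof.
move=> Pk cp; have bb : - b <= b by rewrite ge0_cp// ltW.
have cn : {within `[- b, b], continuous (fun w => `|p w|)}.
  by apply: continuous_subspaceT => x; apply: continuous_comp; [exact: cp|exact: norm_continuous].
have [c _ hc] := EVT_max bb cn.
apply: int1_le (int1Z `|p c| (int1_norm (PW_int1 Pk))).
  apply: measurable_funM; first by case: (PW_sqint Pk).
  exact: continuous_measurable_fun.
move=> w; rewrite normrM mulrC; have [wb|bw] := lerP `|w| b; last by rewrite Pk.2// normr0 !mulr0.
by rewrite ler_wpM2r// hc// in_itv/= -ler_norml.
Qed.

Definition cint (k : R -> R) (E : R -> C) : C :=
  ((\int[mu]_w (k w * Re (E w))) +i* (\int[mu]_w (k w * Im (E w))))%C.

Definition ccont (E : R -> C) :=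
  continuous (fun w => Re (E w)) /\ continuous (fun w => Im (E w)).

Lemma cintB k E F : PW b k -> ccont E -> ccont F ->
  cint k (fun w => E w - F w) = cint k E - cint k F.
Proof.
move=> Pk [c1 c2] [c3 c4]; rewrite /cint -[RHS]/(_ +i* _)%C -!intB; try exact: int1_PW_continuous.
by congr (_ +i* _)%C; apply: eq_int => w; case: (E w) (F w) => ? ? [? ?] /=; rewrite mulrBr.
Qed.

Lemma cintZ k a E : PW b k -> ccont E -> cint k (fun w => a * E w) = a * cint k E.
Proof.
move=> Pk [c1 c2]; case: a => x y; rewrite /cint -[RHS]/(_ +i* _)%C -!intZ; try exact: int1_PW_continuous.
rewrite -intB -?intD; try (by apply: int1Z; exact: int1_PW_continuous).
by congr (_ +i* _)%C; apply: eq_int => w; case: (E w) => ? ? /=; ring.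
Qed.

Lemma normc_cint k E M : PW b k -> ccont E -> (forall w, `|w| <= b -> normc (E w) <= M) ->
  normc (cint k E) <= 2 * (M * \int[mu]_w `|k w|).
Proof.
move=> Pk [c1 c2] EM; apply: (le_trans (normc_Re_Im _)).
have ik := int1_norm (PW_int1 Pk).
rewrite [2 * _]mulr_natl mulr2n -(intZ _ ik).
have h (p : R -> R) : continuous p -> (forall w, `|w| <= b -> `|p w| <= M) ->
    `|\int[mu]_w (k w * p w)| <= \int[mu]_w (M * `|k w|).
  move=> cp pM; have i1 := int1_PW_continuous Pk cp.
  apply: (le_trans (int_abs i1)); apply: int_le; [exact: int1_norm|exact: int1Z|].
  move=> w; rewrite normrM mulrC; have [wb|bw] := lerP `|w| b; last by rewrite Pk.2// normr0 !mulr0.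
  by rewrite ler_wpM2r// pM.
apply: lerD; apply: h => // w /EM; apply: le_trans; [exact: Re_normc|exact: Im_normc].
Qed.

Lemma ccont_cker z : ccont (cker z).
Proof.
have c1 (y : R) : continuous (fun w : R => 2 * pi * w * y).
  by apply: continuous_mul; [apply: continuous_scale; exact: continuous_ident|exact: continuous_const].
have c2 : continuous (fun w : R => expR (- (2 * pi * w * Im z))).
  apply: continuous_compose; last exact: continuous_expR.
  by move=> x; apply: cvgN; exact: c1.
split; apply: continuous_mul => //.
  by apply: continuous_compose (c1 _) _; exact: continuous_cos.
by apply: continuous_compose (c1 _) _; exact: continuous_sin.
Qed.

Lemma ccontM E F : ccont E -> ccont F -> ccont (fun w => E w * F w).
Proof.
move=> [c1 c2] [c3 c4]; split.
  rewrite (_ : (fun _ => _) = fun w => Re (E w) * Re (F w) - Im (E w) * Im (F w)).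
    by apply: continuous_sub; exact: continuous_mul.
  by apply/funext => w; case: (E w) (F w) => ? ? [].
rewrite (_ : (fun _ => _) = fun w => Re (E w) * Im (F w) + Im (E w) * Re (F w)).
  by apply: continuous_add; exact: continuous_mul.
by apply/funext => w; case: (E w) (F w) => ? ? [].
Qed.

Lemma ccontB E F : ccont E -> ccont F -> ccont (fun w => E w - F w).
Proof.
move=> [c1 c2] [c3 c4]; split.
  rewrite (_ : (fun _ => _) = fun w => Re (E w) - Re (F w)); first exact: continuous_sub.
  by apply/funext => w; case: (E w) (F w) => ? ? [].
rewrite (_ : (fun _ => _) = fun w => Im (E w) - Im (F w)); first exact: continuous_sub.
by apply/funext => w; case: (E w) (F w) => ? ? [].
Qed.

Lemma ccont_cst (a : C) : ccont (fun=> a).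
Proof. by split; exact: continuous_const. Qed.

Lemma ccont_lin : ccont (fun w => (0 +i* (2 * pi * w))%C).
Proof. by split; [exact: continuous_const|apply: continuous_scale; exact: continuous_ident]. Qed.

(** Inverse Fourier transform of [k], continued to complex arguments. *)
Definition expint (k : R -> R) (z : C) : C := cint k (cker z).

Lemma expint_quadratic k z : PW b k -> differs_quadratically (expint k) z.
Proof.
(* [D] is the derivative taken under the integral. By [ckerD] only the expansion of the kernel at
   [0] matters; [K] multiplies its constant by the growth of [cker z], the mass of [|k|] and a
   factor [2] for bounding the two coordinates separately. *)
move=> Pk; pose D := cint k (fun w => (0 +i* (2 * pi * w))%C * cker z w).
pose K : R := 2 * (expR (2 * pi * b * normc z) * (4 * (2 * pi * b) ^+ 2 * expR (2 * pi * b)) * \int[mu]_w `|k w|).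
have I0 : 0 <= \int[mu]_w `|k w| by exact: int_ge0.
have K0 : 0 <= K by repeat first [exact: expR_ge0|exact: sqr_ge0|done|apply: mulr_ge0].
exists D, K%:C%C; first by rewrite lecE/= eqxx.
move=> h; rewrite normCE lecE/= eqxx/= => h1.
have -> : expint k (z + h) - expint k z - h * D =
    cint k (fun w => cker z w * (cker h w - 1 - (0 +i* (2 * pi * w))%C * h)).
  have cz := ccont_cker z; have ch := ccont_cker h.
  have cl := ccontM ccont_lin cz.
  rewrite /D /expint -cintZ// -cintB//; last exact: ccont_cker.
  rewrite -cintB//; first last.
  - by apply: ccontM => //; exact: ccont_cst.
  - by apply: ccontB => //; exact: ccont_cker.
  congr (cint k _); apply/funext => w; rewrite ckerD.
  by move: (0 +i* _)%C (cker z w) (cker h w) => p q r; ring.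
have ce : ccont (fun w => cker z w * (cker h w - 1 - (0 +i* (2 * pi * w))%C * h)).
  apply: ccontM (ccont_cker z) _; apply: ccontB; last exact: ccontM ccont_lin (ccont_cst _).
  by apply: ccontB (ccont_cker h) (ccont_cst _).
rewrite !normCE -[X in _ <= X]/(K%:C%C * (normc h)%:C%C ^+ 2) -rmorphXn -rmorphM lecE/= eqxx/=.
have -> : K * normc h ^+ 2 = 2 * ((expR (2 * pi * b * normc z) *
    (4 * (2 * pi * b) ^+ 2 * expR (2 * pi * b) * normc h ^+ 2)) * \int[mu]_w `|k w|).
  rewrite /K; ring.
apply: normc_cint => // w wb.
rewrite ComplexField.Normc.normcM; apply: ler_pM; rewrite ?normc_ge0//.
  by apply: normc_cker => //; exact: ltW.
exact: cker_taylor.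
Qed.

Lemma expint_exp_type k z : PW b k ->
  normc (expint k z) <= 2 * (\int[mu]_w `|k w|) * expR (2 * pi * b * normc z).
Proof.
move=> Pk; rewrite -mulrA [X in 2 * X]mulrC; apply: normc_cint => //; first exact: ccont_cker.
by move=> w wb; apply: normc_cker => //; exact: ltW.
Qed.

Lemma expint_real k (t : R) : PW b k -> expint k t%:C%C = (ctrans k t +i* strans k t)%C.
Proof.
move=> Pk; rewrite /expint /cint /ctrans /strans; congr (_ +i* _)%C; apply: eq_int => w;
by rewrite /cker /cexp /= mulr0 oppr0 expR0 mul1r (mulrAC (2 * pi)).
Qed.

End EntireExtension.

(** * Hartley transforms of band spectra are bandlimited *)

Section PWBandlimited.
Context {R : realType}.
Local Notation C := (R[i]).
Local Notation mu := (@lebesgue_measure R).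
Local Notation Re := complex.Re.
Local Notation Im := complex.Im.
Local Notation normc := ComplexField.Normc.normc.
Variable b : R.
Hypothesis b0 : 0 < b.

Definition entire_of_type (F : C -> C) :=
  (forall z, differs_quadratically F z) /\ exists2 A : R, 0 <= A & forall z, normc (F z) <= A * expR (2 * pi * b * normc z).

Lemma entire_of_typeZ (a : C) F : entire_of_type F -> entire_of_type (fun z => a * F z).
Proof.
move=> [eF [A A0 hA]]; split.
  move=> z; have [D [K K0 hF]] := eF z; exists (a * D), (`|a| * K); first exact: mulr_ge0.
  move=> h /hF h1; have -> : a * F (z + h) - a * F z - h * (a * D) = a * (F (z + h) - F z - h * D) by ring.
  by rewrite normrM -mulrA; apply: ler_wpM2l.
exists (normc a * A); first by rewrite mulr_ge0// normc_ge0.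
by move=> z; rewrite ComplexField.Normc.normcM -[leRHS]mulrA; apply: ler_wpM2l; [exact: normc_ge0|exact: hA].
Qed.

Lemma entire_of_typeD F G : entire_of_type F -> entire_of_type G ->
  entire_of_type (fun z => F z + G z).
Proof.
move=> [eF [A A0 hA]] [eG [B B0 hB]]; split.
  move=> z; have [D [K K0 hF]] := eF z; have [D' [K' K'0 hG]] := eG z.
  exists (D + D'), (K + K'); first exact: addr_ge0.
  move=> h h1; rewrite mulrDl; apply: le_trans (lerD (hF h h1) (hG h h1)).
  rewrite (_ : _ - _ = (F (z + h) - F z - h * D) + (G (z + h) - G z - h * D')); last by ring.
  exact: ler_normD.
exists (A + B); first exact: addr_ge0.
move=> z; rewrite mulrDl; apply: le_trans (lerD (hA z) (hB z)).
by have := ler_normD (F z) (G z); rewrite !normCE -[X in _ <= X]rmorphD lecE/= eqxx.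
Qed.

Lemma PW_reflect k : PW b k -> PW b (fun w => k (- w)).
Proof.
by move=> [sk k0]; split; [exact: sqint_reflect|move=> w bw; rewrite k0// normrN].
Qed.

(* [cos z + sin z = ((1 - i) e ^ (i z) + (1 + i) e ^ (- i z)) / 2]. *)
Lemma hartley_entire k : PW b k -> exists2 F, entire_of_type F &
  forall t : R, F t%:C%C = (hartley k t)%:C%C.
Proof.
move=> Pk; have Pk' := PW_reflect Pk; have ik := PW_int1 Pk.
have good (h : R -> R) : PW b h -> entire_of_type (expint h).
  move=> Ph; split; first by move=> z; exact (expint_quadratic b0 z Ph).
  exists (2 * \int[mu]_w `|h w|); first by rewrite mulr_ge0// int_ge0.
  by move=> z; exact: expint_exp_type.
exists (fun z => (1/2 -i* (1/2))%C * expint k z + (1/2 +i* (1/2))%C * expint (fun w => k (- w)) z).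
  by apply: entire_of_typeD; apply: entire_of_typeZ; exact: good.
move=> t; rewrite (expint_real t Pk) (expint_real t Pk') hartley_ctrans//.
have -> : ctrans (fun w => k (- w)) t = ctrans k t.
  rewrite /ctrans -(int_reflect (int1_cos_lin t ik)).
  by apply: eq_int => w; rewrite mulrN cosN.
have -> : strans (fun w => k (- w)) t = - strans k t.
  rewrite /strans -(int_reflect (int1_sin_lin t ik)) -intN; last first.
    by apply: (int1_reflect (f := fun w => k w * sin (2 * pi * t * w))); exact: int1_sin_lin.
  by apply: eq_int => w; rewrite mulrN sinN mulrN opprK.
move: (ctrans k t) (strans k t) => p q.
by rewrite -[LHS]/(_ +i* _)%C; congr (_ +i* _)%C; field.
Qed.

Lemma hpartD_bound (a c : R -> R) : sqint a -> sqint c ->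
  cnorm2 (fun w => (hpart a (fun w => - c w) w +i* hpart c a w)%C) <= 4 * (norm2 a + norm2 c).
Proof.
move=> sa sc; have h1 := norm2_hpart sa (sqintN sc); have h2 := norm2_hpart sc sa.
have e : norm2 (fun w => - c w) = norm2 c by apply: eq_int => w; rewrite sqrrN.
rewrite /cnorm2/=; rewrite e in h1; lra.
Qed.

Lemma PW_bandlimited sigma k1 k2 : b = sigma / (2 * pi) ->
  PW b k1 -> PW b k2 -> bandlimited sigma (fun t => (hartley k1 t +i* hartley k2 t)%C).
Proof.
move=> eb P1 P2; have [s1 s2] := (PW_sqint P1, PW_sqint P2).
have [i1 i2] := (PW_int1 P1, PW_int1 P2).
have [h1 h2] := (hartley_PW_sqint P1, hartley_PW_sqint P2).
have sf : csqint (fun t => (hartley k1 t +i* hartley k2 t)%C) by [].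
have sg : csqint (fun w => (hpart k1 (fun w => - k2 w) w +i* hpart k2 k1 w)%C).
  by split; apply: hpart_sqint => //; exact: sqintN.
split; first exact/cLfun2P.
(* The Fourier transform in terms of Hartley spectra: its real part is the even part of [k1] plus
   the odd part of [k2], its imaginary part the even part of [k2] minus the odd part of [k1]. *)
- exists (fun w => (hpart k1 (fun w => - k2 w) w +i* hpart k2 k1 w)%C).
    split; first exact/cLfun2P.
    pose p1 (n : nat) (x : R) : R := hartley k1 x * \1_(`[- n%:R, n%:R]) x.
    have [ip1 sp1 c1 d1] : [/\ forall n, int1 (p1 n), forall n, sqint (p1 n),
      norm2 (fun x => p1 n x - hartley k1 x) @[n --> \oo] --> 0 &
      norm2 (fun x => hartley (p1 n) x - k1 x) @[n --> \oo] --> 0] := hartley_truncate_cvg i1 s1.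
    pose p2 (n : nat) (x : R) : R := hartley k2 x * \1_(`[- n%:R, n%:R]) x.
    have [ip2 sp2 c2 d2] : [/\ forall n, int1 (p2 n), forall n, sqint (p2 n),
      norm2 (fun x => p2 n x - hartley k2 x) @[n --> \oo] --> 0 &
      norm2 (fun x => hartley (p2 n) x - k2 x) @[n --> \oo] --> 0] := hartley_truncate_cvg i2 s2.
    pose u n t := (p1 n t +i* p2 n t)%C.
    have uL1 n : cLfun 1%:E (u n) by apply/cLfun1P; split; [exact: ip1|exact: ip2].
    have us n : csqint (u n) by split; [exact: sp1|exact: sp2].
    exists u; split.
    + by move=> n; split => //; exact/cLfun2P.
    + apply/L2norm_cvg0; first by move=> n; exact: csqintB.
      by rewrite -[X in _ --> X](addr0 0); exact: cvgD c1 c2.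
    + apply/L2norm_cvg0; first by move=> n; apply: csqintB => //; exact: csqint_fourier1.
      pose e1 n w := hartley (p1 n) w - k1 w; pose e2 n w := hartley (p2 n) w - k2 w.
      have se1 n : sqint (e1 n) by apply: sqintB => //; have [] := hartley_L2 (ip1 n) (sp1 n).
      have se2 n : sqint (e2 n) by apply: sqintB => //; have [] := hartley_L2 (ip2 n) (sp2 n).
      apply: (@squeeze_cvgr _ _ _ _ (fun=> 0) (fun n => 4 * (norm2 (e1 n) + norm2 (e2 n)))).
      * apply: nearW => n; rewrite cnorm2_ge0/=.
        rewrite [leLHS](_ : _ = cnorm2 (fun w => (hpart (e1 n) (fun w => - e2 n w) w +i* hpart (e2 n) (e1 n) w)%C)).
          exact: hpartD_bound.
        congr cnorm2; apply/funext => w; rewrite fourier1E//; [|exact: ip1|exact: ip2].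
        rewrite /hpart /e1 /e2 -[LHS]/(_ +i* _)%C /u/=.
        rewrite !hartleyN_ctrans// !hartley_ctrans//.
        move: (ctrans _ w) (ctrans _ w) (strans _ w) (strans _ w) => a c p q.
        by congr (_ +i* _)%C; field.
      * exact: cvg_cst.
      * have : 4 * (norm2 (e1 n) + norm2 (e2 n)) @[n --> \oo] --> (4 * (0 + 0) : R).
          by apply: cvgM; [exact: cvg_cst|exact: cvgD d1 d2].
        by rewrite addr0 mulr0.
  (* A frequency off the band has the open set [b < |t|] as a neighbourhood on which the transform
     is identically [0]. *)
  move=> w; apply: contraPP => /= wb.
  apply/existsNP; exists [set t | b < `|t|].
  apply/not_implyP; split; first exact: (open_comp (fun x _ => @norm_continuous _ R x) (@open_gt _ b)).
  apply/not_implyP; split; first by rewrite /= ltNge ler_norml eb; exact/negP.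
  move=> ng; apply: ng; exists set0; split; [exact: measurable0|exact: measure0|move=> t h; apply: h => /= bt].
  have z (k : R -> R) : PW b k -> k t = 0 /\ k (- t) = 0.
    by move=> [_ k0]; rewrite !k0// normrN.
  have [a1 a2] := z _ P1; have [a3 a4] := z _ P2.
  by rewrite /hpart a1 a2 a3 a4; congr (_ +i* _)%C; field.
- have [F1 [e1 [A1 A10 hA1]] r1] := hartley_entire P1.
  have [F2 g2 r2] := hartley_entire P2.
  have g1 : entire_of_type F1 by split => //; exists A1.
  have [e [A A0 hA]] := entire_of_typeD g1 (entire_of_typeZ (0 +i* 1)%C g2).
  exists (fun z => F1 z + (0 +i* 1)%C * F2 z); split => //.
    by move=> z; exact: derivable_quadratic.
    move=> eps eps0; exists A => z; apply: (le_trans (hA z)); apply: ler_wpM2l => //.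
    rewrite ler_expR; apply: ler_wpM2r; first exact: normc_ge0.
    have -> : 2 * pi * b = sigma.
      rewrite eb; have := @pi_gt0 R; move: (@pi R) => p p0; field; lra.
    by rewrite lerDl ltW.
  move=> t; rewrite r1 r2 -[RHS]/(_ +i* _)%C; congr (_ +i* _)%C; ring.
Qed.

End PWBandlimited.

(** * Reconstruction of the derivative *)

Section Synthesis.
Context {R : realType}.
Local Notation C := (R[i]).
Local Notation Re := complex.Re.
Local Notation Im := complex.Im.
Local Notation normc := ComplexField.Normc.normc.
Variable b : R.
Hypothesis b0 : 0 < b.
Local Notation V := (R -> R^o).

(** The derivative of [hartley h], kept as a Hartley transform so that linearity and the norm bounds
    apply to it. *)
Definition synth (h : R -> R) : V := hartley (hderiv h).

Lemma synth_lin a (u v : V) t : PW b u -> PW b v ->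
  synth (a *: u + v) t = a * synth u t + synth v t.
Proof.
by move=> Pu Pv; rewrite /synth hderiv_lin (hartley_lin (b := b))//; exact: hderiv_PW.
Qed.

Lemma synthB (u v : V) t : PW b u -> PW b v -> synth (u - v) t = synth u t - synth v t.
Proof.
move=> Pu Pv; rewrite addrC -scaleN1r synth_lin// mulN1r addrC//.
Qed.

Lemma synth0 t : synth 0 t = 0.
Proof.
have P0 : PW b (0 : V) := si_0 (semi_inner_PW b).
by rewrite -(subrr (0 : V)) synthB// subrr.
Qed.

Lemma synth_sum (K : Type) (s : seq K) (a : K -> R) (d : K -> V) t :
  (forall k, PW b (d k)) ->
  synth (\sum_(k <- s) a k *: d k) t = \sum_(k <- s) a k * synth (d k) t.
Proof.
move=> Pd; have S := semi_inner_PW b; elim: s => [|k s IH]; first by rewrite !big_nil synth0.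
rewrite !big_cons synth_lin// ?IH//; apply: (siP_sum S) => i; exact: (siP_scale S).
Qed.

Lemma norm2_synth (v : V) : PW b v -> norm2 (synth v) <= (2 * pi * b) ^+ 2 * dot v v.
Proof.
move=> Pv; rewrite (hartley_PW_isometry (b := b)) ?norm2_hderiv -?norm2E//; last exact: hderiv_PW.
Qed.

Lemma synth_point (v : V) t : PW b v -> (synth v t) ^+ 2 <= 8 * b * ((2 * pi * b) ^+ 2 * dot v v).
Proof.
move=> Pv; apply: (le_trans (hartley_PW_point b0 t (hderiv_PW Pv))).
apply: ler_wpM2l; first by rewrite mulr_ge0// ltW.
by rewrite -norm2E; exact: norm2_hderiv.
Qed.

Lemma synth_sqint (v : V) : PW b v -> sqint (synth v).
Proof. by move=> Pv; apply: (hartley_PW_sqint (b := b)); exact: hderiv_PW. Qed.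

Definition sums_to (K : choiceType) (a : K -> R) (d : K -> V) (s : V) :=
  forall e : R, 0 < e -> exists J0 : {fset K}, forall J : {fset K}, (J0 `<=` J)%fset ->
    dot (\sum_(k <- J) a k *: d k - s) (\sum_(k <- J) a k *: d k - s) <= e.

Lemma complex_sum (K : Type) (s : seq K) (p q : K -> R) :
  \sum_(k <- s) (p k +i* q k)%C = ((\sum_(k <- s) p k) +i* (\sum_(k <- s) q k))%C :> C.
Proof. by elim: s => [|k s IH]; rewrite ?big_nil// !big_cons IH. Qed.

(** [synth] is bounded into [L2] and at each point, so convergence of spectra gives both required
    modes. Complex coefficients act on the real spectra through their two parts separately. *)
Lemma synth_function_sum (K : choiceType) (a a' : K -> R) (d : K -> V) (s s' : V) :
  (forall k, PW b (d k)) -> PW b s -> PW b s' -> sums_to a d s -> sums_to a' d s' ->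
  has_function_sum (fun k t => (a k +i* a' k)%C * (synth (d k) t)%:C%C)
    (fun t => (synth s t +i* synth s' t)%C).
Proof.
move=> Pd Ps Ps' sa sa'; have S := semi_inner_PW b.
pose w (a : K -> R) (s : V) (J : {fset K}) : V := \sum_(k <- J) a k *: d k - s.
have Pw a1 s1 J : PW b s1 -> PW b (w a1 s1 J).
  by move=> P1; apply: (siP_sub S) => //; apply: (siP_sum S) => k; exact: (siP_scale S).
have wE a1 s1 J t : PW b s1 -> synth (w a1 s1 J) t = \sum_(k <- J) a1 k * synth (d k) t - synth s1 t.
  move=> P1; rewrite /w synthB ?synth_sum//.
  by apply: (siP_sum S) => k; exact: (siP_scale S).
have E J t : partial_sum (fun k => (a k +i* a' k)%C * (synth (d k) t)%:C%C) J - (synth s t +i* synth s' t)%C =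
    (synth (w a s J) t +i* synth (w a' s' J) t)%C :> C.
  rewrite /partial_sum -(big_seq_fsetE _ J xpredT (fun k => (a k +i* a' k)%C * (synth (d k) t)%:C%C)).
  rewrite (eq_bigr (fun k => ((a k * synth (d k) t) +i* (a' k * synth (d k) t))%C)); last first.
    by move=> k _; rewrite -[LHS]/(_ +i* _)%C; congr (_ +i* _)%C; ring.
  by rewrite complex_sum !wE.
set L := (2 * pi * b) ^+ 2.
have L0 : 0 < L by rewrite exprn_gt0// !mulr_gt0// pi_gt0.
have near_small (e : R) : 0 < e -> \forall J \near totally,
    dot (w a s J) (w a s J) + dot (w a' s' J) (w a' s' J) <= e.
  move=> e0; have e2 : 0 < e / 2 by rewrite divr_gt0.
  have [[J1 h1] [J2 h2]] := (sa _ e2, sa' _ e2).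
  apply/totallyP; exists (J1 `|` J2)%fset => J; rewrite fsubUset => /andP[j1 j2].
  by rewrite (splitr e); apply: lerD; [exact: h1|exact: h2].
split.
  apply/L2norm_cvg0.
    move=> J; under eq_fun do rewrite E.
    by split; apply: synth_sqint; exact: Pw.
  apply/cvgrPdist_le => e e0; have e' : 0 < e / L by rewrite divr_gt0.
  apply: filterS (near_small _ e') => J hJ.
  rewrite sub0r normrN ger0_norm ?cnorm2_ge0//.
  under [X in cnorm2 X]eq_fun do rewrite E.
  rewrite /cnorm2/=; apply: (le_trans (lerD (norm2_synth (Pw a s J Ps)) (norm2_synth (Pw a' s' J Ps')))).
  by rewrite -mulrDr -ler_pdivlMl// mulrC.
move=> t; apply/cvgC_normc; apply/cvgrPdist_le => e e0.
have B0 : 0 < 8 * b * L by apply: mulr_gt0 => //; apply: mulr_gt0.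
have e' : 0 < e ^+ 2 / (8 * b * L) by rewrite divr_gt0// exprn_gt0.
apply: filterS (near_small _ e') => J hJ.
rewrite sub0r normrN ger0_norm ?normc_ge0// E.
rewrite -(@ler_pXn2r _ 2) ?nnegrE ?normc_ge0 ?(ltW e0)// sqr_normc/=.
apply: (le_trans (lerD (synth_point t (Pw a s J Ps)) (synth_point t (Pw a' s' J Ps')))).
by rewrite -/L -mulrDr -mulrDr mulrA -ler_pdivlMl// mulrC.
Qed.

(** Duality: a synthesis bound transposes to an analysis bound. If [w] is the synthesis with the
    coefficients [a k] of [u], the sum [T] of their squares equals [dot w u], and Cauchy-Schwarz
    gives [T^2 <= A L T norm2 u]. *)
Lemma synth_bessel (K : choiceType) (d : K -> V) (A : R) (u : R -> R) (J : {fset K}) :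
  0 < A -> (forall k, PW b (d k)) ->
  (forall (J : {fset K}) (a : K -> R),
    dot (\sum_(k <- J) a k *: d k) (\sum_(k <- J) a k *: d k) <= A * \sum_(k <- J) a k ^+ 2) ->
  sqint u ->
  \sum_(k <- J) dot u (synth (d k)) ^+ 2 <= A * (2 * pi * b) ^+ 2 * norm2 u.
Proof.
move=> A0 Pd dA su; have S := @semi_inner_L2 R.
set L := (2 * pi * b) ^+ 2.
have L0 : 0 < L by rewrite exprn_gt0// !mulr_gt0// pi_gt0.
pose a k := dot u (synth (d k)); pose w : V := \sum_(k <- J) a k *: synth (d k).
have sg k : sqint (synth (d k)) := synth_sqint (Pd k).
have Pv : PW b (\sum_(k <- J) a k *: d k).
  by apply: (siP_sum (semi_inner_PW b)) => k; exact: (siP_scale (semi_inner_PW b)).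
have wE : w = synth (\sum_(k <- J) a k *: d k).
  by apply/funext => t; rewrite synth_sum// /w fct_sumE.
have sw : sqint w by rewrite wE; exact: synth_sqint.
have h1 : dot w w <= A * L * \sum_(k <- J) a k ^+ 2.
  rewrite -norm2E wE; apply: (le_trans (norm2_synth Pv)).
  rewrite -/L [leRHS](_ : _ = L * (A * \sum_(k <- J) a k ^+ 2)); last by ring.
  by apply: ler_wpM2l; [exact: ltW|exact: dA].
have h2 : dot w u = \sum_(k <- J) a k ^+ 2.
  rewrite /w (si_suml S)//; last by move=> k; exact: (siP_scale S).
  by apply: eq_bigr => k _; rewrite (siZl S)// (si_sym S)// -/(a k) expr2.
have := si_cauchy_schwarz S sw su; rewrite h2 -[dot u u]norm2E.
have T0 : 0 <= \sum_(k <- J) a k ^+ 2 by apply: sumr_ge0 => k _; exact: sqr_ge0.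
have N0 := norm2_ge0 u; rewrite -/(a _).
move: h1 T0; rewrite -/(\sum_(k <- J) dot u (synth (d k)) ^+ 2) => h1 T0 h3.
have AL0 : 0 < A * L by rewrite mulr_gt0.
have [T00|] := eqVneq (\sum_(k <- J) a k ^+ 2) 0; first by rewrite [leLHS]T00 mulr_ge0// ltW.
move=> Tn0; have Tp : 0 < \sum_(k <- J) a k ^+ 2 by rewrite lt_neqAle eq_sym Tn0.
rewrite -[leLHS]/(\sum_(k <- J) a k ^+ 2) -(ler_pM2l Tp) -expr2.
apply: (le_trans h3); apply: (le_trans (ler_wpM2r N0 h1)).
by rewrite le_eqVlt; apply/orP; left; apply/eqP; ring.
Qed.

End Synthesis.

(** * The sampling frame and its two halves *)

Section Frame.
Context {R : realType}.
Variables (x : int -> R) (gam del b : R).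
Hypothesis (gam0 : 0 < gam).
Hypothesis (gapl : forall i : int, gam <= x (i + 1) - x i).
Hypothesis (gapr : forall i : int, x (i + 1) - x i <= del).
Hypothesis b0 : 0 < b.
Hypothesis bdel : 2 * pi * b * del < 2 * pi.
Local Notation V := (R -> R^o).

Lemma sampling_dual_frame : exists d : int + int -> V, exists2 A : R, 0 < A &
  [/\ forall k, PW b (d k),
    forall (J : {fset int + int}) (a : int + int -> R),
      dot (\sum_(k <- J) a k *: d k) (\sum_(k <- J) a k *: d k) <= A * \sum_(k <- J) a k ^+ 2
  & forall u : V, PW b u -> sums_to (fun k => sample x k u) d u].
Proof.
have [al al0 low] := sample_lower gam0 gapl gapr b0 bdel.
set beta := (2 / gam + del * (2 * pi * b) ^+ 2) * (1 + (2 * pi * b) ^+ 2).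
have up (u : V) : PW b u -> forall J : {fset int + int}, \sum_(k <- J) sample x k u ^+ 2 <= beta * dot u u.
  by move=> Pu J; rewrite -norm2E; exact: (sample_upper gam0 gapl gapr b0).
have low' (u : V) (M : R) : PW b u ->
    (forall J : {fset int + int}, \sum_(k <- J) sample x k u ^+ 2 <= M) -> al * dot u u <= M.
  by move=> Pu h; rewrite -norm2E; exact: low.
have [d [Pd dA ds]] := dual_frame (semi_inner_PW b) (@PW_complete R b)
  (fun k a (u v : V) Pu Pv => @sample_lin R x b k a u v Pu Pv) al0 up low'.
by exists d, al^-1; [rewrite invr_gt0|split].
Qed.

Lemma sum_imfset_inj (K K' : choiceType) (f : K -> K') (J : {fset K}) (U : nmodType) (F : K' -> U) :
  injective f -> \sum_(k <- [fset f i | i in J]%fset) F k = \sum_(i <- J) F (f i).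
Proof.
move=> fI; rewrite (perm_big _ (enum_imfset _ _))/=; last by move=> i j _ _; exact: fI.
by rewrite big_map.
Qed.

(** Values and derivatives have to be summed separately. Half of the samples is still square
    summable and the synthesis bound restricts to half of the family, so the half series converges,
    though in general not to [u]. *)
Lemma half_synthesis (d : int + int -> V) (A : R) (f : int -> int + int) (u : V) :
  injective f -> (forall k, PW b (d k)) ->
  (forall (J : {fset int + int}) (a : int + int -> R),
    dot (\sum_(k <- J) a k *: d k) (\sum_(k <- J) a k *: d k) <= A * \sum_(k <- J) a k ^+ 2) ->
  PW b u ->
  exists2 s : V, PW b s & sums_to (fun i => sample x (f i) u) (fun i => d (f i)) s.
Proof.
move=> fI Pd dA Pu.
pose M := (2 / gam + del * (2 * pi * b) ^+ 2) * (1 + (2 * pi * b) ^+ 2) * norm2 u.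
apply: (bessel_synthesis (semi_inner_PW b) (@PW_complete R b) (A := A) (M := M)) => //.
  (* Coefficients extended by [0] off the image of [f], so that the bound for the whole family
     applies. *)
  move=> J a; pose r (k : int + int) := if [pick i : J | f (val i) == k] is Some i then a (val i) else 0.
  have rE i : i \in J -> r (f i) = a i.
    move=> iJ; rewrite /r; case: pickP => [j /eqP/fI ->//|/(_ [` iJ]%fset)].
    by rewrite eqxx.
  have := dA [fset f i | i in J]%fset r.
  rewrite !sum_imfset_inj// (eq_big_seq (fun i => a i *: d (f i))); last by move=> i /rE ->.
  by rewrite [X in _ <= A * X -> _](eq_big_seq (fun i => a i ^+ 2)); last by move=> i /rE ->.
move=> J; have := sample_upper gam0 gapl gapr b0 Pu [fset f i | i in J]%fset.
by rewrite sum_imfset_inj.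
Qed.

(** The two half limits and the joint limit are compared on one finite set adapted to all three. The
    spectra agree only up to a null function, which [synth] sends to [0] at every point. *)
Lemma sums_to_add (c : int + int -> R) (d : int + int -> V) (s1 s2 u : V) :
  (forall k, PW b (d k)) -> PW b s1 -> PW b s2 -> PW b u ->
  sums_to (fun i => c (inl i)) (fun i => d (inl i)) s1 ->
  sums_to (fun i => c (inr i)) (fun i => d (inr i)) s2 ->
  sums_to c d u -> forall t, synth u t = synth s1 t + synth s2 t.
Proof.
move=> Pd P1 P2 Pu h1 h2 h t; have S := semi_inner_PW b.
pose w : V := s1 + s2 - u.
have Pw : PW b w by apply: (siP_sub S) => //; exact: (siP_add S).
(* [10 = 2 + 2 (2 + 2)]: two applications of the inequality between the square of a sum and twice
   the squares, with three errors of size [e]. *)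
have small (e : R) : 0 < e -> dot w w <= 10 * e.
  move=> e0; have [[J1 g1] [J2 g2] [J0 g]] := And3 (h1 e e0) (h2 e e0) (h e e0).
  pose r (k : int + int) : int := match k with inl i => i | inr i => i end.
  (* Adding the integers that underlie [J0] makes the union of the two tagged sets contain [J0]. *)
  pose J1' := (J1 `|` [fset r k | k in J0])%fset.
  pose J2' := (J2 `|` [fset r k | k in J0])%fset.
  pose I1 : {fset int + int} := [fset inl i | i in J1']%fset.
  pose I2 : {fset int + int} := [fset inr i | i in J2']%fset.
  have JI : (J0 `<=` I1 `|` I2)%fset.
    apply/fsubsetP => -[] i iJ; rewrite in_fsetU; apply/orP; [left|right];
      (apply/imfsetP; exists i => //; rewrite in_fsetU; apply/orP; right; apply/imfsetP).
      by exists (inl i).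
    by exists (inr i).
  have D : ((I1 `|` I2) `\` I1 = I2)%fset.
    apply/fsetP => k; rewrite in_fsetD in_fsetU.
    case: (boolP (k \in I1)) => //= /imfsetP[i _ ->]; apply/esym/negbTE/negP => /imfsetP[j _].
    by [].
  have := g _ JI; have := g1 J1' (fsubsetUl _ _); have := g2 J2' (fsubsetUl _ _).
  rewrite (sum_fset_split _ (fsubsetUl I1 I2)) D !sum_imfset_inj//; try by move=> ? ? [].
  set q1 : V := \sum_(k <- J1') _; set q2 : V := \sum_(k <- J2') _.
  have Q1 : PW b q1 by apply: (siP_sum S) => k; exact: (siP_scale S).
  have Q2 : PW b q2 by apply: (siP_sum S) => k; exact: (siP_scale S).
  have -> : w = (q1 + q2 - u) - ((q1 - s1) + (q2 - s2)).
    by rewrite /w; apply/funext => z; rewrite !fctE; ring.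
  have A1 := siP_sub S Q1 P1; have A2 := siP_sub S Q2 P2.
  have A3 := siP_sub S (siP_add S Q1 Q2) Pu.
  have := si_sqrB_le2 S A3 (siP_add S A1 A2); have := si_sqrD_le2 S A1 A2.
  move: (dot _ _) (dot (_ + _) _) (dot (q1 - s1) _) (dot (q2 - s2) _) (dot (q1 + q2 - u) _) => v1 v2 v3 v4 v5.
  lra.
have w0 : dot w w <= 0.
  by apply/ler_addgt0Pr => e e0; have := small (e / 10); rewrite divr_gt0// => /(_ isT); lra.
have := synth_point b0 t Pw.
have sw0 : synth w t = synth s1 t + synth s2 t - synth u t.
  rewrite /w (synthB (b := b))//; last exact: (siP_add S).
  by rewrite -[s1](scale1r s1) (synth_lin (b := b))// mul1r scale1r.
rewrite -[dot w w]norm2E in w0 *.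
have -> : norm2 w = 0 by apply/eqP; rewrite eq_le w0 norm2_ge0.
rewrite !mulr0 => h0; have : synth w t ^+ 2 == 0 by rewrite eq_le h0 sqr_ge0.
rewrite sqrf_eq0 sw0 subr_eq0 => /eqP.
by [].
Qed.

End Frame.

(** * The reconstruction theorem *)

Section Main.
Context {R : realType}.
Local Notation C := (R[i]).
Local Notation Re := complex.Re.
Local Notation Im := complex.Im.
Local Notation normc := ComplexField.Normc.normc.

Lemma gap_bounds (sigma : R) (x : int -> R) : (forall i : int, x i < x (i + 1)) ->
  separated_points x -> (max_gap x < (2 * pi / sigma)%:E)%E ->
  exists gam del : R, [/\ 0 < gam, forall i : int, gam <= x (i + 1) - x i,
    forall i : int, x (i + 1) - x i <= del & del < 2 * pi / sigma].
Proof.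
move=> xi [gam gam0 sep] gap.
have ub i : ((x (i + 1) - x i)%:E <= max_gap x)%E by apply: ereal_sup_ubound; exists i.
(* [-oo] is excluded by any single gap, [+oo] by the strict upper bound. *)
have fin : max_gap x \is a fin_num.
  apply: fin_real; apply/andP; split; [exact: lt_le_trans (ltNyr _) (ub 0)|exact: lt_trans gap (ltry _)].
exists gam; exists (fine (max_gap x) : R); split => //.
- move=> i; rewrite -lee_fin; apply: (le_trans sep); apply: ereal_inf_lbound.
  exists (i + 1, i) => /=; last by rewrite gtr0_norm// subr_gt0.
  by move/eqP; rewrite -subr_eq0 addrAC subrr add0r oner_eq0.
- by move=> i; rewrite -lee_fin fineK.
- by rewrite -lte_fin fineK.
Qed.

Lemma cderive_hartley (b : R) k1 k2 : 0 < b -> PW b k1 -> PW b k2 ->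
  cderive (fun t => (hartley k1 t +i* hartley k2 t)%C) = (fun t => (synth k1 t +i* synth k2 t)%C).
Proof.
move=> b0 P1 P2; apply/funext => t; rewrite /cderive; congr (_ +i* _)%C.
  by rewrite derive1E; have [_ ->] := hartley_deriv b0 t P1.
by rewrite derive1E; have [_ ->] := hartley_deriv b0 t P2.
Qed.

Lemma esum_le_fset (K : choiceType) (a : K -> R) (M : R) :
  (forall J : {fset K}, \sum_(k <- J) a k <= M) ->
  (\esum_(k in [set: K]) (a k)%:E <= M%:E)%E.
Proof.
move=> aM; apply: ge_ereal_sup => _ [A [fA _] <-].
by rewrite fsumEFin// lee_fin fsbig_finite.
Qed.

Lemma itg_hartley (b : R) k (a c : R) : 0 < b -> PW b k -> a <= c ->
  itg a c (synth k) = hartley k c - hartley k a.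
Proof.
move=> b0 Pk ac; apply: itg_FTC => //; first by move=> t _; exact: (hartley_deriv b0 t Pk).
apply: continuous_cont_on; exact: (hartley_PW_continuous b0 (hderiv_PW Pk)).
Qed.

Lemma ointegral_cderive (b : R) k1 k2 (a c : R) : 0 < b -> PW b k1 -> PW b k2 ->
  ointegral a c (fun t => (synth k1 t +i* synth k2 t)%C) =
    (hartley k1 c +i* hartley k2 c)%C - (hartley k1 a +i* hartley k2 a)%C.
Proof.
move=> b0 P1 P2.
have h p q : p <= q -> cintegral `[p, q]%classic (fun t => (synth k1 t +i* synth k2 t)%C) =
    (hartley k1 q +i* hartley k2 q)%C - (hartley k1 p +i* hartley k2 p)%C.
  move=> pq; rewrite /cintegral/= -[LHS]/(itg p q (synth k1) +i* itg p q (synth k2))%C.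
  by rewrite !(itg_hartley b0).
rewrite /ointegral; case: ifPn => ac; first exact: h.
by rewrite h ?opprB// ltW// ltNge.
Qed.

(** The frame functions are real, so the squared modulus of a coefficient splits into the squared
    coefficients of the two parts of [f]. *)
Lemma bessel_frame (b : R) (K : choiceType) (d : K -> R -> R^o) (A : R) :
  0 < b -> 0 < A -> (forall k, PW b (d k)) ->
  (forall (J : {fset K}) (a : K -> R),
    dot (\sum_(k <- J) a k *: d k) (\sum_(k <- J) a k *: d k) <= A * \sum_(k <- J) a k ^+ 2) ->
  forall f : R -> C, csqint f ->
  (\esum_(k in [set: K]) ((normc (L2dot f (fun t => (synth (d k) t)%:C%C)) ^+ 2)%:E)
   <= (A * (2 * pi * b) ^+ 2)%:E * L2norm f ^+ 2)%E.
Proof.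
move=> b0 A0 Pd dA f sf; rewrite L2norm_sqr// -EFinM; apply: esum_le_fset => J.
under eq_bigr do rewrite L2dot_real sqr_normc/=.
rewrite big_split/= /cnorm2 mulrDr; have [s1 s2] := sf.
by apply: lerD; exact: (synth_bessel b0 J A0 Pd dA).
Qed.

End Main.

Theorem theorem1p1 (R : realType) (sigma : R) (x : int -> R)
    (sigma_gt0 : 0 < sigma)
    (x_incr : forall i : int, x i < x (i + 1))
    (x_sep : separated_points x)
    (x_gap : (max_gap x < (2 * pi / sigma)%:E)%E) :
  (exists g1 g2 : int -> R -> R[i],
    bessel_sequence sigma
      (fun k : int + int => match k with inl i => g1 i | inr i => g2 i end) /\
    forall f : R -> R[i], bandlimited sigma f ->
      exists S1 S2 : R -> R[i],
        has_function_sum (fun i t => f (x i) * g1 i t) S1 /\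
        has_function_sum (fun i t => cderive f (x i) * g2 i t) S2 /\
        forall t : R, cderive f t = S1 t + S2 t) /\
  (forall f : R -> R[i], bandlimited sigma f ->
    forall (i : int) (t : R),
      f t = ointegral (x i) t (cderive f) + f (x i)).
Proof.
set b := sigma / (2 * pi).
have p0 := @pi_gt0 R.
have b0 : 0 < b by rewrite divr_gt0// mulr_gt0.
have bE : 2 * pi * b = sigma by rewrite /b; move: (@pi R) p0 => p p0; field; lra.
have repr (f : R -> R[i]) : bandlimited sigma f -> exists k1 k2,
    [/\ PW b k1, PW b k2 & f = fun t => (hartley k1 t +i* hartley k2 t)%C].
  by move=> /(bandlimited_PW sigma_gt0)[k1 [k2 [P1 P2 e]]]; exists k1, k2; split => //; apply/funext.
split; last first.
  move=> f /repr[k1 [k2 [P1 P2 ->]]] i t.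
  by rewrite (cderive_hartley b0)// (ointegral_cderive _ _ b0)// subrK.
have [gam [del [gam0 gapl gapr dels]]] := gap_bounds x_incr x_sep x_gap.
have bdel : 2 * pi * b * del < 2 * pi.
  by rewrite bE mulrC -ltr_pdivlMr.
have [d [A A0 [Pd dA dS]]] := sampling_dual_frame gam0 gapl gapr b0 bdel.
pose g k t : R[i] := ((synth (d k) t)%:C)%C.
(* The functions are real, so their imaginary spectrum is [0]. *)
have gB k : bandlimited sigma (g k).
  have P0 : PW b (0 : R -> R^o) := si_0 (semi_inner_PW b).
  have := PW_bandlimited b0 erefl (hderiv_PW (Pd k)) P0.
  by rewrite hartley_0_fun.
exists (fun i => g (inl i)), (fun i => g (inr i)); split.
  rewrite (_ : (fun k : int + int => _) = g); last by apply/funext => -[].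
  split=> //; exists (A * (2 * pi * b) ^+ 2).
    by rewrite mulr_gt0// exprn_gt0// bE.
  move=> f [/cLfun2P sf _ _]; exact: bessel_frame.
move=> f /repr[k1 [k2 [P1 P2 ->]]]; rewrite (cderive_hartley b0)//.
have inlI : injective (@inl int int) by move=> ? ? [].
have inrI : injective (@inr int int) by move=> ? ? [].
(* The same real family serves the spectra [k1] and [k2] of the real and imaginary parts. *)
have half (u : R -> R^o) (Pu : PW b u) := (half_synthesis gam0 gapl gapr b0 inlI Pd dA Pu,
  half_synthesis gam0 gapl gapr b0 inrI Pd dA Pu).
have [[s1 Q1 h1] [s2 Q2 h2]] := half k1 P1.
have [[s1' Q1' h1'] [s2' Q2' h2']] := half k2 P2.
exists (fun t => (synth s1 t +i* synth s1' t)%C), (fun t => (synth s2 t +i* synth s2' t)%C).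
split; first exact (synth_function_sum b0 (fun i => Pd (inl i)) Q1 Q1' h1 h1').
split; first exact (synth_function_sum b0 (fun i => Pd (inr i)) Q2 Q2' h2 h2').
move=> t; rewrite (sums_to_add b0 Pd Q1 Q2 P1 h1 h2 (dS _ P1)).
by rewrite (sums_to_add b0 Pd Q1' Q2' P2 h1' h2' (dS _ P2)).
Qed.
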